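(* There exists $\alpha_0>0$ such that for every $\alpha\ge\alpha_0$ the following holds. There are a non-zero, divergence-free (in the sense of distributions) and mean-free initial datum $B_0\in L^\infty(\mathbb T^3;\mathbb R^3)$ and constants $\lambda_2,C>0$ such that for every $1\le p\le\infty$ the solution $B$ of the ideal induction equation with velocity $\widetilde u_\alpha$ and initial datum $B_0$ satisfies $$\|B(t,\cdot)\|_{L^p}\ \le\ C\,e^{-\lambda_2 t}\,\|B_0\|_{L^p}\qquad\text{for all }t\ge 0 .$$
   Context: $\mathbb T=\mathbb R/2\pi\mathbb Z$, $\mathbb T^3=\mathbb R^3/(2\pi\mathbb Z)^3$, with points $\boldsymbol x=(x,y,z)$. Let $h:\mathbb T\to[0,\pi]$ be the $2\pi$-periodic function with $h(s)=|s-\pi|$ for $s\in[0,2\pi)$. For $\alpha\in\mathbb R$ and $t\in\mathbb R$ put $\tau=t-\lfloor t\rfloor\in[0,1)$ and define $$u_\alpha(t,x,y,z)=3\alpha\begin{cases}(h(y),0,0),&0\le\tau<1/3,\\(0,h(z),0),&1/3\le\tau<2/3,\\(0,0,h(x)),&2/3\le\tau<1.\end{cases}$$ The reversed velocity is $\widetilde u_\alpha(t,\boldsymbol x)=-u_\alpha(1-t,\boldsymbol x)$ for $0\le t<1$, extended one-periodically in $t$. Let $\widetilde\phi_t$ be the flow map of $\widetilde u_\alpha$, i.e. $\frac{d}{dt}\widetilde\phi_t(\boldsymbol x)=\widetilde u_\alpha(t,\widetilde\phi_t(\boldsymbol x))$, $\widetilde\phi_0(\boldsymbol x)=\boldsymbol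 x$; it is a volume-preserving bi-Lipschitz homeomorphism of $\mathbb T^3$. The ideal induction equation is $\partial_tB+(u\cdot\nabla)B=(B\cdot\nabla)u$, $\operatorname{div}B=0$, $B(0,\cdot)=B_0$. Its solution with velocity $u=\widetilde u_\alpha$ means the Lagrangian solution, defined for almost every $\boldsymbol x$ by $$B(t,\boldsymbol x)=D\widetilde\phi_t(\widetilde\phi_t^{-1}(\boldsymbol x))\,B_0(\widetilde\phi_t^{-1}(\boldsymbol x)).$$ Mean-free means $\int_{\mathbb T^3}B_0\,d\boldsymbol x=0$. *)

(* Defs.v *)
From HB Require Import structures.
From mathcomp Require Import all_boot all_order all_algebra.
From mathcomp Require Import all_classical all_reals all_analysis.

Set Implicit Arguments.
Unset Strict Implicit.
Unset Printing Implicit Defensive.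

Import Order.TTheory GRing.Theory Num.Theory.
Import numFieldNormedType.Exports.

Local Open Scope classical_set_scope.
Local Open Scope ring_scope.

(* Functions and fields on the torus T^3 = R^3/(2 pi Z)^3 are represented by
   (2 pi Z)^3-periodic maps on R^3; integrals, L^p norms and "almost every"
   refer to the fundamental cell [0, 2 pi[^3.  Maps of the torus into itself
   (flow maps) are represented by their lifts to R^3.
   A point (x, y, z) is ((x, y), z) : R * R * R, so that
   x = p.1.1, y = p.1.2, z = p.2.  The topology (sup norm), differentials and
   Borel sets on R * R * R are those of the library. *)

Section torus.
Context {R : realType}.

(* The library's Lebesgue measure lives on the alias [measurableTypeR R]; it
   is transported to R itself, whose Borel sets are the same by conversion. *)
Definition leb : set R -> \bar R := @lebesgue_measure R.

HB.instance Definition _ := isMeasure.Build _ R R leb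
  (@measure0 _ _ _ (@lebesgue_measure R))
  (@measure_ge0 _ _ _ (@lebesgue_measure R))
  (@measure_semi_sigma_additive _ _ _ (@lebesgue_measure R)).

Lemma leb_sigma_finite : sigma_finite setT leb.
Proof. exact: (@sigma_finiteT _ _ _ (@lebesgue_measure R)). Qed.

HB.instance Definition _ :=
  @Measure_isSigmaFinite.Build _ _ _ leb leb_sigma_finite.

(* For a product measure the library infers sigma-finiteness only from
   subprobabilities, hence the explicit instances on the plane. *)
Definition leb2 : set (R * R) -> \bar R := (leb \x leb)%E.

HB.instance Definition _ := isMeasure.Build _ (R * R)%type R leb2
  (@measure0 _ _ _ (leb \x leb)%E)
  (@measure_ge0 _ _ _ (leb \x leb)%E)
  (@measure_semi_sigma_additive _ _ _ (leb \x leb)%E).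

Lemma leb2_sigma_finite : sigma_finite setT leb2.
Proof.
have /sigma_finiteP[F [TF ndF Foo]] := sigma_finiteT (@lebesgue_measure R).
exists (fun n => F n `*` F n).
  rewrite -setXTT TF predeqE => -[x y]; split.
    move=> [/= [n _ Fnx] [k _ Fky]]; exists (maxn n k) => //; split.
    - by move: x Fnx; exact/subsetPset/ndF/leq_maxl.
    - by move: y Fky; exact/subsetPset/ndF/leq_maxr.
  by move=> [n _ []/= ? ?]; split; exists n.
move=> k; have [mFk Fkoo] := Foo k.
split; first exact: measurableX.
rewrite /leb2 product_measure1E// lte_mul_pinfty//.
by rewrite ge0_fin_numE.
Qed.

HB.instance Definition _ :=
  @Measure_isSigmaFinite.Build _ _ _ leb2 leb2_sigma_finite.

Definition vol : set (R * R * R) -> \bar R := (leb2 \x leb)%E.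

HB.instance Definition _ := isMeasure.Build _ (R * R * R)%type R vol
  (@measure0 _ _ _ (leb2 \x leb)%E)
  (@measure_ge0 _ _ _ (leb2 \x leb)%E)
  (@measure_semi_sigma_additive _ _ _ (leb2 \x leb)%E).

Definition cell : set (R * R * R) :=
  `[0, 2 * pi[ `*` `[0, 2 * pi[ `*` `[0, 2 * pi[.

Definition torus_periodic (T : Type) (f : R * R * R -> T) : Prop :=
  forall x y z : R, [/\ f (x + 2 * pi, y, z) = f (x, y, z),
    f (x, y + 2 * pi, z) = f (x, y, z) & f (x, y, z + 2 * pi) = f (x, y, z)].

Definition dot (v w : R * R * R) : R :=
  v.1.1 * w.1.1 + v.1.2 * w.1.2 + v.2 * w.2.

Definition enorm (v : R * R * R) : R := Num.sqrt (dot v v).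

Definition torus_Lnorm (p : \bar R) (B : R * R * R -> R * R * R) : \bar R :=
  ('N[vol]_p[(fun x => (enorm (B x))%:E) \_ cell])%E.

Definition torus_field (B : R * R * R -> R * R * R) : Prop :=
  torus_periodic B /\ measurable_fun setT B.

Definition torus_Linfty (B : R * R * R -> R * R * R) : Prop :=
  torus_field B /\ (torus_Lnorm +oo B < +oo)%E.

Definition ae_zero (B : R * R * R -> R * R * R) : Prop :=
  {ae vol, forall x, cell x -> B x = 0}.

Definition mean_free (B : R * R * R -> R * R * R) : Prop :=
  [/\ (\int[vol]_(x in cell) ((B x).1.1)%:E = 0)%E,
      (\int[vol]_(x in cell) ((B x).1.2)%:E = 0)%E
    & (\int[vol]_(x in cell) ((B x).2)%:E = 0)%E].

Fixpoint Ck (k : nat) (f : R * R * R -> R) : Prop :=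
  if k is k'.+1 then
    (forall x, differentiable f x) /\ (forall v, Ck k' (fun x => 'D_v f x))
  else continuous f.

Definition test_function (f : R * R * R -> R) : Prop :=
  torus_periodic f /\ forall k, Ck k f.

Definition grad (f : R * R * R -> R) (x : R * R * R) : R * R * R :=
  ('D_(1, 0, 0) f x, 'D_(0, 1, 0) f x, 'D_(0, 0, 1) f x).

Definition div_free (B : R * R * R -> R * R * R) : Prop :=
  forall f, test_function f ->
    (\int[vol]_(x in cell) (dot (B x) (grad f x))%:E = 0)%E.

Definition hprofile (s : R) : R :=
  `|s - 2 * pi * (Num.floor (s / (2 * pi)))%:~R - pi|.

Definition tfrac (t : R) : R := t - (Num.floor t)%:~R.

Definition velocity (alpha t : R) (x : R * R * R) : R * R * R :=
  (3 * alpha) *: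
    (if tfrac t < 1 / 3 then (hprofile x.1.2, 0, 0)
     else if tfrac t < 2 / 3 then (0, hprofile x.2, 0)
     else (0, 0, hprofile x.1.1)).

Definition velocity_rev (alpha t : R) (x : R * R * R) : R * R * R :=
  - velocity alpha (1 - tfrac t) x.

(* The velocities above are constant in time between consecutive points of
   Z/3 and jump there, so the flow is continuous in time and satisfies the
   differential equation off Z/3. *)
Definition is_flow (v : R -> R * R * R -> R * R * R)
    (phi : R -> R * R * R -> R * R * R) : Prop :=
  forall x, [/\ phi 0 x = x,
    {within `[0, +oo[, continuous (fun t : R => phi t x)}
  & forall t : R, 0 < t -> 3 * t \isn't a Num.int ->
      is_derive t (1 : R) (fun s => phi s x) (v t (phi t x))].

(* [psi t] is the inverse of the flow map [phi t]. *)
Definition lagrangian_solution (v : R -> R * R * R -> R * R * R)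
    (B0 : R * R * R -> R * R * R) (B : R -> R * R * R -> R * R * R) : Prop :=
  exists phi psi : R -> R * R * R -> R * R * R,
    is_flow v phi /\
    forall t : R, 0 <= t ->
      [/\ cancel (phi t) (psi t), cancel (psi t) (phi t), torus_field (B t)
        & {ae vol, forall x, cell x ->
            differentiable (phi t) (psi t x) /\
            B t x = 'd (phi t) (psi t x) (B0 (psi t x))}].

End torus.

(* Main.v *)
Require Import Defs.
From HB Require Import structures.
From mathcomp Require Import all_boot all_order all_algebra.
From mathcomp Require Import all_classical all_reals all_analysis.
From mathcomp Require Import measurable_realfun ess_sup_inf ring lra.

Set Implicit Arguments.
Unset Strict Implicit.
Unset Printing Implicit Defensive.

Import Order.TTheory GRing.Theory Num.Theory.
Import numFieldNormedType.Exports.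

Local Open Scope classical_set_scope.
Local Open Scope ring_scope.

(** Write [h] for the profile.  If the coordinates are permuted cyclically after
    each third of a unit of time, the reversed flow does the same thing in every
    third: the shear-and-permute map [step], (x, y, z) |-> (z - alpha h(x), x, y).
    The orbit of a point is then a scalar sequence [w_n] ([coordinate]) with
    w_{n+3} = w_n - alpha h(w_{n+2}), and a vector carried by the flow is a
    solution of the linearised recurrence s_{n+3} = s_n - alpha e_n s_{n+2}, where
    e_n = 1 or -1 is the slope of [h] at [w_{n+2}].

    For alpha >= 20 this recurrence has one expanding direction, that of
    (1, 0, 0) ([expanding_growth]), while by a maximum principle a solution that
    vanishes at time N and is at most 1 at the times 0 and 1 is bounded by
    4 * 4^-n up to time N ([contracting_bound]).  So a vector orthogonal to the
    normalised gradient sigma_N of [w_N], whose first component is 1, decays up to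
    time N, and a field that is orthogonal to the limit of the sigma_N at each
    point decays for ever.  The difficulty is to find one that is
    divergence-free.

    Off the kinks of [h] the field sigma_N is locally constant, so that
    curl(Psi sigma_N) = grad Psi x sigma_N is orthogonal to sigma_N for every
    function Psi; it is a divergence-free bounded function as soon as Psi sigma_N
    is Lipschitz, i.e. as soon as Psi vanishes where sigma_N jumps
    ([potential_lipschitz]).  This is achieved by the product Psi_N of sin(w_1) and
    of cut-offs F_k(w_k), 2 <= k < N, with F_k = 0 at the kinks, F_k = 1 outside a
    strip of width of order 2^-k and |F_k'| of order 2^k.  The gradients of the
    Psi_N diverge, but the curls B_N = grad Psi_N x sigma_N converge at every point:
    passing from N to N + 1 multiplies the last two components by F_N, up to an error
    of order 2^-N that combines the growth 2^N of the derivatives with the decay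
    4^-N ([leafwise_step]), and a sequence damped by factors in [0, 1] up to summable
    errors converges ([damped_cvg]); orthogonality to sigma_N gives the first
    component.

    The initial field is the limit B_0 of the B_N.  It is divergence-free and
    mean-free by bounded convergence, since the B_N are bounded and integrate to
    zero against gradients ([cross_derivative_integral], [curl_approx_div_free]).
    It decays in the supremum norm at the rate 4^-3 per unit of time
    ([dflow_decay]).  It is not zero: as the flow preserves the volume, the strips
    where some cut-off is active have a small total volume, and off them the last
    component of B_0 is -cos y ([unstable_field_good], [vol_good_set]).  Being
    bounded below on a set of positive measure, B_0 has an L^p norm comparable with
    its supremum, uniformly in p, so that the bound on the supremum of the solution
    gives all the L^p bounds ([torus_Lnorm_compare]).  They hold for every
    Lagrangian solution because the flow is unique: along a trajectory the
    velocity is constant in each third of a unit of time ([flow_unique]). *)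

(** * Integration over the cell and volume-preserving maps of the torus *)

Section tonelli_rectangle.
Local Open Scope ereal_scope.
Context d1 d2 (T1 : measurableType d1) (T2 : measurableType d2) (R : realType).
Context (m1 : {sigma_finite_measure set T1 -> \bar R})
        (m2 : {sigma_finite_measure set T2 -> \bar R}).
Context (D1 : set T1) (D2 : set T2) (mD1 : measurable D1) (mD2 : measurable D2).
Context (g : T1 * T2 -> \bar R) (mg : measurable_fun setT g)
        (g0 : forall x, 0 <= g x).

Let gD := g \_ (D1 `*` D2).

Let mgD : measurable_fun setT gD.
Proof.
apply/(measurable_restrictT _ _).1; first exact: measurableX.
exact: measurable_funTS.
Qed.

Let gD0 p : 0 <= gD p.
Proof. by rewrite /gD patchE; case: ifPn. Qed.

Lemma tonelli_rect1 : \int[m1 \x m2]_(p in D1 `*` D2) g p =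
  \int[m1]_(x in D1) \int[m2]_(y in D2) g (x, y).
Proof.
rewrite integral_mkcond (@fubini_tonelli1 _ _ _ _ _ m1 m2 gD mgD gD0) [RHS]integral_mkcond.
apply: eq_integral => x _; rewrite /fubini_F patchE.
case: ifPn => [/set_mem D1x|/negP D1x].
  rewrite [RHS]integral_mkcond; apply: eq_integral => y _; rewrite /gD !patchE.
  by rewrite in_setX/= mem_set.
rewrite integral0_eq// => y _; rewrite /gD patchE in_setX/=.
by case: (x \in D1) D1x => // /(_ isT).
Qed.

Lemma tonelli_rect2 : \int[m1 \x m2]_(p in D1 `*` D2) g p =
  \int[m2]_(y in D2) \int[m1]_(x in D1) g (x, y).
Proof.
rewrite integral_mkcond (@fubini_tonelli2 _ _ _ _ _ m1 m2 gD mgD gD0) [RHS]integral_mkcond.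
apply: eq_integral => y _; rewrite /fubini_G patchE.
case: ifPn => [/set_mem D2y|/negP D2y].
  rewrite [RHS]integral_mkcond; apply: eq_integral => x _; rewrite /gD !patchE.
  by rewrite in_setX/= (mem_set D2y) andbT.
rewrite integral0_eq// => x _; rewrite /gD patchE in_setX/= andbC.
by case: (y \in D2) D2y => // /(_ isT).
Qed.

Lemma measurable_tonelli_rect :
  measurable_fun setT (fun x => \int[m2]_(y in D2) g (x, y)).
Proof.
have mh : measurable_fun setT (g \_ (setT `*` D2)).
  apply/(measurable_restrictT _ _).1; first exact: measurableX.
  exact: measurable_funTS.
have h0 p : 0 <= (g \_ (setT `*` D2)) p by rewrite patchE; case: ifPn.
apply: (eq_measurable_fun (fubini_F m2 (g \_ (setT `*` D2)))); last first.
  exact: measurable_fun_fubini_tonelli_F.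
move=> x _; rewrite /fubini_F [RHS]integral_mkcond.
by apply: eq_integral => y _; rewrite !patchE in_setX/= in_setT.
Qed.

End tonelli_rectangle.

Section circle_shift.
Local Open Scope ereal_scope.
Context {R : realType}.

Lemma leb_shift (s : R) (A : set R) : measurable A ->
  pushforward (@leb R) (fun x => x + s)%R A = leb A.
Proof.
move=> mA; have mf : measurable_fun setT (fun x : measurableTypeR R => (x + s : measurableTypeR R)%R).
  exact: measurable_funD.
suff : pushforward (@lebesgue_measure R)
    ((fun x => x + s)%R : measurableTypeR R -> measurableTypeR R) A =
  lebesgue_measure A by [].
apply/esym/lebesgue_measure_unique => //.
move=> _ [[a b]] _ <-.
transitivity (@lebesgue_measure R `](a - s)%R, (b - s)%R]%classic).
  rewrite !lebesgue_measure_itv/= !lte_fin ltrD2r; congr (if _ then _ else _).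
  by rewrite -!EFinD; congr (_%:E); ring.
rewrite /pushforward; congr lebesgue_measure.
by apply/seteqP; split=> x /=; rewrite !in_itv/= ltrBlDr lerBrDr.
Qed.

Lemma ge0_integral_leb_shift (s : R) (D : set R) (f : R -> \bar R) :
  measurable D -> measurable_fun setT f -> (forall x, 0 <= f x) ->
  \int[leb]_(x in [set x | D (x + s)%R]) f (x + s)%R = \int[leb]_(x in D) f x.
Proof.
move=> mD mf f0.
have mphi : measurable_fun setT (fun x : R => (x + s)%R) by exact: measurable_funD.
rewrite -(@ge0_integral_pushforward _ _ R R R (fun x => x + s)%R mphi leb D f)//.
- by apply: eq_measure_integral => A mA _; rewrite /= leb_shift.
- exact: measurable_funTS.
Qed.

Lemma periodic_intmul (T : Type) (f : R -> T) (c : R) :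
  (forall x, f (x + c)%R = f x) -> forall (k : int) x, f (x + c * k%:~R)%R = f x.
Proof.
move=> fc.
have fn (n : nat) x : f (x + c * n%:R)%R = f x.
  elim: n x => [|n ih] x; first by rewrite mulr0 addr0.
  by rewrite -addn1 natrD mulrDr mulr1 addrA fc ih.
move=> [n|n] x; first exact: fn.
by rewrite NegzE mulrNz mulrN -[LHS](fn n.+1) -addrA addNr addr0.
Qed.

(** For [s] reduced modulo the period, the part of the shifted interval that
    sticks out is moved back by one period. *)
Lemma ge0_integral_circle_shift (s : R) (f : R -> \bar R) :
  measurable_fun setT f -> (forall x, 0 <= f x) ->
  (forall x, f (x + 2 * pi)%R = f x) ->
  \int[leb]_(x in `[0%R, (2 * pi)%R[) f (x + s)%R =
  \int[leb]_(x in `[0%R, (2 * pi)%R[) f x.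
Proof.
move=> mf f0 fp.
have p0 : (0 < 2 * pi :> R)%R by rewrite mulr_gt0// pi_gt0.
wlog : s / (0 <= s < 2 * pi)%R.
  move=> h; pose k := Num.floor (s / (2 * pi)).
  have fE x : f (x + s)%R = f (x + (s - 2 * pi * k%:~R))%R.
    by rewrite -[RHS](periodic_intmul fp k); congr f; ring.
  under eq_integral do rewrite fE.
  apply: h; have h1 := ge_floor (s / (2 * pi)).
  have := floorD1_gt (s / (2 * pi)); rewrite intrD -/k in h1 * => h2.
  have sE : s = (2 * pi * (s / (2 * pi)))%R by rewrite mulrC divfK// gt_eqF.
  by apply/andP; split; nra.
move=> /andP[s0 s2].
have mfs : measurable_fun setT (fun x : R => f (x + s)%R).
  by apply: measurableT_comp => //; exact: measurable_funD.
have -> : \int[leb]_(x in `[0%R, (2 * pi)%R[) f (x + s)%R =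
    \int[leb]_(x in `[s, (s + 2 * pi)%R[) f x.
  rewrite -(ge0_integral_leb_shift s (f := f))//.
  congr integral; apply/seteqP; split=> x /=; rewrite !in_itv/=; lra.
have E (a b c : R) : (a <= b)%R -> (b <= c)%R -> \int[leb]_(x in `[a, c[) f x =
   \int[leb]_(x in `[a, b[) f x + \int[leb]_(x in `[b, c[) f x.
  move=> ab bc; rewrite (@itv_bndbnd_setU _ _ (BLeft a) (BLeft b) (BLeft c)) ?bnd_simp//.
  rewrite ge0_integral_setU//=; first exact: measurable_funTS.
  apply/disj_setPS => x [] /=; rewrite !in_itv/=; lra.
rewrite (E s (2 * pi)%R); [|lra|lra].
rewrite [RHS](E _ s); [|lra|lra]; rewrite addeC; congr (_ + _).
rewrite -(ge0_integral_leb_shift (2 * pi)%R (f := f))//.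
under eq_integral do rewrite fp.
congr integral; apply/seteqP; split=> x /=; rewrite !in_itv/=; lra.
Qed.

End circle_shift.

Section cell_integral.
Local Open Scope ereal_scope.
Context {R : realType}.
Implicit Types (g : R * R * R -> \bar R).

Let I : set R := `[0%R, (2 * pi)%R[%classic.
Let mI : measurable I.
Proof. exact: measurable_itv. Qed.

Lemma cell_tonelli g : measurable_fun setT g -> (forall p, 0 <= g p) ->
  \int[vol]_(p in cell) g p =
  \int[leb]_(x in I) \int[leb]_(y in I) \int[leb]_(z in I) g (x, y, z).
Proof.
move=> mg g0.
have mII : measurable (I `*` I) by exact: measurableX.
transitivity (\int[leb2]_(p in I `*` I) \int[leb]_(z in I) g (p, z)).
  exact: (@tonelli_rect1 _ _ _ _ _ leb2 leb (I `*` I) I mII mI g mg g0).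
have mg2 := @measurable_tonelli_rect _ _ _ _ _ leb I mI g mg g0.
apply: (@tonelli_rect1 _ _ _ _ _ leb leb I I mI mI _ mg2) => p.
by apply: integral_ge0.
Qed.

Lemma leb_swap (g : R * R -> \bar R) : measurable_fun setT g ->
  (forall p, 0 <= g p) ->
  \int[leb]_(x in I) \int[leb]_(y in I) g (x, y) =
  \int[leb]_(y in I) \int[leb]_(x in I) g (x, y).
Proof.
move=> mg g0.
by rewrite -(@tonelli_rect2 _ _ _ _ _ leb leb I I mI mI _ mg g0) tonelli_rect1.
Qed.

Definition rot (p : R * R * R) : R * R * R := (p.1.2, p.2, p.1.1).

Lemma measurable_rot : measurable_fun setT rot.
Proof.
apply: measurable_fun_pair; first apply: measurable_fun_pair.
- exact: (measurableT_comp measurable_snd measurable_fst).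
- exact: measurable_snd.
- exact: (measurableT_comp measurable_fst measurable_fst).
Qed.

Lemma cell_integral_rot g : measurable_fun setT g -> (forall p, 0 <= g p) ->
  \int[vol]_(p in cell) g (rot p) = \int[vol]_(p in cell) g p.
Proof.
move=> mg g0.
have mgr : measurable_fun setT (fun p => g (rot p)).
  exact: (measurableT_comp mg measurable_rot).
rewrite (@cell_tonelli (fun p => g (rot p)) mgr (fun p => g0 _)) (@cell_tonelli g mg g0).
rewrite /rot/=.
(* the outermost variable is the last argument of [g]: it is moved inwards past
   the other two, one at a time *)
transitivity (\int[leb]_(y in I) \int[leb]_(x in I) \int[leb]_(z in I) g (y, z, x)).
  have mh : measurable_fun setT (fun p : (R * R) * R => g (p.1.2, p.2, p.1.1)).
    by apply: (measurableT_comp mg); exact: measurable_rot.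
  have := @measurable_tonelli_rect _ _ _ _ _ leb I mI _ mh.
  move=> /(_ (fun=> g0 _)) m2.
  by apply: (leb_swap m2) => p; apply: integral_ge0.
apply: eq_integral => y _.
apply: (@leb_swap (fun p => g (y, p.2, p.1))) => //.
apply: (measurableT_comp mg).
apply: measurable_fun_pair; first exact: measurable_fun_pair.
exact: measurable_fst.
Qed.

(** Asking that composition preserve periodicity expresses that [S] descends to
    the torus without naming the quotient. *)
Definition torus_map (S : R * R * R -> R * R * R) : Prop :=
  forall (T : Type) (f : R * R * R -> T),
    torus_periodic f -> torus_periodic (f \o S).

(** Only periodic integrands are tested: the preimage of the cell is in general
    another fundamental domain. *)
Definition volume_preserving (S : R * R * R -> R * R * R) : Prop :=
  [/\ measurable_fun setT S, torus_map S &
    forall g, measurable_fun setT g -> (forall p, 0 <= g p) -> torus_periodic g ->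
      \int[vol]_(p in cell) g (S p) = \int[vol]_(p in cell) g p].

Lemma vp_id : volume_preserving id.
Proof. by split=> //; move=> T f. Qed.

Lemma vp_comp S1 S2 : volume_preserving S1 -> volume_preserving S2 ->
  volume_preserving (S1 \o S2).
Proof.
move=> [m1 p1 i1] [m2 p2 i2]; split.
- exact: measurableT_comp.
- by move=> T f /p1 /p2.
- move=> g mg g0 gp; rewrite /comp -(i1 g mg g0 gp).
  exact: (i2 (g \o S1) (measurableT_comp mg m1) (fun=> g0 _) (p1 _ _ gp)).
Qed.

Lemma vp_iter S n : volume_preserving S -> volume_preserving (iter n S).
Proof.
by move=> vS; elim: n => [|n ih]; [exact: vp_id|exact: (vp_comp vS ih)].
Qed.

Lemma vp_rot : volume_preserving rot.
Proof.
split; [exact: measurable_rot| |by move=> g mg g0 _; exact: cell_integral_rot].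
by move=> T f pf x y z; have [] := pf y z x.
Qed.

Definition vshear (s : R -> R) (p : R * R * R) : R * R * R :=
  (p.1, p.2 + s p.1.1)%R.

(** A shear rotates each vertical circle, by an angle that depends on the circle
    only. *)
Lemma vp_vshear (s : R -> R) : measurable_fun setT s ->
  (forall x, s (x + 2 * pi)%R = s x) -> volume_preserving (vshear s).
Proof.
move=> ms sp.
have mV : measurable_fun setT (vshear s).
  apply: measurable_fun_pair; first exact: measurable_fst.
  apply: measurable_funD; first exact: measurable_snd.
  by apply: (measurableT_comp ms); exact: (measurableT_comp measurable_fst measurable_fst).
split=> //.
- move=> T f pf x y z; rewrite /vshear /=; split.
  + by rewrite sp; have [] := pf x y (z + s x)%R.
  + by have [] := pf x y (z + s x)%R.
  + by rewrite addrAC; have [] := pf x y (z + s x)%R.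
- move=> g mg g0 gp.
  have mgV : measurable_fun setT (fun p => g (vshear s p)) by exact: (measurableT_comp mg mV).
  rewrite (@cell_tonelli (fun p => g (vshear s p)) mgV (fun p => g0 _)).
  rewrite (@cell_tonelli g mg g0).
  apply: eq_integral => x _; apply: eq_integral => y _; rewrite /vshear/=.
  apply: (@ge0_integral_circle_shift R (s x) (fun z => g (x, y, z))) => //.
    by apply: (measurableT_comp mg); exact: measurable_fun_pair.
  by move=> z; have [] := gp x y z.
Qed.

(** A translation is a product of shears of constant amplitude in the three
    directions. *)
Lemma vp_translate (v : R * R * R) : volume_preserving (fun p => p + v)%R.
Proof.
have vc c : volume_preserving (vshear (fun=> c)) by apply: vp_vshear.
rewrite [X in volume_preserving X](_ : _ =
  (rot \o vshear (fun=> v.1.2)) \o ((rot \o vshear (fun=> v.1.1)) \o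
  (rot \o vshear (fun=> v.2)))); last by apply/funext => -[[x y] z].
by do ![apply: vp_comp] => //; exact: vp_rot.
Qed.

Lemma measurable_cell : measurable (@cell R).
Proof. by apply: measurableX => //; exact: measurableX. Qed.

Lemma cell_integral_vp S (f : R * R * R -> \bar R) : volume_preserving S ->
  measurable_fun setT f -> torus_periodic f ->
  \int[vol]_(p in cell) f (S p) = \int[vol]_(p in cell) f p.
Proof.
move=> [_ _ iS] mf pf; rewrite integralE [RHS]integralE.
rewrite -[X in \int[_]_(_ in _) X^\+ _]/(f \o S) funepos_comp.
rewrite -[X in \int[_]_(_ in _) X^\- _]/(f \o S) funeneg_comp; congr (_ - _).
- refine (iS (f^\+) _ _ _) => //; first exact: measurable_funepos.
  by move=> x y z; have [h1 h2 h3] := pf x y z; rewrite !funeposE h1 h2 h3.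
- refine (iS (f^\-) _ _ _) => //; first exact: measurable_funeneg.
  by move=> x y z; have [h1 h2 h3] := pf x y z; rewrite !funenegE h1 h2 h3.
Qed.

Lemma cell_measure_vp S (A : set (R * R * R)) : volume_preserving S ->
  measurable A -> torus_periodic (fun p => A p) ->
  vol (cell `&` S @^-1` A) = vol (cell `&` A).
Proof.
move=> [mS _ iS] mA pA.
have mSA : measurable (S @^-1` A) by rewrite -[X in measurable X]setTI; exact: mS.
have E (B : set (R * R * R)) : measurable B ->
    \int[vol]_(p in cell) (\1_B p)%:E = vol (cell `&` B).
  by move=> mB; rewrite (integral_indic _ measurable_cell mB) setIC.
rewrite -(E _ mA) -(E _ mSA); apply: (iS (fun p => (\1_A p)%:E)) => //.
- by apply/measurable_EFinP; exact: measurable_indic.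
- move=> x y z; have [h1 h2 h3] := pA x y z.
  by rewrite !indicE !/(_ \in _)/= /in_set h1 h2 h3.
Qed.

Lemma vol_box (A B C : set R) : measurable A -> measurable B -> measurable C ->
  vol (A `*` B `*` C) = leb A * leb B * leb C.
Proof.
move=> mA mB mC; rewrite /vol product_measure1E//; last exact: measurableX.
by congr (_ * _); rewrite /= /leb2 product_measure1E.
Qed.

Lemma leb_circle : leb `[0%R, (2 * pi)%R[%classic = (2 * pi)%:E :> \bar R.
Proof.
rewrite /leb lebesgue_measure_itv/= lte_fin mulr_gt0 ?pi_gt0//.
by rewrite -EFinB subr0.
Qed.

Lemma vol_cell : vol (@cell R) = ((2 * pi) ^+ 3)%:E.
Proof.
rewrite /cell vol_box// !leb_circle -!EFinM; congr EFin; ring.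
Qed.

End cell_integral.

(** * Three-term recurrences *)

Section three_term_recurrence.
Context {R : realType} (alpha : R) (e : nat -> R).
Implicit Types (v : R * R * R) (s u : nat -> R).

(** The differential of [step], with [c] for [alpha] times the slope of the
    profile. *)
Definition tangent_step (c : R) v : R * R * R := (v.2 - c * v.1.1, v.1.1, v.1.2).

Fixpoint tangent n v : R * R * R :=
  if n is m.+1 then tangent_step (alpha * e m) (tangent m v) else v.

(** Keeping the last component only loses nothing, as the other two are its
    values at the next two times. *)
Definition sol v n : R := (tangent n v).2.

Definition recurrence s := forall n, s n.+3 = s n - alpha * e n * s n.+2.

Lemma tangentE n v : tangent n v = (sol v n.+2, sol v n.+1, sol v n).
Proof. by rewrite /sol /=; case: (tangent n v) => -[]. Qed.

Lemma sol_recurrence v : recurrence (sol v).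
Proof. by move=> n; rewrite /sol /=. Qed.

Lemma sol_linear v n : sol v n = v.1.1 * sol (1, 0, 0) n +
  v.1.2 * sol (0, 1, 0) n + v.2 * sol (0, 0, 1) n.
Proof.
have h k : [/\ sol v k = v.1.1 * sol (1, 0, 0) k +
    v.1.2 * sol (0, 1, 0) k + v.2 * sol (0, 0, 1) k,
  sol v k.+1 = v.1.1 * sol (1, 0, 0) k.+1 +
    v.1.2 * sol (0, 1, 0) k.+1 + v.2 * sol (0, 0, 1) k.+1 &
  sol v k.+2 = v.1.1 * sol (1, 0, 0) k.+2 +
    v.1.2 * sol (0, 1, 0) k.+2 + v.2 * sol (0, 0, 1) k.+2].
  elim: k => [|k [h0 h1 h2]]; first by rewrite /sol/=; split; ring.
  by split => //; rewrite !(sol_recurrence _ k) h0 h2; ring.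
by have [] := h n.
Qed.

Hypothesis e1 : forall n, `|e n| = 1.
Hypothesis alpha20 : 20 <= alpha.

(** As long as the moduli increase, the next one is at least [alpha - 1] times
    the last one. *)
Lemma expanding_growth u : recurrence u -> u 0%N = 0 -> u 1%N = 0 ->
  u 2%N = 1 -> (forall n, `|u n| <= `|u n.+1|) /\ (forall n, 1 <= `|u n.+2|).
Proof.
move=> ru u0 u1 u2.
have h n : [/\ `|u n| <= `|u n.+1|, `|u n.+1| <= `|u n.+2| & 1 <= `|u n.+2|].
  elim: n => [|n [h0 h1 h2]]; first by rewrite u0 u1 u2 normr0 normr1.
  have : `|u n.+2| <= `|u n.+3|.
    have : alpha * `|u n.+2| <= `|u n| + `|u n.+3|.
      have -> : alpha * `|u n.+2| = `|u n - u n.+3|.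
        rewrite (ru n) opprB addrC subrK normrM normrM e1 mulr1 ger0_norm//.
        by apply: le_trans alpha20.
      exact: ler_normB.
    have : 20 * `|u n.+2| <= alpha * `|u n.+2| by rewrite ler_wpM2r.
    by have := normr_ge0 (u n.+2); lra.
  by move=> h3; split => //; apply: le_trans h3.
by split=> n; have [] := h n.
Qed.

(** A discrete maximum principle. At a maximum of [4 ^+ n * `|d n|] strictly
    between the times 1 and [N] the recurrence would give [alpha <= 16 + 1 / 4],
    unless the maximum is zero; hence the two initial values control everything.
    *)
Lemma contracting_bound (d : nat -> R) N : recurrence d -> d N = 0 ->
  `|d 0%N| <= 1 -> `|d 1%N| <= 1 ->
  forall n, (n <= N)%N -> `|d n| <= 4 / 4 ^+ n.
Proof.
move=> rd dN d0 d1.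
case: (@arg_maxP _ _ _ (@ord0 N) xpredT (fun i : 'I_N.+1 => 4 ^+ i * `|d i|)) => // i _ imax.
have max n : (n <= N)%N -> 4 ^+ n * `|d n| <= 4 ^+ i * `|d i|.
  by rewrite -ltnS => nN; exact: (imax (Ordinal nN)).
suff K4 : 4 ^+ i * `|d i| <= 4.
  move=> n nN; rewrite ler_pdivlMr ?exprn_gt0// mulrC.
  exact: le_trans (max _ nN) K4.
move: (ltn_ord i) max; case: (nat_of_ord i) => {imax i} [|[|m]] iN max.
- by rewrite expr0 mul1r; apply: le_trans d0 _; lra.
- by rewrite expr1; lra.
- have [mN|mN] := eqVneq m.+2 N; first by rewrite mN dN normr0 mulr0.
  have m3 : (m.+3 <= N)%N by rewrite ltn_neqAle mN -ltnS.
  have h0 := max m (ltnW (ltnW (ltnW m3))); have h3 := max m.+3 m3.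
  have : alpha * `|d m.+2| <= `|d m| + `|d m.+3|.
    have -> : alpha * `|d m.+2| = `|d m - d m.+3|.
      rewrite (rd m) opprB addrC subrK normrM normrM e1 mulr1 ger0_norm//.
      by apply: le_trans alpha20.
    exact: ler_normB.
  move: h0 h3; rewrite !exprS.
  have : 0 < 4 ^+ m :> R by rewrite exprn_gt0.
  have := normr_ge0 (d m); have := normr_ge0 (d m.+2); have := normr_ge0 (d m.+3).
  set X := 4 ^+ m; move: `|d m| `|d m.+2| `|d m.+3| => a b c.
  move=> c0 b0 a0 X0 h0 h3 habc.
  have {}h0 : X * a <= 16 * (X * b) by lra.
  have {}h3 : X * c <= (1/4) * (X * b) by lra.
  have h4 : alpha * (X * b) <= X * a + X * c.
    by rewrite mulrCA -mulrDr ler_wpM2l// ltW.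
  have Xb0 : 0 <= X * b by rewrite mulr_ge0// ltW.
  have h5 : 20 * (X * b) <= alpha * (X * b) by rewrite ler_wpM2r.
  by lra.
Qed.

End three_term_recurrence.

Section damped.
Context {R : realType}.
Implicit Types x f : R^nat.

(** Adding the tail of the series of errors makes the sequence nonincreasing. *)
Lemma almost_decreasing_cvg x (c : R) :
  (forall n, 0 <= x n) -> 0 <= c ->
  (forall n, x n.+1 <= x n + c / 2 ^+ n) -> cvgn x.
Proof.
move=> x0 c0 xS.
(* the second term is the sum of the errors from time [n] on *)
pose y n := x n + 2 * c / 2 ^+ n.
have cy : cvgn y.
  apply: nonincreasing_is_cvgn.
    apply/nonincreasing_seqP => n; rewrite /y.
    have -> : 2 * c / 2 ^+ n.+1 = c / 2 ^+ n :> R.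
      by rewrite exprS; field; rewrite expf_neq0.
    by have := xS n; lra.
  exists 0 => _ [n _ <-]; rewrite /y addr_ge0//.
  by rewrite mulr_ge0 ?mulr_ge0// invr_ge0 exprn_ge0.
have g0 : (fun n => 2 * c / 2 ^+ n) @ \oo --> (0 : R).
  rewrite -[0](mulr0 (2 * c)); apply: cvgMr.
  under eq_fun do rewrite -exprVn.
  by apply: cvg_expr; rewrite ger0_norm ?invr_ge0// invf_lt1// ltr1n.
have -> : x = y \- (fun n => 2 * c / 2 ^+ n).
  by apply/funext => n; rewrite /y /= addrK.
by apply: is_cvgB => //; apply/cvg_ex; exists 0.
Qed.

(** The factors may oscillate, so that the limit is not known in advance; but
    the positive and the negative part of [x] both decrease up to summable
    errors. *)
Lemma damped_cvg x f (c : R) : 0 <= c -> (forall n, 0 <= f n <= 1) ->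
  (forall n, `|x n.+1 - f n * x n| <= c / 2 ^+ n) -> cvgn x.
Proof.
move=> c0 f01 xf.
have H y : (forall n, `|y n.+1 - f n * y n| <= c / 2 ^+ n) ->
    cvgn (fun n => Num.max (y n) 0).
  move=> yf; apply: (@almost_decreasing_cvg _ c) => //.
    by move=> n; rewrite le_max lexx orbT.
  move=> n; have := yf n; rewrite ler_norml => /andP[_ h].
  have /andP[f0 f1] := f01 n.
  have c2 : 0 <= c / 2 ^+ n by rewrite divr_ge0// exprn_ge0.
  rewrite ge_max; apply/andP; split; last first.
    by rewrite addr_ge0// le_max lexx orbT.
  have : f n * y n <= Num.max (y n) 0.
    have [y0|y0] := leP (y n) 0; first by rewrite mulr_ge0_le0.
    by rewrite ler_piMl// ltW.
  by lra.
have -> : x = (fun n => Num.max (x n) 0) \- (fun n => Num.max (- x n) 0).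
  apply/funext => n /=; case: (leP (x n) 0) => h.
    by rewrite max_l ?oppr_ge0// sub0r opprK.
  by rewrite max_r ?subr0// oppr_le0 ltW.
apply: is_cvgB; apply: H => // n.
by have := xf n; rewrite -normrN opprB mulrN opprK addrC.
Qed.

End damped.

(** * The contracted plane and the limit of the curls *)

Section transversal.
Context {R : realType} (alpha : R) (e F G : nat -> R).

Local Notation solv := (sol alpha e).

(** When [sol v] is the derivative in the direction [v] of the coordinates of an
    orbit, these quotients are the components of the gradient of the [N]-th one,
    normalised to have first component 1. *)
Definition slope (v : R * R * R) N : R := solv v N / solv (1, 0, 0) N.

Definition weight N : R := \prod_(k < N) F k.

(** The Leibniz rule for [weight]: [G k] stands for the derivative of the [k]-th
    factor and [w k] for the derivative of its argument. *)
Fixpoint dweight (w : nat -> R) N : R :=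
  if N is m.+1 then F m * dweight w m + weight m * G m * w m else 0.

(** The derivative of the weight along [v - slope v N *: (1, 0, 0)], i.e. within
    the level surface of the [N]-th coordinate. The derivative in the direction
    [(1, 0, 0)] grows without bound with [N], the one along the level surface
    does not. *)
Definition leafwise (v : R * R * R) N : R :=
  dweight (solv v) N - slope v N * dweight (solv (1, 0, 0)) N.

(** The cross product of the gradient of the weight with the normalised gradient
    of the [N]-th coordinate. *)
Definition curl_field N : R * R * R :=
  (leafwise (0, 1, 0) N * slope (0, 0, 1) N -
     leafwise (0, 0, 1) N * slope (0, 1, 0) N,
   leafwise (0, 0, 1) N, - leafwise (0, 1, 0) N).

Hypothesis e1 : forall n, `|e n| = 1.
Hypothesis alpha20 : 20 <= alpha.

Let u := solv (1, 0, 0).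

Let ru : recurrence alpha e u. Proof. exact: sol_recurrence. Qed.

Let ugrow : (forall n, `|u n| <= `|u n.+1|) /\ (forall n, 1 <= `|u n.+2|).
Proof. exact: (expanding_growth e1 alpha20 ru). Qed.

Lemma sol_x_neq0 N : (2 <= N)%N -> solv (1, 0, 0) N != 0.
Proof.
case: N => [|[|N]]// _; rewrite -normr_gt0.
exact: lt_le_trans ltr01 (ugrow.2 N).
Qed.

Section direction.
Context (v : R * R * R).
Hypothesis v0 : v.1.1 = 0.
Hypothesis v1 : `|v.1.2| <= 1.
Hypothesis v2 : `|v.2| <= 1.

(** The slope is chosen such that this solution vanishes at time [N], and at the
    times 0 and 1 it agrees with [v], because [u] is zero there. *)
Lemma defect_bound N n : (2 <= N)%N -> (n <= N)%N ->
  `|solv v n - slope v N * u n| <= 4 / 4 ^+ n.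
Proof.
move=> N2; move: n.
apply: (@contracting_bound _ alpha e e1 alpha20
  (fun n => solv v n - slope v N * u n)).
- by move=> n; rewrite sol_recurrence ru; ring.
- by rewrite /slope divfK ?subrr// sol_x_neq0.
- by rewrite mulr0 subr0.
- by rewrite mulr0 subr0.
Qed.

Lemma slope_bound N : (2 <= N)%N -> `|slope v N| <= 1.
Proof.
move=> N2; have := defect_bound N2 N2.
by rewrite /u /sol /= v0 !(mulr0, subr0, mulr1, sub0r) normrN; lra.
Qed.

(** At time [N] the defect of [v] relative to time [N.+1] is the difference of
    the two slopes times [u N]. *)
Lemma slope_step N : (2 <= N)%N ->
  `|slope v N - slope v N.+1| * `|u N| <= 4 / 4 ^+ N.
Proof.
move=> N2; have := @defect_bound N.+1 N (leqW N2) (leqnSn N).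
rewrite -normrM mulrBl {2}/slope divfK//; exact: sol_x_neq0.
Qed.

Lemma slope_cvg : cvgn (slope v).
Proof.
apply/cvg_ex; have : cvgn (fun n => slope v (n + 2)%N); last first.
  by move=> /cvg_ex[l]; rewrite cvg_shiftn => h; exists l.
apply: (@damped_cvg _ _ (fun=> 1) 4) => // [n|n]; first by rewrite ler01 lexx.
rewrite mul1r distrC; have := @slope_step (n + 2)%N; rewrite leq_addl => /(_ isT) h.
have u1 : 1 <= `|u (n + 2)%N| by rewrite addn2; exact: ugrow.2.
apply: le_trans (_ : 4 / 4 ^+ (n + 2) <= _); last first.
  rewrite ler_pM2l// lef_pV2 ?posrE ?exprn_gt0//.
  apply: le_trans (_ : 4 ^+ n <= _); first by rewrite lerXn2r ?nnegrE// ler_nat.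
  by rewrite ler_eXn2l ?ltr1n// leq_addr.
by apply: le_trans h; rewrite ler_peMr.
Qed.

Context (g : R).
Hypothesis F1 : forall n, `|F n| <= 1.
Hypothesis F0 : forall n, (2 <= n)%N -> 0 <= F n.
Hypothesis G1 : forall n, `|G n| <= g * 2 ^+ n.

Let g0 : 0 <= g.
Proof. by have := G1 0; rewrite expr0 mulr1; exact: le_trans. Qed.

Lemma weight1 N : `|weight N| <= 1.
Proof.
elim: N => [|N ih]; first by rewrite /weight big_ord0 normr1.
by rewrite /weight big_ord_recr/= normrM mulr_ile1.
Qed.

(** The geometric growth of the factors' derivatives and the growth of [u] make
    the last term of the Leibniz rule dominate all the earlier ones. *)
Lemma dweight_bound N : `|dweight u N| <= g * 2 ^+ N * `|u N|.
Proof.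
elim: N => [|N ih] /=; first by rewrite normr0 !mulr_ge0.
apply: (le_trans (ler_normD _ _)); rewrite !normrM.
apply: le_trans (_ : g * 2 ^+ N * `|u N| + g * 2 ^+ N * `|u N| <= _); last first.
  have gX : 0 <= g * 2 ^+ N by rewrite mulr_ge0// exprn_ge0.
  have := ler_wpM2l gX (ugrow.1 N).
  by rewrite exprS; set a := `|u N|; set b := `|u N.+1|; lra.
apply: lerD; first by rewrite -[leRHS]mul1r ler_pM.
by rewrite ler_wpM2r// -[leRHS]mul1r ler_pM// weight1.
Qed.

(** Two errors are made when the factor of index [N] is added: the level surface
    turns, which costs the change, at most [4 / (4 ^+ N * `|u N|)], of the slope
    times the full derivative, of order [2 ^+ N * `|u N|]; and the new factor is
    differentiated, which costs [2 ^+ N] times the defect at time [N]. This is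
    where the decay rate of the defects has to exceed the growth rate of the
    derivatives of the factors. *)
Lemma leafwise_step N : (2 <= N)%N ->
  `|leafwise v N.+1 - F N * leafwise v N| <= 8 * g / 2 ^+ N.
Proof.
move=> N2.
have -> : leafwise v N.+1 - F N * leafwise v N =
    F N * ((slope v N - slope v N.+1) * dweight u N) +
    weight N * (G N * (solv v N - slope v N.+1 * u N)).
  by rewrite /leafwise /= -/u; ring.
have q : 4 ^+ N = 2 ^+ N * 2 ^+ N :> R by rewrite -exprMn; congr (_ ^+ _); ring.
have X0 : 0 < 2 ^+ N :> R by rewrite exprn_gt0.
have -> : 8 * g / 2 ^+ N = g * 2 ^+ N * (4 / 4 ^+ N) + g * 2 ^+ N * (4 / 4 ^+ N) :> R.
  by rewrite q; field; rewrite gt_eqF.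
apply: (le_trans (ler_normD _ _)); apply: lerD; rewrite normrM -[leRHS]mul1r ler_pM//.
- rewrite normrM; have := dweight_bound N.
  move/(ler_wpM2l (normr_ge0 (slope v N - slope v N.+1))) => /le_trans; apply.
  rewrite mulrCA; apply: ler_wpM2l; last exact: slope_step.
  by rewrite mulr_ge0// ltW.
- exact: weight1.
- by rewrite normrM ler_pM//; exact: defect_bound (leqW N2) (leqnSn N).
Qed.

Lemma leafwise_cvg : cvgn (leafwise v).
Proof.
apply/cvg_ex; have : cvgn (fun n => leafwise v (n + 2)%N); last first.
  by move=> /cvg_ex[l]; rewrite cvg_shiftn => h; exists l.
apply: (@damped_cvg _ _ (fun n => F (n + 2)%N) (8 * g)) => [|n|n].
- by rewrite mulr_ge0.
- rewrite F0 ?leq_addl//=; exact: le_trans (ler_norm _) (F1 _).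
- have := @leafwise_step (n + 2)%N; rewrite leq_addl => /(_ isT) /le_trans; apply.
  rewrite ler_wpM2l ?mulr_ge0// lef_pV2 ?posrE ?exprn_gt0//.
  by rewrite ler_eXn2l ?ltr1n// leq_addr.
Qed.

Lemma leafwise_bound N : (2 <= N)%N -> `|leafwise v N| <= 8 * g.
Proof.
(* the subtracted term is the sum of all the later errors of [leafwise_step] *)
move=> N2; apply: le_trans (_ : 8 * g - 16 * g / 2 ^+ N <= _); last first.
  by rewrite gerBl divr_ge0 ?mulr_ge0.
elim: N N2 => // -[|[|N]] ih // _.
  rewrite /leafwise/= /weight !(big_ord_recr, big_ord0)/= !(mulr0, mul0r, add0r, addr0, mul1r).
  rewrite /sol/= !(mulr0, subr0, addr0).
  apply: le_trans (ler_normD _ _) _; rewrite !normrM.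
  have h1 := G1 1; have h0 := G1 0; have f1 := F1 1; have f0 := F1 0.
  have : `|F 1| * (`|G 0| * `|v.2|) <= g.
    rewrite -[leRHS]mul1r ler_pM// -[leRHS]mulr1 ler_pM//.
    by rewrite expr0 mulr1 in h0.
  have : `|F 0| * `|G 1| * `|v.1.2| <= 2 * g.
    rewrite -[leRHS]mulr1 ler_pM// -[leRHS]mul1r ler_pM//.
    by rewrite expr1 mulrC in h1.
  have -> : 2 ^+ 2 = 4 :> R by ring.
  by have := g0; lra.
have := @leafwise_step N.+2 isT; have {}ih := ih isT.
move=> /(le_trans (lerB_dist _ _)).
have : `|F N.+2 * leafwise v N.+2| <= `|leafwise v N.+2|.
  by rewrite normrM ler_piMl.
have -> : 16 * g / 2 ^+ N.+3 = 16 * g / 2 ^+ N.+2 - 8 * g / 2 ^+ N.+2 :> R.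
  by rewrite (exprS _ N.+2); field; rewrite expf_neq0.
by lra.
Qed.

End direction.

Lemma norm_le_cvg (x : R^nat) (l M : R) n0 : x @ \oo --> l ->
  (forall n, (n0 <= n)%N -> `|x n| <= M) -> `|l| <= M.
Proof.
move=> xl xM; have nxl : `|x n| @[n --> \oo] --> `|l| by exact: cvg_norm.
rewrite -(cvg_lim _ nxl)//; apply: limr_le; first by apply/cvg_ex; exists `|l|.
by near=> n; apply: xM; near: n; exact: nbhs_infty_ge.
Unshelve. all: by end_near. Qed.

(** It spans, with its analogues for other weights, the plane of the vectors
    that the linearised recurrence contracts for all times; the inverse dynamics
    expands this plane. *)
Definition unstable_vector : R * R * R :=
  (limn (leafwise (0, 1, 0)) * limn (slope (0, 0, 1)) -
     limn (leafwise (0, 0, 1)) * limn (slope (0, 1, 0)),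
   limn (leafwise (0, 0, 1)), - limn (leafwise (0, 1, 0))).

Context (g : R).
Hypothesis F1 : forall n, `|F n| <= 1.
Hypothesis F0 : forall n, (2 <= n)%N -> 0 <= F n.
Hypothesis G1 : forall n, `|G n| <= g * 2 ^+ n.

Let ys : [/\ ((0, 1, 0) : R * R * R).1.1 = 0, `|((0, 1, 0) : R * R * R).1.2| <= 1
  & `|((0, 1, 0) : R * R * R).2| <= 1].
Proof. by rewrite /= normr0 normr1 lexx ler01. Qed.

Let zs : [/\ ((0, 0, 1) : R * R * R).1.1 = 0, `|((0, 0, 1) : R * R * R).1.2| <= 1
  & `|((0, 0, 1) : R * R * R).2| <= 1].
Proof. by rewrite /= normr0 normr1 lexx ler01. Qed.

Lemma curl_field_cvg :
  [/\ (fun N => (curl_field N).1.1) @ \oo --> unstable_vector.1.1,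
      (fun N => (curl_field N).1.2) @ \oo --> unstable_vector.1.2 &
      (fun N => (curl_field N).2) @ \oo --> unstable_vector.2].
Proof.
have [y1 y2 y3] := ys; have [z1 z2 z3] := zs.
have ly := leafwise_cvg y2 y3 F1 F0 G1.
have lz := leafwise_cvg z2 z3 F1 F0 G1.
have sy := slope_cvg y2 y3; have sz := slope_cvg z2 z3.
by split; rewrite /=; [apply: cvgB; apply: cvgM| |apply: cvgN].
Qed.

(** Orthogonality to the gradient of the [N]-th coordinate makes the curl a
    combination of the two defects, with bounded coefficients. *)
Lemma sol_curl_field_bound N n : (2 <= N)%N -> (n <= N)%N ->
  `|solv (curl_field N) n| <= 64 * g / 4 ^+ n.
Proof.
move=> N2 nN.
have [y1 y2 y3] := ys; have [z1 z2 z3] := zs.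
have ly := leafwise_bound y2 y3 F1 G1 N2.
have lz := leafwise_bound z2 z3 F1 G1 N2.
have dy := defect_bound y2 y3 N2 nN.
have dz := defect_bound z2 z3 N2 nN.
have -> : solv (curl_field N) n =
    leafwise (0, 0, 1) N * (solv (0, 1, 0) n - slope (0, 1, 0) N * u n) -
    leafwise (0, 1, 0) N * (solv (0, 0, 1) n - slope (0, 0, 1) N * u n).
  by rewrite sol_linear /=; ring.
have -> : 64 * g / 4 ^+ n = 8 * g * (4 / 4 ^+ n) + 8 * g * (4 / 4 ^+ n) :> R.
  by field; rewrite expf_neq0.
by apply: (le_trans (ler_normB _ _)); apply: lerD; rewrite normrM ler_pM.
Qed.

(** For fixed [n] the solution depends linearly on its data, so the bounds pass
    to the limit in [N]. *)
Lemma sol_unstable_vector_bound n : `|solv unstable_vector n| <= 64 * g / 4 ^+ n.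
Proof.
apply: (@norm_le_cvg (fun N => solv (curl_field N) n) _ _ n.+2); last first.
  by move=> N nN; apply: sol_curl_field_bound; apply: leq_trans nN => //; rewrite -addn2 leq_addr.
under eq_fun do rewrite sol_linear.
have [cx cy cz] := curl_field_cvg.
rewrite sol_linear; apply: cvgD; first apply: cvgD.
- by apply: cvgM => //; exact: cvg_cst.
- by apply: cvgM => //; exact: cvg_cst.
- by apply: cvgM => //; exact: cvg_cst.
Qed.

Lemma curl_field_bound N : (2 <= N)%N ->
  [/\ `|(curl_field N).1.1| <= 16 * g, `|(curl_field N).1.2| <= 16 * g &
      `|(curl_field N).2| <= 16 * g].
Proof.
move=> N2.
have [y1 y2 y3] := ys; have [z1 z2 z3] := zs.
have ly := leafwise_bound y2 y3 F1 G1 N2.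
have lz := leafwise_bound z2 z3 F1 G1 N2.
have sy := slope_bound y1 y2 y3 N2; have sz := slope_bound z1 z2 z3 N2.
have g0 : 0 <= g.
  by have := G1 0; rewrite expr0 mulr1; exact: le_trans.
rewrite /= normrN; split; [|lra|lra].
apply: (le_trans (ler_normB _ _)).
rewrite (normrM (leafwise (0, 1, 0) N)) (normrM (leafwise (0, 0, 1) N)).
have : `|leafwise (0, 1, 0) N| * `|slope (0, 0, 1) N| <= 8 * g.
  by rewrite -[leRHS]mulr1 ler_pM.
have : `|leafwise (0, 0, 1) N| * `|slope (0, 1, 0) N| <= 8 * g.
  by rewrite -[leRHS]mulr1 ler_pM.
by lra.
Qed.

(** If every cut-off is inactive, the weight only depends on the coordinate of
    index 1, and its derivative is that of the factor of this index. *)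
Lemma unstable_vector_good : F 0%N = 1 -> G 0%N = 0 ->
  (forall n, (2 <= n)%N -> F n = 1 /\ G n = 0) -> unstable_vector.2 = - G 1%N.
Proof.
move=> F00 G00 FG.
have E N : dweight u N.+2 = 0 /\ dweight (solv (0, 1, 0)) N.+2 = G 1%N.
  elim: N => [|N [ih1 ih2]].
    rewrite /= /weight !(big_ord_recr, big_ord0)/= F00 G00 /u /sol /=.
    by split; ring.
  rewrite [dweight u _]/= [dweight _ N.+3]/= -!/(dweight _ N.+2) ih1 ih2.
  by have [-> ->] := FG N.+2 isT; split; ring.
rewrite /unstable_vector /=; congr (- _).
apply/cvg_lim => //; rewrite -(cvg_shiftn 2).
(* from index 2 on the sequence is constant *)
rewrite (_ : (fun n => _) = cst (G 1%N)); first exact: cvg_cst.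
by apply/funext => N; rewrite /= addn2 /leafwise (E N).1 (E N).2 mulr0 subr0.
Qed.

End transversal.

(** * The profile and the cut-offs *)

Section profile.
Context {R : realType}.
Implicit Types (s a b M : R).

Lemma is_derive_quadratic (f : R -> R) x l K :
  (forall h, `|f (h + x) - f x - h * l| <= K * h ^+ 2) -> is_derive x (1 : R) f l.
Proof.
move=> fK.
suff fl : h^-1 *: ((f \o shift x) (h *: (1 : R)) - f x) @[h --> 0^'] --> l.
  split; first by apply/cvg_ex; exists l.
  by apply/cvg_lim.
apply/cvgrPdist_le => eps eps0; near=> h.
have h0 : h != 0 by near: h; exact: nbhs_dnbhs_neq.
have K1 : 0 < `|K| + 1 by rewrite ltr_wpDl.
have hd : `|h| <= eps / (`|K| + 1).
  near: h; apply: (@dnbhs0_le _ R); exact: divr_gt0.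
rewrite /= scaler1 -(ler_pM2l (_ : 0 < `|h|)) ?normr_gt0// -normrM mulrBr.
rewrite /GRing.scale/= mulVKf// distrC.
apply: (le_trans (fK h)); rewrite -real_normK ?num_real// expr2 mulrA.
rewrite (mulrC `|h|); apply: ler_wpM2r => //.
move: hd; rewrite ler_pdivlMr// => hd; apply: le_trans hd.
by rewrite mulrC ler_wpM2l// (le_trans (ler_norm K))// lerDl.
Unshelve. all: by end_near. Qed.

Lemma sin_lipschitz a b : `|sin a - sin b| <= `|a - b|.
Proof.
wlog ab : a b / b <= a.
  by move=> h; have [/h//|/ltW/h] := leP b a; rewrite distrC (distrC b).
have [|c _ ->] := @MVT_segment R sin cos b a ab.
  by apply: continuous_subspaceT => x; exact: continuous_sin.
by rewrite normrM ler_piMl// ler_norml cos_le1 cos_geN1.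
Qed.

Lemma sin_period s : sin (s + 2 * pi) = sin s.
Proof. by rewrite mulr_natl sinD2pi. Qed.

Lemma cos_period s : cos (s + 2 * pi) = cos s.
Proof. by rewrite mulr_natl cosD2pi. Qed.

(** The profile is the distance to the points [pi + 2 * pi * k]; hence it is at
    most the distance to each of them, and it is 1-Lipschitz. *)
Lemma hprofile_le s (k : int) : hprofile s <= `|s - 2 * pi * k%:~R - pi|.
Proof.
have p0 : (0 < 2 * pi :> R) by rewrite mulr_gt0// pi_gt0.
rewrite /hprofile; set m := Num.floor _.
have h1 := ge_floor (s / (2 * pi)).
have := floorD1_gt (s / (2 * pi)); rewrite intrD -/m in h1 * => h2.
have sE : s = (2 * pi * (s / (2 * pi))) by rewrite mulrC divfK// gt_eqF.
have {}h1 : 0 <= s - 2 * pi * m%:~R by nra.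
have {}h2 : s - 2 * pi * m%:~R <= 2 * pi by nra.
have [km|km] := leP k m.
  have [->//|] := eqVneq k m => kNm.
  have : (k + 1 <= m) by rewrite lezD1 lt_neqAle kNm.
  rewrite -(ler_int R) intrD => {}km.
  have : 2 * pi * (k%:~R + 1) <= 2 * pi * m%:~R :> R by rewrite ler_pM2l.
  rewrite mulrDr mulr1 => h3.
  rewrite [leRHS]ger0_norm; last lra.
  by rewrite ler_norml; apply/andP; split; lra.
have : (m + 1 <= k) by rewrite lezD1.
rewrite -(ler_int R) intrD => {}km.
have : 2 * pi * (m%:~R + 1) <= 2 * pi * k%:~R :> R by rewrite ler_pM2l.
rewrite mulrDr mulr1 => h3.
rewrite [leRHS]ler0_norm; last lra.
by rewrite ler_norml; apply/andP; split; lra.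
Qed.

Lemma hprofile_lipschitz a b : `|hprofile a - hprofile b| <= `|a - b|.
Proof.
wlog ab : a b / hprofile b <= hprofile a.
  by move=> h; have [/h//|/ltW/h] := leP (hprofile b) (hprofile a); rewrite distrC (distrC b).
rewrite ger0_norm ?subr_ge0// lerBlDr.
apply: le_trans (hprofile_le a (Num.floor (b / (2 * pi)))) _.
rewrite /hprofile; set c := 2 * pi * _.
by apply: le_trans (ler_normD _ _); rewrite le_eqVlt; apply/orP; left; apply/eqP; congr `|_|; ring.
Qed.

Lemma hprofile_period s : hprofile (s + 2 * pi) = hprofile s.
Proof.
have p0 : (2 * pi != 0 :> R) by rewrite gt_eqF// mulr_gt0// pi_gt0.
rewrite /hprofile (mulrDl s) divff// floorDrz ?rpred1// floor1 intrD; congr `|_|; ring.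
Qed.

Lemma hprofile_continuous : continuous (@hprofile R).
Proof.
move=> s; apply/cvgrPdist_le => eps eps0; near=> t.
apply: le_trans (hprofile_lipschitz _ _) _; near: t.
by apply: cvgr_dist_le => //; exact: cvg_id.
Unshelve. all: by end_near. Qed.

(** A formula without reduction modulo the period, from which the derivative off
    the kinks follows by the chain rule. *)
Lemma hprofile_acos s : hprofile s = acos (- cos s).
Proof.
have p0 : (0 < 2 * pi :> R) by rewrite mulr_gt0// pi_gt0.
rewrite /hprofile; set m := Num.floor _.
have h1 := ge_floor (s / (2 * pi)).
have := floorD1_gt (s / (2 * pi)); rewrite intrD -/m in h1 * => h2.
have sE : s = (2 * pi * (s / (2 * pi))) by rewrite mulrC divfK// gt_eqF.
have {}h1 : 0 <= s - 2 * pi * m%:~R by nra.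
have {}h2 : s - 2 * pi * m%:~R <= 2 * pi by nra.
have cE : cos s = cos (s - 2 * pi * m%:~R).
  by rewrite -[RHS](periodic_intmul cos_period m) subrK.
have -> : - cos s = cos `|s - 2 * pi * m%:~R - pi|.
  rewrite cE; case: (leP 0 (s - 2 * pi * m%:~R - pi)) => h.
    by rewrite ger0_norm// -[in LHS](subrK pi (s - _)) cosDpi opprK.
  by rewrite ltr0_norm// cosN -[in LHS](subrK pi (s - _)) cosDpi opprK.
rewrite cosK// in_itv/= normr_ge0 ler_norml; apply/andP; split; lra.
Qed.

(** The kinks are the zeros of the sine; the values there are a convention. *)
Definition hslope s : R := if 0 <= sin s then - 1 else 1.

Lemma hslope_norm s : `|hslope s| = 1.
Proof. by rewrite /hslope; case: ifP; rewrite ?normrN normr1. Qed.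

Lemma hslope_period s : hslope (s + 2 * pi) = hslope s.
Proof. by rewrite /hslope sin_period. Qed.

(** Between two points with different slopes there is a zero of the sine. *)
Lemma hslope_jump a b : hslope a != hslope b -> `|sin a| <= `|a - b|.
Proof.
move=> ab; apply: le_trans (sin_lipschitz a b); move: ab.
rewrite /hslope; case: (leP 0 (sin a)) => ha; case: (leP 0 (sin b)) => hb; rewrite ?eqxx// => _.
  by rewrite !ger0_norm//; lra.
by rewrite !ler0_norm//; lra.
Qed.

Lemma measurable_hslope : measurable_fun setT hslope.
Proof.
apply: measurable_fun_ifT => //.
apply: measurable_fun_ler => //.
by apply: continuous_measurable_fun; exact: continuous_sin.
Qed.

Lemma is_derive_hprofile s : sin s != 0 -> is_derive s (1 : R) hprofile (hslope s).
Proof.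
move=> ss0.
have c1 : -1 < - cos s < 1.
  have : (- cos s) ^+ 2 < 1.
    by rewrite sqrrN -subr_gt0 -sin2cos2 lt0r sqrf_eq0 ss0 sqr_ge0.
  by rewrite -(real_normK (num_real _)) expr_lt1// ltr_norml.
rewrite (_ : hprofile = acos \o (\- cos)); last first.
  by apply/funext => t; rewrite hprofile_acos.
have dc : is_derive s (1 : R) (\- cos) (sin s).
  by apply: is_derive_eq; rewrite opprK.
have da := is_derive1_acos c1.
apply: is_derive_eq.
rewrite sqrrN -sin2cos2 sqrtr_sqr /hslope.
have [h|h] := leP 0 (sin s).
  by rewrite ger0_norm// mulNr mulVf.
by rewrite ltr0_norm// invrN opprK mulVf.
Qed.

(** With [y = (M * sin s) ^+ 2] this is [1 - max (1 - y, 0) ^+ 2]: the square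
    makes it continuously differentiable where it becomes equal to 1. *)
Definition cutoff M s : R := 1 - Num.max (1 - (M * sin s) ^+ 2) 0 ^+ 2.

Definition dcutoff M s : R :=
  4 * M ^+ 2 * sin s * cos s * Num.max (1 - (M * sin s) ^+ 2) 0.

Lemma max01 M s : 0 <= Num.max (1 - (M * sin s) ^+ 2) 0 <= 1.
Proof.
rewrite le_max lexx orbT/= ge_max ler01 andbT.
by rewrite gerBl sqr_ge0.
Qed.

Lemma cutoff01 M s : 0 <= cutoff M s <= 1.
Proof.
have /andP[h0 h1] := max01 M s; rewrite /cutoff.
by rewrite gerBl sqr_ge0 andbT subr_ge0 expr_le1.
Qed.

Lemma cutoff_le M s : cutoff M s <= 2 * M ^+ 2 * `|sin s|.
Proof.
have /andP[m0 m1] := max01 M s.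
have : 1 - (M * sin s) ^+ 2 <= Num.max (1 - (M * sin s) ^+ 2) 0 by rewrite le_max lexx.
rewrite /cutoff; move: m0 m1; set m := Num.max _ _ => m0 m1.
rewrite exprMn => h.
have : sin s ^+ 2 <= `|sin s|.
  by rewrite -(real_normK (num_real _)) expr2 ler_piMl// ler_norml sin_le1 sin_geN1.
move=> /(ler_wpM2l (sqr_ge0 M)) hw.
have hm : 1 - m ^+ 2 <= 2 * (1 - m) by have := sqr_ge0 (1 - m); lra.
by move: h hw hm; set w := M ^+ 2 * sin s ^+ 2; lra.
Qed.

Lemma cutoff_lipschitz M a b : `|cutoff M a - cutoff M b| <= 4 * M ^+ 2 * `|a - b|.
Proof.
have /andP[a0 a1] := max01 M a; have /andP[b0 b1] := max01 M b.
have -> : cutoff M a - cutoff M b =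
  (Num.max (1 - (M * sin b) ^+ 2) 0 - Num.max (1 - (M * sin a) ^+ 2) 0) *
  (Num.max (1 - (M * sin b) ^+ 2) 0 + Num.max (1 - (M * sin a) ^+ 2) 0).
  by rewrite /cutoff; ring.
have h : `|Num.max (1 - (M * sin b) ^+ 2) 0 - Num.max (1 - (M * sin a) ^+ 2) 0|
    <= 2 * M ^+ 2 * `|a - b|.
  apply: le_trans (_ : `|(M * sin a) ^+ 2 - (M * sin b) ^+ 2| <= _).
    set x := (M * sin a) ^+ 2; set y := (M * sin b) ^+ 2.
    rewrite /Num.max; case: ifPn => h1; case: ifPn => h2.
    - by rewrite subrr normr0.
    - move: h1 h2; rewrite -leNgt => h1 h2.
      by rewrite ler_norml; apply/andP; split; have := ler_norm (x - y);
        rewrite -normrN; have := ler_norm (- (x - y)); lra.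
    - move: h1 h2; rewrite -leNgt => h1 h2.
      by rewrite ler_norml; apply/andP; split;
        have := ler_norm (x - y); have := normr_ge0 (x - y); lra.
    - by rewrite le_eqVlt; apply/orP; left; apply/eqP; congr `|_|; ring.
  rewrite !exprMn -mulrBr normrM normrX real_normK ?num_real//.
  rewrite (_ : 2 * M ^+ 2 * `|a - b| = M ^+ 2 * (2 * `|a - b|)); last by ring.
  apply: ler_wpM2l; first exact: sqr_ge0.
  rewrite subr_sqr normrM mulrC ler_pM//.
    apply: le_trans (ler_normD _ _) _.
    have : `|sin a| <= 1 by rewrite ler_norml sin_le1 sin_geN1.
    have : `|sin b| <= 1 by rewrite ler_norml sin_le1 sin_geN1.
    lra.
  exact: sin_lipschitz.
rewrite normrM; apply: le_trans (_ : 2 * M ^+ 2 * `|a - b| * 2 <= _); last lra.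
rewrite ler_pM//; apply: le_trans (ler_normD _ _) _.
by rewrite !ger0_norm//; lra.
Qed.

Lemma dcutoff_bound M s : 0 <= M -> `|dcutoff M s| <= 4 * M.
Proof.
move=> M0; have /andP[m0 m1] := max01 M s.
have c1 : `|cos s| <= 1 by rewrite ler_norml cos_le1 cos_geN1.
rewrite /dcutoff; have [h|h] := leP (1 - (M * sin s) ^+ 2) 0.
  by rewrite mulr0 normr0 mulr_ge0.
have h1 : `|M * sin s| <= 1.
  by rewrite -(@expr_le1 _ 2)// real_normK ?num_real// ltW// -subr_gt0.
have -> : 4 * M ^+ 2 * sin s * cos s * (1 - (M * sin s) ^+ 2) =
  4 * M * ((M * sin s) * cos s * (1 - (M * sin s) ^+ 2)) by ring.
rewrite normrM ger0_norm ?mulr_ge0// -[leRHS]mulr1 ler_wpM2l ?mulr_ge0//.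
rewrite !normrM -normrM mulr_ile1// ?mulr_ile1// ler_norml.
by have := sqr_ge0 (M * sin s); lra.
Qed.

Lemma cutoff_far M s : 1 <= (M * sin s) ^+ 2 -> cutoff M s = 1 /\ dcutoff M s = 0.
Proof.
move=> h; rewrite /cutoff /dcutoff max_r ?subr_le0//.
by split; ring.
Qed.

Lemma cutoff_period M s : cutoff M (s + 2 * pi) = cutoff M s.
Proof. by rewrite /cutoff sin_period. Qed.

Lemma dcutoff_period M s : dcutoff M (s + 2 * pi) = dcutoff M s.
Proof. by rewrite /dcutoff sin_period cos_period. Qed.

Lemma is_derive_max_sqr (x : R) :
  is_derive x (1 : R) (fun t => Num.max t 0 ^+ 2) (2 * Num.max x 0).
Proof.
apply: (@is_derive_quadratic _ _ _ 1) => h.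
rewrite mul1r ler_norml /Num.max; case: ifPn => h1; case: ifPn => h2;
  move: h1 h2; rewrite -?leNgt => h1 h2; apply/andP; split; nra.
Qed.

Lemma is_derive_cutoff M s : is_derive s (1 : R) (cutoff M) (dcutoff M s).
Proof.
have d1 : is_derive s (1 : R) (fun t => 1 - (M * sin t) ^+ 2)
    (- (2 * M ^+ 2 * sin s * cos s)).
  apply: is_derive_eq; rewrite /GRing.scale/=; ring.
have d2 := is_derive_max_sqr (1 - (M * sin s) ^+ 2).
have d3 : is_derive s (1 : R) ((fun t => Num.max t 0 ^+ 2) \o (fun t => 1 - (M * sin t) ^+ 2))
   (2 * Num.max (1 - (M * sin s) ^+ 2) 0 * - (2 * M ^+ 2 * sin s * cos s)).
  exact: is_derive1_comp.
rewrite /cutoff.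
have -> : (fun s => 1 - Num.max (1 - (M * sin s) ^+ 2) 0 ^+ 2) =
  cst 1 - ((fun t => Num.max t 0 ^+ 2) \o (fun t => 1 - (M * sin t) ^+ 2)) by [].
apply: is_derive_eq; rewrite /dcutoff; ring.
Qed.

End profile.

(** * The dynamics in rotating coordinates *)

Section factors.
Context {R : realType} (m : R) (m1 : 1 <= m).
Implicit Types (s a b : R).

(** The slope of the profile at time [k] is taken at the coordinate of index
    [k.+2], so that the cut-offs start with index 2; the sine of index 1 makes
    the product nonconstant where no cut-off is active, and the factor of index
    0 is trivial so that indices of factors and of coordinates agree. The
    doubling of the steepness makes the volumes of the strips with active
    cut-offs summable. *)
Definition factor (k : nat) : R -> R :=
  match k with 0%N => cst 1 | 1%N => sin | _ => cutoff (m * 2 ^+ k) end.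

Definition dfactor (k : nat) : R -> R :=
  match k with 0%N => cst 0 | 1%N => cos | _ => dcutoff (m * 2 ^+ k) end.

Lemma is_derive_factor k s : is_derive s (1 : R) (factor k) (dfactor k s).
Proof.
case: k => [|[|k]]; first exact: is_derive_cst.
- exact: is_derive_sin.
- exact: is_derive_cutoff.
Qed.

Lemma factor_continuous k : continuous (factor k).
Proof.
move=> s; have [d _] := is_derive_factor k s.
by apply: differentiable_continuous; apply/derivable1_diffP.
Qed.

Lemma factor_norm k s : `|factor k s| <= 1.
Proof.
case: k => [|[|k]]; rewrite /factor/=; first by rewrite normr1.
- by rewrite ler_norml sin_le1 sin_geN1.
- by have /andP[h0 h1] := cutoff01 (m * 2 ^+ k.+2) s; rewrite ger0_norm.
Qed.

Lemma factor_ge0 k s : (2 <= k)%N -> 0 <= factor k s.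
Proof. by case: k => [|[|k]]// _; have /andP[] := cutoff01 (m * 2 ^+ k.+2) s. Qed.

Lemma dfactor_norm k s : `|dfactor k s| <= 4 * m * 2 ^+ k.
Proof.
have m0 : 0 <= m by apply: le_trans m1.
case: k => [|[|k]]; rewrite /dfactor/=.
- by rewrite normr0 mulr_ge0// mulr_ge0.
- have : `|cos s| <= 1 by rewrite ler_norml cos_le1 cos_geN1.
  by have := m1; rewrite expr1; lra.
- by rewrite -mulrA dcutoff_bound// mulr_ge0// exprn_ge0.
Qed.

Lemma factor_lipschitz k : exists2 L, 0 <= L &
  forall a b, `|factor k a - factor k b| <= L * `|a - b|.
Proof.
case: k => [|[|k]]; rewrite /factor/=.
- by exists 0 => // a b; rewrite subrr normr0 mul0r.
- by exists 1 => // a b; rewrite mul1r sin_lipschitz.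
- exists (4 * (m * 2 ^+ k.+2) ^+ 2) => [|a b]; last exact: cutoff_lipschitz.
  by rewrite mulr_ge0// sqr_ge0.
Qed.

(** The cut-offs vanish at the kinks, at least linearly. *)
Lemma factor_jump k : (2 <= k)%N -> exists2 L, 0 <= L &
  forall a b, hslope a != hslope b -> `|factor k a| <= L * `|a - b|.
Proof.
move=> k2; exists (2 * (m * 2 ^+ k) ^+ 2) => [|a b /hslope_jump ab].
  by rewrite mulr_ge0// sqr_ge0.
case: k k2 => [|[|k]]// _; rewrite ger0_norm ?factor_ge0//.
apply: le_trans (cutoff_le _ _) _; rewrite ler_wpM2l//.
by rewrite mulr_ge0// sqr_ge0.
Qed.

Lemma factor_period k s : factor k (s + 2 * pi) = factor k s.
Proof. by case: k => [|[|k]]//=; [exact: sin_period|exact: cutoff_period]. Qed.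

Lemma dfactor_period k s : dfactor k (s + 2 * pi) = dfactor k s.
Proof. by case: k => [|[|k]]//=; [exact: cos_period|exact: dcutoff_period]. Qed.

End factors.

Section dynamics.
Context {R : realType} (alpha : R).
Implicit Types (p q v : R * R * R).

Definition shear (r : R) : R * R * R -> R * R * R :=
  vshear (fun x => - (r * alpha * hprofile x)).

(** The square of [rot] is its inverse: after the shear the coordinates are
    permuted so that the next shear again acts on the last one. *)
Definition step p : R * R * R := rot (rot (shear 1 p)).

Definition orbit n p : R * R * R := iter n step p.

Definition coordinate n p : R := (orbit n p).2.

Definition slopes p n : R := hslope (orbit n p).1.1.

Lemma stepE p : step p = (p.2 - alpha * hprofile p.1.1, p.1.1, p.1.2).
Proof. by rewrite /step /shear /vshear /rot/= mul1r. Qed.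

(** The orbit is a scalar sequence seen through a window of length 3. *)
Lemma orbitE n p : orbit n p = (coordinate n.+2 p, coordinate n.+1 p, coordinate n p).
Proof. by rewrite /coordinate /orbit !iterS !stepE /=; case: (iter n step p) => -[]. Qed.

Lemma slopesE p n : slopes p n = hslope (coordinate n.+2 p).
Proof. by rewrite /slopes orbitE. Qed.

Lemma slopes_norm p n : `|slopes p n| = 1.
Proof. exact: hslope_norm. Qed.

Lemma vp_shear r : volume_preserving (shear r).
Proof.
apply: vp_vshear; last by move=> x; rewrite hprofile_period.
apply: measurable_funN; apply: measurable_funM => //.
by apply: continuous_measurable_fun; exact: hprofile_continuous.
Qed.

Lemma vp_step : volume_preserving step.
Proof.
rewrite (_ : step = (rot \o rot) \o shear 1)//.
apply: vp_comp; last exact: vp_shear.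
by apply: vp_comp; exact: vp_rot.
Qed.

Lemma vp_orbit n : volume_preserving (orbit n).
Proof. exact: vp_iter vp_step. Qed.

Lemma sup_norm_le p (M : R) :
  (`|p| <= M) = [&& `|p.1.1| <= M, `|p.1.2| <= M & `|p.2| <= M].
Proof. by rewrite prod_normE ge_max prod_normE ge_max andbA. Qed.

Lemma norm_coords p : [/\ `|p.1.1| <= `|p|, `|p.1.2| <= `|p| & `|p.2| <= `|p|].
Proof. by have := lexx `|p|; rewrite {1}sup_norm_le => /and3P. Qed.

Lemma step_lipschitz p q : 0 <= alpha -> `|step p - step q| <= (1 + alpha) * `|p - q|.
Proof.
move=> a0; have [h1 h2 h3] := norm_coords (p - q); rewrite !stepE.
have hh := hprofile_lipschitz p.1.1 q.1.1.
have n0 := normr_ge0 (p - q).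
have an0 : 0 <= alpha * `|p - q| by rewrite mulr_ge0.
rewrite sup_norm_le /=; apply/and3P; split; [|by move: h1 => /=; lra|by move: h2 => /=; lra].
have -> : p.2 - alpha * hprofile p.1.1 - (q.2 - alpha * hprofile q.1.1) =
  (p.2 - q.2) - alpha * (hprofile p.1.1 - hprofile q.1.1) by ring.
apply: le_trans (ler_normB _ _) _; rewrite mulrDl mul1r lerD// normrM ger0_norm//.
by rewrite ler_wpM2l//; exact: le_trans hh h1.
Qed.

Lemma coordinate_lipschitz n p q : 0 <= alpha ->
  `|coordinate n p - coordinate n q| <= (1 + alpha) ^+ n * `|p - q|.
Proof.
move=> a0; have [_ _ h] := norm_coords (orbit n p - orbit n q).
apply: le_trans h _; elim: n => [|n ih]; first by rewrite expr0 mul1r.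
apply: le_trans (step_lipschitz _ _ a0) _.
by rewrite exprS -mulrA ler_wpM2l// addr_ge0.
Qed.

Lemma coordinate_continuous n : 0 <= alpha -> continuous (coordinate n).
Proof.
move=> a0 p; apply/cvgrPdist_le => eps eps0; near=> q.
apply: le_trans (coordinate_lipschitz _ _ _ a0) _.
rewrite mulrC -ler_pdivlMr ?exprn_gt0 ?ltr_pwDl//.
near: q; apply: cvgr_dist_le; first exact: cvg_id.
by rewrite divr_gt0// exprn_gt0// ltr_pwDl.
Unshelve. all: by end_near. Qed.

Lemma is_derive_is_diff (f : R -> R) x l : is_derive x (1 : R) f l ->
  is_diff x f (fun t => t * l).
Proof.
move=> [d <-]; have df : differentiable f x by apply/derivable1_diffP.
apply: DiffDef => //.
by rewrite deriv1E// derive1E.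
Qed.

Lemma is_diff_fst (U W : normedModType R) (p : U * W) : is_diff p fst fst.
Proof.
have c : continuous (fst : U * W -> U) by move=> ?; exact: cvg_fst.
by apply: DiffDef; [exact: linear_differentiable|exact: diff_lin].
Qed.

Lemma is_diff_snd (U W : normedModType R) (p : U * W) : is_diff p snd snd.
Proof.
have c : continuous (snd : U * W -> W) by move=> ?; exact: cvg_snd.
by apply: DiffDef; [exact: linear_differentiable|exact: diff_lin].
Qed.

Lemma is_diff_11 p : is_diff p (fun q => q.1.1) (fun v => v.1.1).
Proof.
exact: (@is_diff_comp _ _ _ _ _ _ fst fst p (is_diff_fst p) (is_diff_fst p.1)).
Qed.

Lemma is_diff_12 p : is_diff p (fun q => q.1.2) (fun v => v.1.2).
Proof.
exact: (@is_diff_comp _ _ _ _ _ _ snd snd p (is_diff_fst p) (is_diff_snd p.1)).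
Qed.

Lemma is_diff_rot p : is_diff p rot rot.
Proof.
have h1 := @is_diff_pair _ _ _ _ _ _ _ _ _ (is_diff_12 p) (is_diff_snd p).
exact: (@is_diff_pair _ _ _ _ _ _ _ _ _ h1 (is_diff_11 p)).
Qed.

Definition dshear (c : R) v : R * R * R := (v.1, v.2 - c * v.1.1).

Lemma is_diff_shear r p : sin p.1.1 != 0 ->
  is_diff p (shear r) (dshear (r * alpha * hslope p.1.1)).
Proof.
move=> /is_derive_hprofile /is_derive_is_diff dh.
have d1 := @is_diff_comp _ _ _ _ _ _ _ _ p (is_diff_11 p) dh.
have d2 := @is_diffZ _ _ _ _ _ (r * alpha) p d1.
have d3 := @is_diffB _ _ _ _ _ _ _ p (is_diff_snd p) d2.
have d4 := @is_diff_pair _ _ _ _ _ _ _ _ _ (is_diff_fst p) d3.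
apply: is_diff_eq d4 _.
apply/funext => v.
change ((v.1, v.2 - r * alpha * (v.1.1 * hslope p.1.1)) = dshear (r * alpha * hslope p.1.1) v).
by rewrite /dshear; congr (_, _ - _); ring.
Qed.

Lemma is_diff_step p : sin p.1.1 != 0 ->
  is_diff p step (tangent_step (alpha * hslope p.1.1)).
Proof.
move=> /(is_diff_shear 1) ds.
have d1 := @is_diff_comp _ _ _ _ _ _ _ _ p ds (is_diff_rot _).
have d2 := @is_diff_comp _ _ _ _ _ _ _ _ p d1 (is_diff_rot _).
apply: is_diff_eq d2 _.
by apply/funext => v; rewrite /tangent_step /dshear /rot /= mul1r.
Qed.

(** The orbit meets no kink of the profile before time [n], since the shear at
    time [k] evaluates the profile at the coordinate of index [k.+2]. *)
Definition regular n p := forall k, (k < n)%N -> sin (coordinate k.+2 p) != 0.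

Lemma is_diff_orbit n p : regular n p ->
  is_diff p (orbit n) (tangent alpha (slopes p) n).
Proof.
elim: n => [|n ih] rp; first exact: is_diff_id.
have := @is_diff_comp _ _ _ _ _ _ _ _ p (ih _) (is_diff_step _).
apply; first by move=> k kn; apply: rp; rewrite ltnS ltnW.
by have := rp n (ltnSn n); rewrite orbitE.
Qed.

Lemma is_diff_coordinate n p : regular n p ->
  is_diff p (coordinate n) (fun v => sol alpha (slopes p) v n).
Proof.
move=> /is_diff_orbit d.
exact: (@is_diff_comp _ _ _ _ _ _ _ _ p d (is_diff_snd _)).
Qed.

Lemma is_diff_is_derive (f df : R * R * R -> R) p v : is_diff p f df ->
  is_derive p v f (df v).
Proof.
move=> d; apply: DeriveDef; first exact: diff_derivable.
by rewrite deriveE// diff_val.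
Qed.

Context (m : R).

Definition factors p k : R := factor m k (coordinate k p).
Definition dfactors p k : R := dfactor m k (coordinate k p).

Lemma regularS n p : regular n.+1 p -> regular n p.
Proof. by move=> rp k kn; apply: rp; rewrite ltnS ltnW. Qed.

Lemma is_derive_factors n p v : regular n p ->
  is_derive p v (factors ^~ n) (dfactors p n * sol alpha (slopes p) v n).
Proof.
move=> rp; have df := is_derive_is_diff (is_derive_factor m n (coordinate n p)).
have d := @is_diff_comp _ _ _ _ _ _ _ _ p (is_diff_coordinate rp) df.
by have := is_diff_is_derive v d; rewrite /= mulrC.
Qed.

Lemma is_derive_weight n p v : regular n p ->
  is_derive p v (fun q => weight (factors q) n)
    (dweight (factors p) (dfactors p) (sol alpha (slopes p) v) n).
Proof.
elim: n => [|n ih] rp.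
  rewrite /= (_ : (fun q => _) = cst 1); first exact: is_derive_cst.
  by apply/funext => q; rewrite /weight big_ord0.
have rpn := regularS rp.
rewrite (_ : (fun q => _) = (fun q => weight (factors q) n) * (factors ^~ n)); last first.
  by apply/funext => q; rewrite /weight big_ord_recr.
have d1 := ih rpn; have d2 := is_derive_factors v rpn.
by apply: is_derive_eq; rewrite /= /GRing.scale/= mulrA addrC; congr (_ + _).
Qed.

(** The components, for [v] in the canonical basis, of the vector potential of
    [curl_field]. *)
Definition potential v n p : R := weight (factors p) n * slope alpha (slopes p) v n.

Lemma tangent_ext (e e' : nat -> R) n v : (forall k, (k < n)%N -> e k = e' k) ->
  tangent alpha e n v = tangent alpha e' n v.
Proof.
elim: n => [//|n ih] ee /=; rewrite ih ?ee// => k kn.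
by apply: ee; rewrite ltnS ltnW.
Qed.

Lemma slope_ext (e e' : nat -> R) n v : (forall k, (k < n)%N -> e k = e' k) ->
  slope alpha e v n.+2 = slope alpha e' v n.+2.
Proof.
move=> ee; rewrite /slope.
have E w : sol alpha e w n.+2 = sol alpha e' w n.+2.
  have := tangent_ext w ee; rewrite !tangentE => -[]//.
by rewrite !E.
Qed.

Lemma slopes_near n p : 0 <= alpha -> regular n p ->
  \forall q \near p, forall k, (k < n)%N -> slopes p k = slopes q k.
Proof.
move=> a0; elim: n => [|n ih] rp; first by near=> q => k; rewrite ltn0.
have c : sin (coordinate n.+2 q) @[q --> p] --> sin (coordinate n.+2 p).
  apply: (@continuous_comp _ _ _ (coordinate n.+2) sin).
    exact: coordinate_continuous.
  exact: continuous_sin.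
have rn := rp n (ltnSn n).
have hn : \forall q \near p, slopes p n = slopes q n.
  have [h|h] := leP 0 (sin (coordinate n.+2 p)).
    have {rn}h : 0 < sin (coordinate n.+2 p) by rewrite lt0r rn h.
    have : \forall q \near p, 0 < sin (coordinate n.+2 q) by apply: (cvgr_gt _ c).
    apply: filterS => q hq.
    by rewrite !slopesE /hslope !ltW.
  have : \forall q \near p, sin (coordinate n.+2 q) < 0 by apply: (cvgr_lt _ c).
  apply: filterS => q hq.
  by rewrite !slopesE /hslope leNgt h/= leNgt hq.
apply: filterS2 (ih (regularS rp)) hn => q h1 h2 k.
by rewrite ltnS leq_eqVlt => /predU1P[->//|/h1].
Unshelve. all: by end_near. Qed.

(** Near a regular point the slopes of the profile along the orbit are constant,
    so only the weight is differentiated. *)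
Lemma is_derive_potential n p v w : 0 <= alpha -> regular n.+2 p ->
  is_derive p v (potential w n.+2)
    (dweight (factors p) (dfactors p) (sol alpha (slopes p) v) n.+2
     * slope alpha (slopes p) w n.+2).
Proof.
move=> a0 rp.
have d1 := is_derive_weight v rp.
have := @is_deriveZ _ _ _ _ (slope alpha (slopes p) w n.+2) _ _ _ d1.
move=> d2; rewrite mulrC; move: d2; apply: near_eq_is_derive.
have := slopes_near a0 (regularS (regularS rp)); apply: filterS => q hq.
rewrite /potential mulrC /GRing.scale/=; congr (_ * _).
exact: slope_ext.
Qed.

Section lipschitz.
Hypothesis alpha20 : 20 <= alpha.
Hypothesis m1 : 1 <= m.

Let a0 : 0 <= alpha.
Proof. by apply: le_trans alpha20. Qed.

Let lip (f : R * R * R -> R) :=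
  exists2 L, 0 <= L & forall p q, `|f p - f q| <= L * `|p - q|.

Lemma factors_lipschitz k : lip (factors ^~ k).
Proof.
have [L L0 fL] := factor_lipschitz m k.
exists (L * (1 + alpha) ^+ k) => [|p q].
  by rewrite mulr_ge0// exprn_ge0// addr_ge0.
apply: le_trans (fL _ _) _; rewrite -mulrA ler_wpM2l//.
exact: coordinate_lipschitz.
Qed.

Lemma factors_norm p k : `|factors p k| <= 1.
Proof. exact: factor_norm. Qed.

Lemma weight_norm p k : `|weight (factors p) k| <= 1.
Proof. by apply: weight1 => n; exact: factors_norm. Qed.

Lemma weight_lipschitz n : lip (fun p => weight (factors p) n).
Proof.
elim: n => [|n [L L0 ih]].
  by exists 0 => // p q; rewrite /weight !big_ord0 subrr normr0 mul0r.
have [K K0 fK] := factors_lipschitz n.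
exists (L + K) => [|p q]; first exact: addr_ge0.
rewrite /weight !big_ord_recr/= -!/(weight _ n).
have -> : weight (factors p) n * factors p n - weight (factors q) n * factors q n =
  (weight (factors p) n - weight (factors q) n) * factors p n +
  weight (factors q) n * (factors p n - factors q n) by ring.
apply: le_trans (ler_normD _ _) _; rewrite !normrM mulrDl; apply: lerD.
  by rewrite -[leRHS]mulr1; apply: ler_pM => //; exact: factors_norm.
by rewrite -[leRHS]mul1r; apply: ler_pM => //; exact: weight_norm.
Qed.

(** If the slopes at time [k] differ, the coordinates of index [k.+2] are on the
    two sides of a kink, at which the factor of this index vanishes. *)
Lemma weight_jump n : exists2 L, 0 <= L & forall p q,
  (exists2 k, (k < n)%N & slopes p k != slopes q k) ->
  `|weight (factors p) n.+2| <= L * `|p - q|.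
Proof.
elim: n => [|n [L L0 ih]]; first by exists 0 => // p q [k].
have [K K0 fK] := @factor_jump _ m n.+2 isT.
exists (L + K * (1 + alpha) ^+ n.+2) => [|p q [k]].
  by rewrite addr_ge0// mulr_ge0// exprn_ge0// addr_ge0.
have KK : 0 <= K * (1 + alpha) ^+ n.+2.
  by rewrite mulr_ge0// exprn_ge0// addr_ge0.
rewrite /weight big_ord_recr/= -/(weight (factors p) n.+2) normrM mulrDl.
rewrite ltnS leq_eqVlt => /predU1P[->|kn] pq.
  apply: le_trans (_ : K * (1 + alpha) ^+ n.+2 * `|p - q| <= _); last first.
    by rewrite lerDr mulr_ge0.
  rewrite -[leRHS]mul1r; apply: ler_pM => //; first exact: weight_norm.
  move: pq; rewrite !slopesE => /fK/le_trans; apply; rewrite -mulrA ler_wpM2l//.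
  exact: coordinate_lipschitz.
apply: le_trans (_ : L * `|p - q| <= _); last by rewrite lerDl mulr_ge0.
rewrite -[leRHS]mulr1; apply: ler_pM => //; last exact: (factor_norm m n.+2).
by apply: ih; exists k.
Qed.

Lemma slope_norm n p w : w = (1, 0, 0) \/ w = (0, 1, 0) \/ w = (0, 0, 1) ->
  `|slope alpha (slopes p) w n.+2| <= 1.
Proof.
have e1 := slopes_norm p.
case=> [->|[->|->]].
- by rewrite /slope divff ?normr1// sol_x_neq0.
- by apply: (slope_bound e1 alpha20) => //=; rewrite ?normr1 ?normr0.
- by apply: (slope_bound e1 alpha20) => //=; rewrite ?normr1 ?normr0.
Qed.

(** Two points with the same slopes have the same normalised gradients, and then
    the weight is responsible for the increment; otherwise the weight is small
    at both points. *)
Lemma potential_lipschitz n w : w = (1, 0, 0) \/ w = (0, 1, 0) \/ w = (0, 0, 1) ->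
  lip (potential w n.+2).
Proof.
move=> hw; have [L L0 wL] := weight_lipschitz n.+2.
have [K K0 wK] := weight_jump n.
exists (L + (K + K)) => [|p q]; first by rewrite !addr_ge0.
have pq0 := normr_ge0 (p - q).
rewrite /potential.
have [/forallP same|/forallPn[k pqk]] :=
    boolP [forall k : 'I_n, slopes p k == slopes q k].
  rewrite (@slope_ext (slopes p) (slopes q)) => [|k kn]; last first.
    exact/eqP/(same (Ordinal kn)).
  rewrite -mulrBl normrM -[leRHS]mulr1; apply: ler_pM => //; last exact: slope_norm.
  by apply: le_trans (wL _ _) _; rewrite ler_wpM2r// lerDl addr_ge0.
have hp : `|weight (factors p) n.+2| <= K * `|p - q| by apply: wK; exists k.
have hq : `|weight (factors q) n.+2| <= K * `|p - q|.
  by rewrite distrC; apply: wK; exists k => //; rewrite eq_sym.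
apply: le_trans (ler_normB _ _) _.
rewrite (normrM (weight (factors p) _)) (normrM (weight (factors q) _)).
have hp' : `|weight (factors p) n.+2| * `|slope alpha (slopes p) w n.+2| <= K * `|p - q|.
  by rewrite -[leRHS]mulr1; apply: ler_pM => //; exact: slope_norm.
have hq' : `|weight (factors q) n.+2| * `|slope alpha (slopes q) w n.+2| <= K * `|p - q|.
  by rewrite -[leRHS]mulr1; apply: ler_pM => //; exact: slope_norm.
have : 0 <= L * `|p - q| by rewrite mulr_ge0.
by rewrite !mulrDl; lra.
Qed.

Lemma potential_norm n p w : w = (1, 0, 0) \/ w = (0, 1, 0) \/ w = (0, 0, 1) ->
  `|potential w n.+2 p| <= 1.
Proof.
move=> hw; rewrite /potential normrM mulr_ile1//; first exact: weight_norm.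
exact: slope_norm.
Qed.

End lipschitz.

End dynamics.

(** * Integrals of cross products of derivatives *)

Section cell_calculus.
Context {R : realType}.
Implicit Types (f g A : R * R * R -> R) (p q v e : R * R * R).

Notation CI f := (\int[vol]_(p in cell) (f p)%:E)%E.

Definition bounded_measurable f := measurable_fun setT f /\ exists K, forall p, `|f p| <= K.

Lemma bounded_measurableD f g : bounded_measurable f -> bounded_measurable g -> bounded_measurable (f \+ g).
Proof.
move=> [mf [K fK]] [mg [L gL]]; split; first exact: measurable_funD.
by exists (K + L) => p; apply: le_trans (ler_normD _ _) _; exact: lerD.
Qed.

Lemma bounded_measurableB f g : bounded_measurable f -> bounded_measurable g -> bounded_measurable (f \- g).
Proof.
move=> [mf [K fK]] [mg [L gL]]; split; first exact: measurable_funB.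
by exists (K + L) => p; apply: le_trans (ler_normB _ _) _; exact: lerD.
Qed.

Lemma bounded_measurableM f g : bounded_measurable f -> bounded_measurable g -> bounded_measurable (f \* g).
Proof.
move=> [mf [K fK]] [mg [L gL]]; split; first exact: measurable_funM.
by exists (K * L) => p; rewrite normrM ler_pM.
Qed.

Lemma bounded_measurable_cst (c : R) : bounded_measurable (cst c).
Proof. by split => //; exists `|c| => p. Qed.

Lemma bounded_measurable_comp f S : measurable_fun setT S -> bounded_measurable f ->
  bounded_measurable (f \o S).
Proof.
move=> mS [mf [K fK]]; split; first exact: measurableT_comp.
by exists K => p; exact: fK.
Qed.

Lemma vol_cell_lty : (vol (@cell R) < +oo)%E.
Proof. by rewrite vol_cell ltry. Qed.

Lemma bounded_measurable_integrable f : bounded_measurable f -> vol.-integrable cell (EFin \o f).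
Proof.
move=> [mf [K fK]]; apply: measurable_bounded_integrable.
- exact: measurable_cell.
- exact: vol_cell_lty.
- exact: measurable_funTS.
- exists K; split; first exact: num_real.
  by move=> M KM p _; apply: le_trans (fK p) (ltW KM).
Qed.

Lemma cell_integralB f g : bounded_measurable f -> bounded_measurable g ->
  (CI (f \- g) = CI f - CI g)%E.
Proof.
move=> bf bg; rewrite -(integralB_EFin measurable_cell (bounded_measurable_integrable bf) (bounded_measurable_integrable bg)).
by apply: eq_integral => p _; rewrite EFinB.
Qed.

Lemma cell_integralD f g : bounded_measurable f -> bounded_measurable g ->
  (CI (f \+ g) = CI f + CI g)%E.
Proof.
move=> bf bg; rewrite -(integralD_EFin measurable_cell (bounded_measurable_integrable bf) (bounded_measurable_integrable bg)).
by apply: eq_integral => p _; rewrite /= EFinD.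
Qed.

Lemma cell_integral_sum3_eq0 (f1 f2 f3 f : R * R * R -> R) :
  bounded_measurable f1 -> bounded_measurable f2 -> bounded_measurable f3 ->
  CI f1 = 0%E -> CI f2 = 0%E -> CI f3 = 0%E ->
  (forall p, f p = f1 p + f2 p + f3 p) -> CI f = 0%E.
Proof.
move=> b1 b2 b3 i1 i2 i3 fE.
transitivity (CI ((f1 \+ f2) \+ f3)).
  by apply: eq_integral => p _; rewrite fE.
by rewrite (cell_integralD (bounded_measurableD b1 b2) b3) (cell_integralD b1 b2) i1 i2 i3 !adde0.
Qed.

Lemma cell_integral_comp f S : volume_preserving S -> measurable_fun setT f -> torus_periodic f ->
  CI (f \o S) = CI f.
Proof.
move=> vS mf pf; apply: (cell_integral_vp (f := EFin \o f)) => //.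
  exact/measurable_EFinP.
by move=> x y z; have [h1 h2 h3] := pf x y z; rewrite /= h1 h2 h3.
Qed.

Lemma cell_integral_lim0 (u : nat -> R * R * R -> R) f (K : R) :
  (forall n, measurable_fun setT (u n)) -> measurable_fun setT f ->
  {ae vol, forall p, cell p -> u ^~ p @ \oo --> f p} ->
  (forall n p, `|u n p| <= K) -> (forall n, CI (u n) = 0%E) -> CI f = 0%E.
Proof.
move=> mu mf uf uK u0.
have [|||||_ _] := @dominated_convergence _ _ R vol cell measurable_cell
  (fun n p => (u n p)%:E) (fun p => (f p)%:E) (cst K%:E).
- by move=> n; apply: measurable_funTS; exact/measurable_EFinP.
- by apply: measurable_funTS; exact/measurable_EFinP.
- apply: filterS uf => p uf /uf h; apply: cvg_EFin => //.
  by apply: nearW => n.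
- exact: (bounded_measurable_integrable (bounded_measurable_cst K)).
- by apply: aeW => p n _; rewrite lee_fin.
rewrite (_ : [sequence _]_n = cst 0%E); last by apply/funext => n; rewrite /= u0.
by move=> /cvg_lim <- //; rewrite lim_cst.
Qed.

Lemma difference_quotient f p e (l : R) : is_derive p e f l ->
  (fun n => (n.+1%:R) * (f (p + n.+1%:R^-1 *: e) - f p)) @ \oo --> l /\
  (fun n => (n.+1%:R) * (f p - f (p - n.+1%:R^-1 *: e))) @ \oo --> l.
Proof.
move=> [d dl]; move: d; rewrite /derivable => d.
have {d dl}d : h^-1 *: ((f \o shift p) (h *: e) - f p) @[h --> 0^'] --> l.
  by rewrite -dl; exact: d.
move/cvgr_dnbhsP : d => d; split.
- rewrite (_ : (fun n => _) = (fun n => n.+1%:R^-1^-1 *: ((f \o shift p) (n.+1%:R^-1 *: e) - f p))).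
    apply: (d (fun n => n.+1%:R^-1)); split; last exact: cvg_harmonic.
    by move=> n; rewrite invr_eq0 pnatr_eq0.
  by apply/funext => n; rewrite invrK /= [p + _]addrC.
- rewrite (_ : (fun n => _) =
    (fun n => (- n.+1%:R^-1)^-1 *: ((f \o shift p) (- n.+1%:R^-1 *: e) - f p))).
    apply: (d (fun n => - n.+1%:R^-1)); split.
      by move=> n; rewrite oppr_eq0 invr_eq0 pnatr_eq0.
    by rewrite -[0]oppr0; apply: cvgN; exact: cvg_harmonic.
  apply/funext => n; by rewrite invrN invrK /= [X in _ *: (f X - _)]addrC !scaleNr -scalerN opprB.
Qed.

(** That the divergence of a curl vanishes becomes an exact identity for
    increments: a translation, being volume-preserving, can be moved from [A] to
    [f] with the opposite sign, after which the two terms cancel at each point.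
    Periodicity is asked of the increments of [f] so as to admit the
    coordinates. *)
Lemma increments_commute A f v v' :
  bounded_measurable A -> torus_periodic A -> measurable_fun setT f ->
  (forall w, torus_periodic (fun p => f (p - w) - f p)) ->
  (forall w, exists K, forall p, `|f (p - w) - f p| <= K) ->
  CI (fun p => (A (p + v) - A p) * (f (p - v') - f p) -
               (A (p + v') - A p) * (f (p - v) - f p)) = 0%E.
Proof.
move=> bA pA mf pf bf.
have mtr w : measurable_fun setT (fun p : R * R * R => p + w).
  by have [] := vp_translate w.
pose g w := fun p => f (p - w) - f p.
have bg w : bounded_measurable (g w).
  split; last exact: bf.
  by apply: measurable_funB => //; exact: (measurableT_comp mf (mtr (- w))).
have bAt w : bounded_measurable (A \o (fun p => p + w)) by apply: bounded_measurable_comp.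
have bgt w w' : bounded_measurable (g w \o (fun p => p + w')) by apply: bounded_measurable_comp.
pose H w w' := (A \o (fun p => p + w)) \* g w'.
have bH w w' : bounded_measurable (H w w') by apply: bounded_measurableM.
pose H' w w' := A \* (g w' \o (fun p => p - w)).
have bH' w w' : bounded_measurable (H' w w') by apply: bounded_measurableM.
have HH' w w' : CI (H w w') = CI (H' w w').
  rewrite -(@cell_integral_comp (H w w') (fun p => p - w)); last 3 first.
  - exact: vp_translate.
  - by have [] := bH w w'.
  - have [_ pt _] := vp_translate w.
    move=> x y z; have [a1 a2 a3] := pt _ _ pA x y z; have [b1 b2 b3] := pf w' x y z.
    rewrite /H /= /g; split.
    + by move: a1 b1; rewrite /= => -> ->.
    + by move: a2 b2; rewrite /= => -> ->.
    + by move: a3 b3; rewrite /= => -> ->.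
  by apply: eq_integral => p _; rewrite /H /H' /= subrK.
(* the part without translation of [A] is the same before and after the move *)
pose L := A \* (g v' \- g v).
have bL : bounded_measurable L by apply: bounded_measurableM => //; exact: bounded_measurableB.
transitivity (CI ((H v v' \- H v' v) \- L)).
  by apply: eq_integral => p _; rewrite /H /L /g /=; congr (_%:E); ring.
rewrite cell_integralB//; last exact: bounded_measurableB.
rewrite cell_integralB// !HH' -cell_integralB// -cell_integralB//; last exact: bounded_measurableB.
rewrite integral0_eq// => p _; rewrite /H' /L /g /=.
have -> : p - v' - v = p - v - v' by rewrite addrAC.
by congr (_%:E); ring.
Qed.

(** The limit of [increments_commute] for increments of size [n.+1%:R^-1]. The
    Lipschitz bounds give bounded convergence, and [A] may fail to be
    differentiable on a null set. *)
Lemma cross_derivative_integral A f e e' (dA dA' df df' : R * R * R -> R) (K L : R) :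
  bounded_measurable A -> torus_periodic A -> measurable_fun setT f ->
  (forall w, torus_periodic (fun p => f (p - w) - f p)) ->
  (forall w, exists K, forall p, `|f (p - w) - f p| <= K) ->
  (forall p t, `|A (p + t *: e) - A p| <= K * `|t|) ->
  (forall p t, `|A (p + t *: e') - A p| <= K * `|t|) ->
  (forall p t, `|f (p + t *: e) - f p| <= L * `|t|) ->
  (forall p t, `|f (p + t *: e') - f p| <= L * `|t|) ->
  {ae vol, forall p, cell p -> is_derive p e A (dA p) /\ is_derive p e' A (dA' p)} ->
  (forall p, is_derive p e f (df p)) -> (forall p, is_derive p e' f (df' p)) ->
  measurable_fun setT (fun p => dA p * df' p - dA' p * df p) ->
  CI (fun p => dA p * df' p - dA' p * df p) = 0%E.
Proof.
move=> bA pA mf pf bf KA KA' Lf Lf' dAe dfe dfe' mD.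
pose N n : R := n.+1%:R.
pose D n p := N n * (A (p + (N n)^-1 *: e) - A p) * (N n * (f p - f (p - (N n)^-1 *: e'))) -
  N n * (A (p + (N n)^-1 *: e') - A p) * (N n * (f p - f (p - (N n)^-1 *: e))).
have N0 n : 0 < N n by rewrite /N ltr0n.
have mtr w : measurable_fun setT (fun p : R * R * R => p + w).
  by have [] := vp_translate w.
have mAt w : measurable_fun setT (fun p => A (p + w)).
  by apply: measurableT_comp => //; case: bA.
have mft w : measurable_fun setT (fun p => f (p - w)).
  by apply: measurableT_comp => //; exact: mtr.
have mA : measurable_fun setT A by case: bA.
have mDn n : measurable_fun setT (D n).
  by apply: measurable_funB; apply: measurable_funM; apply: measurable_funM => //;
    exact: measurable_funB.
have bq (u : R * R * R -> R) (M c : R) w n p : (forall p t, `|u (p + t *: w) - u p| <= M * `|t|) ->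
    `|c| = (N n)^-1 -> `|N n * (u (p + c *: w) - u p)| <= M.
  move=> uM cN; rewrite normrM gtr0_norm// mulrC -ler_pdivlMr//.
  by rewrite -cN; exact: uM.
have absN n : `|(N n)^-1| = (N n)^-1 by rewrite gtr0_norm// invr_gt0.
have absNN n : `|- (N n)^-1| = (N n)^-1 by rewrite normrN.
have KL n p : `|D n p| <= K * L + K * L.
  have qA := bq A K _ e n p KA (absN n); have qA' := bq A K _ e' n p KA' (absN n).
  have qf := bq f L _ e n p Lf (absNN n); have qf' := bq f L _ e' n p Lf' (absNN n).
  rewrite !scaleNr in qf qf'; rewrite /D; apply: le_trans (ler_normB _ _) _.
  apply: lerD; rewrite normrM ler_pM//.
    by rewrite -normrN -mulrN opprB.
  by rewrite -normrN -mulrN opprB.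
apply: (@cell_integral_lim0 D _ (K * L + K * L)) => //.
- apply: filterS dAe => p h /h [h1 h2].
  have [a1 _] := difference_quotient h1; have [a2 _] := difference_quotient h2.
  have [_ b1] := difference_quotient (dfe p); have [_ b2] := difference_quotient (dfe' p).
  by apply: cvgB; apply: cvgM.
- move=> n.
  have := @increments_commute A f ((N n)^-1 *: e) ((N n)^-1 *: e') bA pA mf pf bf.
  pose F p := (A (p + (N n)^-1 *: e) - A p) * (f (p - (N n)^-1 *: e') - f p) -
       (A (p + (N n)^-1 *: e') - A p) * (f (p - (N n)^-1 *: e) - f p).
  rewrite -/(CI F) => F0.
  have bg w : bounded_measurable (fun p => f (p - w) - f p).
    by split => //; exact: measurable_funB.
  have bAt w : bounded_measurable (fun p => A (p + w) - A p).
    by apply: (@bounded_measurableB (A \o (fun p => p + w))) => //; apply: bounded_measurable_comp.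
  have bF : bounded_measurable F.
    by apply: (@bounded_measurableB (fun p => _ * _) (fun p => _ * _)); apply: (@bounded_measurableM (fun p => _ - _) (fun p => _ - _)).
  transitivity (\int[vol]_(p in cell) ((- (N n * N n))%:E * (F p)%:E))%E.
    by apply: eq_integral => p _; rewrite /D /F -EFinM; congr (_%:E); ring.
  by rewrite integralZl ?F0 ?mule0//; [exact: measurable_cell|exact: bounded_measurable_integrable].
Qed.

End cell_calculus.

(** * The initial field *)

Section continuous_measurable3.
Context {R : realType}.

(** The boxes with rational centres and radii [k.+1%:R^-1] form a countable base
    of the topology. *)
Lemma open_measurable3 (U : set (R * R * R)) : open U -> measurable U.
Proof.
move=> oU.
pose box (i : (rat * rat * rat) * nat) : set (R * R * R) :=
  [set p | [/\ `|p.1.1 - ratr i.1.1.1| < i.2.+1%:R^-1,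
     `|p.1.2 - ratr i.1.1.2| < i.2.+1%:R^-1 & `|p.2 - ratr i.1.2| < i.2.+1%:R^-1]].
pose F i : set (R * R * R) := if `[< box i `<=` U >] then box i else set0.
have mbox i : measurable (box i).
  have mb (a r : R) : measurable [set x : R | `|x - a| < r].
    rewrite (_ : [set x : R | _] = `](a - r), (a + r)[%classic); first exact: measurable_itv.
    by apply/seteqP; split => x /=; rewrite in_itv/= ltr_distl.
  rewrite (_ : box i = [set x : R | `|x - ratr i.1.1.1| < i.2.+1%:R^-1] `*`
     [set x : R | `|x - ratr i.1.1.2| < i.2.+1%:R^-1] `*`
     [set x : R | `|x - ratr i.1.2| < i.2.+1%:R^-1]).
    by apply: measurableX => //; exact: measurableX.
  by apply/seteqP; split => -[[x y] z] /=; [move=> [] | move=> [[]]].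
have -> : U = \bigcup_i F i.
  apply/seteqP; split => [p Up|p [i _]]; last first.
    by rewrite /F; case: asboolP => // h /h.
  have /nbhs_ballP[eps /= eps0 pU] : nbhs p U by exact: open_nbhs_nbhs.
  have [k _ kE] : \forall k \near \oo, k.+1%:R^-1 < eps / 2 :> R.
    have := @cvg_harmonic R; move/cvgrPdist_lt => /(_ (eps / 2)); rewrite divr_gt0//.
    move=> /(_ isT); apply: filterS => k; rewrite sub0r normrN ger0_norm//; exact: harmonic_ge0.
  have {kE}hk := kE k (leqnn k).
  have k0 : 0 < k.+1%:R^-1 :> R by rewrite invr_gt0.
  have rat_near (x : R) : exists q : rat, `|x - ratr q| < k.+1%:R^-1.
    have [|q] := @rat_in_itvoo R (x - k.+1%:R^-1) (x + k.+1%:R^-1).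
      by rewrite ltrBlDr -addrA ltrDl addr_gt0.
    by rewrite in_itv/= => hq; exists q; rewrite distrC ltr_distl.
  have [a ha] := rat_near p.1.1; have [b hb] := rat_near p.1.2; have [c hc] := rat_near p.2.
  exists ((a, b, c), k) => //; rewrite /F asboolT; first by split.
  move=> q [/= qa qb qc]; apply: pU.
  have tri (x y z : R) : `|x - z| < k.+1%:R^-1 -> `|y - z| < k.+1%:R^-1 -> `|x - y| < eps.
    move=> h1 h2; have := ler_distD z x y; rewrite (distrC z).
    by move: h1 h2 hk; set r := _^-1; lra.
  by rewrite /ball/= /prod_ball/= /ball/= /prod_ball/=; split; [split|];
    rewrite /ball/=; [exact: tri ha qa|exact: tri hb qb|exact: tri hc qc].
apply: countable_bigcupT_measurable; first exact: countableP.
by move=> i; rewrite /F; case: asboolP.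
Qed.

Lemma continuous_measurable3 (f : R * R * R -> R) : continuous f -> measurable_fun setT f.
Proof.
move=> /continuousP cf; apply: (measurability _ (RGenOpens.measurableE R)).
move=> _ [_ [a [b ->] <-]]; rewrite setTI; apply: open_measurable3.
exact/cf/interval_open.
Qed.

Lemma measurable_inv : measurable_fun setT (fun x : R => x^-1).
Proof.
rewrite -(setUv [set (0 : R)]); apply/measurable_funU => //.
  exact: measurableC.
split; first exact: measurable_fun_set1.
apply: open_continuous_measurable_fun.
  by rewrite openC; exact: closed_eq.
by move=> x; rewrite inE /= => /eqP x0; exact: inv_continuous.
Qed.

End continuous_measurable3.

Section unstable_field.
Context {R : realType} (alpha m : R).
Hypothesis alpha20 : 20 <= alpha.
Hypothesis m1 : 1 <= m.
Implicit Types (p q v : R * R * R).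

Let a0 : 0 <= alpha. Proof. by apply: le_trans alpha20. Qed.

Lemma negligible_cell (A : set (R * R * R)) : measurable A ->
  vol (cell `&` A) = 0%E -> {ae vol, forall p, cell p -> ~ A p}.
Proof.
move=> mA A0; exists (cell `&` A); split => //.
  by apply: measurableI => //; exact: measurable_cell.
by move=> p /= /not_implyP[cp /contrapT Ap].
Qed.

Lemma sin_eq0_circle (x : R) : x \in `[0, 2 * pi[ -> sin x = 0 -> x = 0 \/ x = pi.
Proof.
rewrite in_itv/= => /andP[x0 x2] sx.
have [xp|xp|->] := ltgtP x pi; last by right.
  left; apply/eqP; rewrite eq_le x0 andbT leNgt; apply/negP => {}x0.
  by have := @sin_gt0_pi R x; rewrite x0 xp sx ltxx => /(_ isT).
have := @sin_gt0_pi R (x - pi).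
rewrite subr_gt0 xp ltrBlDr -mulr2n -mulr_natl x2 => /(_ isT).
by rewrite -[sin _]opprK -sinDpi subrK sx oppr0 ltxx.
Qed.

Lemma vol_sin_eq0 : vol (cell `&` [set p : R * R * R | sin p.1.1 = 0]) = 0%E.
Proof.
have mI : measurable (`[0, 2 * pi[ : set R) by exact: measurable_itv.
have m0 (c : R) : vol ([set c] `*` `[0, 2 * pi[ `*` `[0, 2 * pi[) = 0%E.
  by rewrite vol_box// /leb lebesgue_measure_set1 !mul0e.
have mc (c : R) : measurable ([set c] `*` `[0, 2 * pi[ `*` `[0, 2 * pi[ : set (R * R * R)).
  by apply: measurableX => //; exact: measurableX.
apply: (@subset_measure0 _ _ _ _ _ (([set 0] `*` `[0, 2 * pi[ `*` `[0, 2 * pi[) `|`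
   ([set pi] `*` `[0, 2 * pi[ `*` `[0, 2 * pi[))).
- apply: measurableI; first exact: measurable_cell.
  rewrite -[X in measurable X]setTI.
  have : measurable_fun setT (fun p : R * R * R => sin p.1.1).
    apply: (measurableT_comp (f := @sin R)).
      by apply: continuous_measurable_fun; exact: continuous_sin.
    exact: (measurableT_comp measurable_fst measurable_fst).
  by move=> /(_ measurableT [set 0] (measurable_set1 _)).
- exact: measurableU.
- move=> [[x y] z] [[[/= xI yI] zI]] sx.
  by have [->|->] := sin_eq0_circle xI sx; [left|right].
- have h (c : R) (X : set (R * R * R)) : X = [set c] `*` `[0, 2 * pi[ `*` `[0, 2 * pi[ ->
      (vol X <= 0)%E.
    by move=> ->; rewrite m0.
  apply/eqP; rewrite eq_le measure_ge0 andbT.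
  apply: le_trans (measureU2 vol (mc 0) (mc pi)) _.
  by rewrite -[leRHS]adde0; apply: leeD; [exact: (h 0)|exact: (h pi)].
Qed.

(** The points whose orbit meets a kink at time [k] form the preimage of a null
    set under a volume-preserving map. *)
Lemma ae_regular_vp S : volume_preserving S ->
  {ae vol, forall p, cell p -> forall n, regular alpha n (S p)}.
Proof.
move=> vS.
have H k : {ae vol, forall p : R * R * R, cell p -> sin (coordinate alpha k.+2 (S p)) != 0}.
  pose Z : set (R * R * R) := [set p | sin p.1.1 = 0].
  have mZ : measurable Z.
    rewrite -[X in measurable X]setTI.
    have : measurable_fun setT (fun p : R * R * R => sin p.1.1).
      apply: (measurableT_comp (f := @sin R)).
        by apply: continuous_measurable_fun; exact: continuous_sin.
      exact: (measurableT_comp measurable_fst measurable_fst).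
    by move=> /(_ measurableT [set 0] (measurable_set1 _)).
  have vo := vp_comp (vp_orbit alpha k) vS.
  have mo : measurable_fun setT (orbit alpha k \o S) by have [] := vo.
  have mZk : measurable ((orbit alpha k \o S) @^-1` Z).
    by rewrite -[X in measurable X]setTI; exact: mo.
  have pZ : torus_periodic (fun p : R * R * R => Z p).
    by move=> x y z; rewrite /Z /=; split => //; rewrite sin_period.
  have Z0 : vol (cell `&` (orbit alpha k \o S) @^-1` Z) = 0%E.
    by rewrite (cell_measure_vp vo mZ pZ) vol_sin_eq0.
  apply: filterS (negligible_cell mZk Z0) => p h cp; apply/eqP => s0.
  by apply: (h cp); rewrite /Z /= orbitE.
have := ae_foralln H; apply: filterS => p h cp n k _; exact: h.
Qed.

Definition unstable_field p : R * R * R :=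
  unstable_vector alpha (slopes alpha p) (factors alpha m p) (dfactors alpha m p).

Definition curl_approx n p : R * R * R :=
  curl_field alpha (slopes alpha p) (factors alpha m p) (dfactors alpha m p) n.

(** All three are functions of points of the orbit, which are periodic in the
    coordinates of these points. *)
Lemma dynamics_periodic : [/\ torus_periodic (slopes alpha),
  torus_periodic (factors alpha m) & torus_periodic (dfactors alpha m)].
Proof.
have H (u : nat -> R * R * R -> R) : (forall n, torus_periodic (u n)) ->
    torus_periodic (fun p n => u n p).
  by move=> hu x y z; split; apply/funext => n; have [] := hu n x y z.
have P n : torus_map (orbit alpha n) by have [] := vp_orbit alpha n.
split.
- apply: (H (fun n p => slopes alpha p n)) => n.
  apply: (P n _ (fun q => hslope q.1.1)) => x y z.
  by split => //=; exact: hslope_period.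
- apply: (H (fun n p => factors alpha m p n)) => n.
  apply: (P n _ (fun q => factor m n q.2)) => x y z.
  by split => //=; exact: factor_period.
- apply: (H (fun n p => dfactors alpha m p n)) => n.
  apply: (P n _ (fun q => dfactor m n q.2)) => x y z.
  by split => //=; exact: dfactor_period.
Qed.

Lemma unstable_field_periodic : torus_periodic unstable_field.
Proof.
have [s f d] := dynamics_periodic => x y z.
have [s1 s2 s3] := s x y z; have [f1 f2 f3] := f x y z; have [d1 d2 d3] := d x y z.
by rewrite /unstable_field s1 s2 s3 f1 f2 f3 d1 d2 d3.
Qed.

Lemma potential_periodic v n : torus_periodic (potential alpha m v n).
Proof.
have [s f d] := dynamics_periodic => x y z.
have [s1 s2 s3] := s x y z; have [f1 f2 f3] := f x y z.
by rewrite /potential s1 s2 s3 f1 f2 f3.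
Qed.

Lemma measurable_orbit n : measurable_fun setT (orbit alpha n).
Proof. by have [] := vp_orbit alpha n. Qed.

Lemma measurable_slopes n : measurable_fun setT (fun p => slopes alpha p n).
Proof.
apply: (measurableT_comp measurable_hslope).
apply: (measurableT_comp measurable_fst).
exact: (measurableT_comp measurable_fst (measurable_orbit n)).
Qed.

Lemma measurable_coordinate n : measurable_fun setT (coordinate alpha n).
Proof. exact: (measurableT_comp measurable_snd (measurable_orbit n)). Qed.

Lemma measurable_factors n : measurable_fun setT (fun p => factors alpha m p n).
Proof.
apply: measurableT_comp (measurable_coordinate n).
by apply: continuous_measurable_fun; exact: factor_continuous.
Qed.

Lemma measurable_dfactors n : measurable_fun setT (fun p => dfactors alpha m p n).
Proof.
apply: measurableT_comp (measurable_coordinate n).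
have ms : measurable_fun setT (@sin R) by apply: continuous_measurable_fun; exact: continuous_sin.
have mc : measurable_fun setT (@cos R) by apply: continuous_measurable_fun; exact: continuous_cos.
case: n => [|[|n]] //; rewrite /dfactor /dcutoff.
apply: measurable_funM; first by apply: measurable_funM => //; exact: measurable_funM.
apply: measurable_maxr => //; apply: measurable_funB => //.
by apply: measurable_funX; exact: measurable_funM.
Qed.

Lemma measurable_tangent n (V : R * R * R -> R * R * R) : measurable_fun setT V ->
  measurable_fun setT (fun p => tangent alpha (slopes alpha p) n (V p)).
Proof.
move=> mV; elim: n => [|n ih]; first exact: mV.
rewrite /= /tangent_step.
have m11 := measurableT_comp measurable_fst (measurableT_comp measurable_fst ih).
have m12 := measurableT_comp measurable_snd (measurableT_comp measurable_fst ih).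
have m2 := measurableT_comp measurable_snd ih.
apply: measurable_fun_pair => //; apply: measurable_fun_pair => //.
apply: measurable_funB => //; apply: measurable_funM => //.
by apply: measurable_funM => //; exact: measurable_slopes.
Qed.

Lemma measurable_sol n v : measurable_fun setT (fun p => sol alpha (slopes alpha p) v n).
Proof. exact: (measurableT_comp measurable_snd (measurable_tangent n (measurable_cst v))). Qed.

Lemma measurable_slope n v : measurable_fun setT (fun p => slope alpha (slopes alpha p) v n).
Proof.
apply: measurable_funM; first exact: measurable_sol.
by apply: measurableT_comp measurable_inv _; exact: measurable_sol.
Qed.

Lemma measurable_weight n : measurable_fun setT (fun p => weight (factors alpha m p) n).
Proof.
elim: n => [|n ih].
  by rewrite /weight; under eq_fun do rewrite big_ord0; exact: measurable_cst.
rewrite /weight; under eq_fun do rewrite big_ord_recr.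
by apply: measurable_funM => //; exact: measurable_factors.
Qed.

Lemma measurable_dweight n v : measurable_fun setT
  (fun p => dweight (factors alpha m p) (dfactors alpha m p) (sol alpha (slopes alpha p) v) n).
Proof.
elim: n => [|n ih]; first exact: measurable_cst.
rewrite /=; apply: measurable_funD.
  by apply: measurable_funM => //; exact: measurable_factors.
apply: measurable_funM; last exact: measurable_sol.
apply: measurable_funM; [exact: measurable_weight|exact: measurable_dfactors].
Qed.

Lemma measurable_leafwise n v : measurable_fun setT
  (fun p => leafwise alpha (slopes alpha p) (factors alpha m p) (dfactors alpha m p) v n).
Proof.
apply: measurable_funB; first exact: measurable_dweight.
by apply: measurable_funM; [exact: measurable_slope|exact: measurable_dweight].
Qed.

Lemma measurable_curl_approx n : [/\ measurable_fun setT (fun p => (curl_approx n p).1.1),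
  measurable_fun setT (fun p => (curl_approx n p).1.2) &
  measurable_fun setT (fun p => (curl_approx n p).2)].
Proof.
rewrite /curl_approx /curl_field /=; split.
- by apply: measurable_funB; apply: measurable_funM;
    (exact: measurable_leafwise || exact: measurable_slope).
- exact: measurable_leafwise.
- by apply: measurable_funN; exact: measurable_leafwise.
Qed.

Let hs p n : `|slopes alpha p n| = 1. Proof. exact: slopes_norm. Qed.
Let hF1 p n : `|factors alpha m p n| <= 1. Proof. exact: factor_norm. Qed.
Let hF0 p n : (2 <= n)%N -> 0 <= factors alpha m p n. Proof. exact: factor_ge0. Qed.
Let hG p n : `|dfactors alpha m p n| <= 4 * m * 2 ^+ n. Proof. exact: dfactor_norm. Qed.

Lemma curl_approx_cvg p :
  [/\ (fun n => (curl_approx n p).1.1) @ \oo --> (unstable_field p).1.1,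
      (fun n => (curl_approx n p).1.2) @ \oo --> (unstable_field p).1.2 &
      (fun n => (curl_approx n p).2) @ \oo --> (unstable_field p).2].
Proof. exact: (curl_field_cvg (hs p) alpha20 (hF1 p) (hF0 p) (hG p)). Qed.

Lemma curl_approx_bound n p :
  [/\ `|(curl_approx n.+2 p).1.1| <= 16 * (4 * m), `|(curl_approx n.+2 p).1.2| <= 16 * (4 * m) &
      `|(curl_approx n.+2 p).2| <= 16 * (4 * m)].
Proof. exact: (curl_field_bound (hs p) alpha20 (hF1 p) (hG p)). Qed.

Lemma sol_unstable_field p n :
  `|sol alpha (slopes alpha p) (unstable_field p) n| <= 64 * (4 * m) / 4 ^+ n.
Proof. exact: (sol_unstable_vector_bound (hs p) alpha20 (hF1 p) (hF0 p) (hG p) n). Qed.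

Lemma measurable_unstable_field : measurable_fun setT unstable_field.
Proof.
have mc n := measurable_curl_approx n.
rewrite (_ : unstable_field = fun p => ((unstable_field p).1.1, (unstable_field p).1.2, (unstable_field p).2)); last first.
  by apply/funext => p; case: (unstable_field p) => -[].
apply: measurable_fun_pair; first apply: measurable_fun_pair.
- by apply: (measurable_fun_cvg (h := fun n p => (curl_approx n p).1.1)) => [n|p _];
    [have [] := mc n|have [] := curl_approx_cvg p].
- by apply: (measurable_fun_cvg (h := fun n p => (curl_approx n p).1.2)) => [n|p _];
    [have [] := mc n|have [] := curl_approx_cvg p].
- by apply: (measurable_fun_cvg (h := fun n p => (curl_approx n p).2)) => [n|p _];
    [have [] := mc n|have [] := curl_approx_cvg p].
Qed.

Let ex : R * R * R := (1, 0, 0).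
Let ey : R * R * R := (0, 1, 0).
Let ez : R * R * R := (0, 0, 1).

(** The functions against which a curl integrates to zero. They include the
    smooth periodic functions, for the divergence, and the coordinates, for the
    mean: periodicity is asked of the increments only. *)
Definition admissible (f : R * R * R -> R) :=
  [/\ measurable_fun setT f,
      forall w, torus_periodic (fun p => f (p - w) - f p),
      forall w, exists K, forall p, `|f (p - w) - f p| <= K &
      forall e, e = ex \/ e = ey \/ e = ez ->
      [/\ exists L, forall p t, `|f (p + t *: e) - f p| <= L * `|t|,
          forall p, derivable f p e, measurable_fun setT (fun p => 'D_e f p) &
          exists K, forall p, `|'D_e f p| <= K]].

Let ex1 : ex = ex \/ ex = ey \/ ex = ez. Proof. by left. Qed.
Let ey1 : ey = ex \/ ey = ey \/ ey = ez. Proof. by right; left. Qed.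
Let ez1 : ez = ex \/ ez = ey \/ ez = ez. Proof. by right; right. Qed.

Let basis_norm (e : R * R * R) : e = ex \/ e = ey \/ e = ez -> `|e| <= 1.
Proof. by case=> [->|[->|->]]; rewrite sup_norm_le /= normr0 normr1 lexx ler01. Qed.

Lemma bounded_measurable_potential n w : w = ex \/ w = ey \/ w = ez ->
  bounded_measurable (potential alpha m w n.+2).
Proof.
move=> hw; split; last first.
  by exists 1 => p; exact: (potential_norm m alpha20 n p hw).
apply: measurable_funM; [exact: measurable_weight|exact: measurable_slope].
Qed.

Notation E n v p :=
  (dweight (factors alpha m p) (dfactors alpha m p) (sol alpha (slopes alpha p) v) n).
Notation r n w p := (slope alpha (slopes alpha p) w n).

(** The identity that [div curl = 0] consists of, for one component of the
    potential and one pair of directions. *)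
Lemma potential_cross n f e e' w : admissible f ->
  e = ex \/ e = ey \/ e = ez -> e' = ex \/ e' = ey \/ e' = ez ->
  w = ex \/ w = ey \/ w = ez ->
  (\int[vol]_(p in cell) (E n.+2 e p * r n.+2 w p * 'D_e' f p -
                         E n.+2 e' p * r n.+2 w p * 'D_e f p)%:E = 0)%E.
Proof.
move=> [mf pf bf df] he he' hw.
have [[L Lf] dfe mfe _] := df e he; have [[L' Lf'] dfe' mfe' _] := df e' he'.
have [K K0 KA] := potential_lipschitz m alpha20 n hw.
have bA := bounded_measurable_potential n hw.
have KAe d p t : d = ex \/ d = ey \/ d = ez ->
    `|potential alpha m w n.+2 (p + t *: d) - potential alpha m w n.+2 p| <= K * `|t|.
  move=> hd; apply: le_trans (KA _ _) _; rewrite addrAC subrr add0r normrZ.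
  by apply: ler_wpM2l => //; rewrite -[leRHS]mulr1 ler_wpM2l// basis_norm.
apply: (@cross_derivative_integral _ (potential alpha m w n.+2) f e e'
  (fun p => E n.+2 e p * r n.+2 w p) (fun p => E n.+2 e' p * r n.+2 w p)
  (fun p => 'D_e f p) (fun p => 'D_e' f p) K (Num.max L L')) => //.
- exact: potential_periodic.
- by move=> p t; exact: KAe.
- by move=> p t; exact: KAe.
- by move=> p t; apply: le_trans (Lf p t) _; rewrite ler_wpM2r// le_max lexx.
- by move=> p t; apply: le_trans (Lf' p t) _; rewrite ler_wpM2r// le_max lexx orbT.
- apply: filterS (ae_regular_vp vp_id) => p h cp.
  by split; apply: is_derive_potential => //; exact: h.
- have mE d := measurable_dweight n.+2 d; have ms := measurable_slope n.+2 w.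
  exact: measurable_funB (measurable_funM (measurable_funM (mE e) ms) mfe')
    (measurable_funM (measurable_funM (mE e') ms) mfe).
Qed.

Lemma bounded_measurable_partial f e : admissible f -> e = ex \/ e = ey \/ e = ez ->
  bounded_measurable (fun p => 'D_e f p).
Proof. by move=> [_ _ _ h] /h []. Qed.

Lemma bounded_measurable_curl_approx n : [/\ bounded_measurable (fun p => (curl_approx n.+2 p).1.1),
  bounded_measurable (fun p => (curl_approx n.+2 p).1.2) &
  bounded_measurable (fun p => (curl_approx n.+2 p).2)].
Proof.
have [mx my mz] := measurable_curl_approx n.+2.
by split; split => //; exists (16 * (4 * m)) => p; have [] := curl_approx_bound n p.
Qed.

Lemma bounded_measurable_dweight n v : bounded_measurable (fun p => E n v p).
Proof.
split; first exact: measurable_dweight.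
have bs k : exists K, forall p, `|sol alpha (slopes alpha p) v k| <= K.
  exists ((1 + alpha) ^+ k * `|v|) => p.
  have [_ _ h] := norm_coords (tangent alpha (slopes alpha p) k v).
  apply: le_trans h _; elim: k => [|k ih]; first by rewrite expr0 mul1r.
  rewrite exprS -mulrA; set w := tangent alpha (slopes alpha p) k v in ih *.
  have [w1 w2 w3] := norm_coords w.
  apply: le_trans (_ : (1 + alpha) * `|w| <= _); last by rewrite ler_wpM2l// addr_ge0.
  have aw : 0 <= alpha * `|w| by rewrite mulr_ge0.
  rewrite /= sup_norm_le /= -/w; apply/and3P; split; [|lra|lra].
  apply: le_trans (ler_normB _ _) _; rewrite mulrDl mul1r lerD//.
  rewrite !normrM slopes_norm mulr1 (ger0_norm a0).
  exact: ler_wpM2l.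
elim: n => [|n [K ih]]; first by exists 0 => p; rewrite normr0.
have [L hL] := bs n; exists (K + 1 * (4 * m * 2 ^+ n) * L) => p /=.
apply: le_trans (ler_normD _ _) _; apply: lerD.
  by rewrite normrM -[leRHS]mul1r ler_pM.
rewrite !normrM; apply: ler_pM => //; apply: ler_pM => //.
by apply: weight1; exact: hF1.
Qed.

Lemma curl_identity (Ex Ey Ez ry rz fx fy fz : R) :
  ((Ey - ry * Ex) * rz - (Ez - rz * Ex) * ry) * fx +
    (Ez - rz * Ex) * fy + - (Ey - ry * Ex) * fz =
  (Ey * rz * fx - Ex * rz * fy) + (Ez * 1 * fy - Ey * 1 * fz) +
    (Ex * ry * fz - Ez * ry * fx).
Proof. by ring. Qed.

(** The pairing with a gradient splits into three integrals of
    [potential_cross], one for each component of the potential. *)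
Lemma curl_approx_div_free n f : admissible f ->
  (\int[vol]_(p in cell) (dot (curl_approx n.+2 p) (grad f p))%:E = 0)%E.
Proof.
move=> af; have [bx by_ bz] := bounded_measurable_curl_approx n.
have dx := bounded_measurable_partial af ex1; have dy := bounded_measurable_partial af ey1; have dz := bounded_measurable_partial af ez1.
have i1 := potential_cross n af ey1 ex1 ez1.
have i2 := potential_cross n af ez1 ey1 ex1.
have i3 := potential_cross n af ex1 ez1 ey1.
have bE e : bounded_measurable (fun p => E n.+2 e p) by exact: bounded_measurable_dweight.
have br w : w = ex \/ w = ey \/ w = ez -> bounded_measurable (fun p => r n.+2 w p).
  move=> hw; split; first exact: measurable_slope.
  by exists 1 => p; exact: slope_norm.
have bM e w e' : w = ex \/ w = ey \/ w = ez -> e' = ex \/ e' = ey \/ e' = ez ->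
    bounded_measurable (fun p => E n.+2 e p * r n.+2 w p * 'D_e' f p).
  move=> hw he'; apply: (@bounded_measurableM _ (fun p => E n.+2 e p * r n.+2 w p)); last exact: bounded_measurable_partial.
  by apply: (@bounded_measurableM _ (fun p => E n.+2 e p)) => //; exact: br.
have b1 := bounded_measurableB (bM ey ez ex ez1 ex1) (bM ex ez ey ez1 ey1).
have b2 := bounded_measurableB (bM ez ex ey ex1 ey1) (bM ey ex ez ex1 ez1).
have b3 := bounded_measurableB (bM ex ey ez ey1 ez1) (bM ez ey ex ey1 ex1).
apply: (cell_integral_sum3_eq0 b1 b2 b3 i1 i2 i3) => p /=.
have r1 : r n.+2 ex p = 1 by rewrite /slope divff// sol_x_neq0//; exact: slopes_norm.
rewrite r1; exact: curl_identity.
Qed.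

End unstable_field.

(** * The initial field is divergence-free and mean-free *)

Section test_functions.
Context {R : realType}.
Implicit Types (p q v w e : R * R * R) (f g : R * R * R -> R).

Lemma periodic_bounded f : continuous f -> torus_periodic f ->
  exists K, forall p, `|f p| <= K.
Proof.
move=> cf pf.
pose I : set R := `[0, 2 * pi]%classic.
have cI : compact (I `*` I `*` I).
  by apply: compact_setX; [apply: compact_setX|]; exact: segment_compact.
have /compact_bounded[M [_ hM]] := continuous_compact (continuous_subspaceT cf) cI.
exists (`|M| + 1) => -[[x y] z].
pose red (t : R) := t - 2 * pi * (Num.floor (t / (2 * pi)))%:~R.
have p0 : (0 < 2 * pi :> R) by rewrite mulr_gt0// pi_gt0.
have Ired t : I (red t).
  rewrite /I /= in_itv/= /red; set k := Num.floor _.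
  have h1 := ge_floor (t / (2 * pi)).
  have := floorD1_gt (t / (2 * pi)); rewrite intrD -/k in h1 * => h2.
  have sE : t = (2 * pi * (t / (2 * pi))) by rewrite mulrC divfK// gt_eqF.
  by apply/andP; split; nra.
have fred : f (x, y, z) = f (red x, red y, red z).
  have hx := periodic_intmul (f := fun t => f (t, y, z)) (c := 2 * pi).
  have {}hx := hx (fun t => let: And3 h _ _ := pf t y z in h).
  have hy := periodic_intmul (f := fun t => f (red x, t, z)) (c := 2 * pi).
  have {}hy := hy (fun t => let: And3 _ h _ := pf (red x) t z in h).
  have hz := periodic_intmul (f := fun t => f (red x, red y, t)) (c := 2 * pi).
  have {}hz := hz (fun t => let: And3 _ _ h := pf (red x) (red y) t in h).
  rewrite -{1}(subrK (2 * pi * (Num.floor (x / (2 * pi)))%:~R) x) hx -/(red x).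
  rewrite -{1}(subrK (2 * pi * (Num.floor (y / (2 * pi)))%:~R) y) hy -/(red y).
  by rewrite -{1}(subrK (2 * pi * (Num.floor (z / (2 * pi)))%:~R) z) hz.
rewrite fred; apply: hM; first by rewrite ltr_pwDr// ler_norm.
by exists (red x, red y, red z) => //; split; [split|]; exact: Ired.
Qed.

Lemma is_derive_line f p e (s : R) : derivable f (p + s *: e) e ->
  is_derive s (1 : R) (fun t => f (p + t *: e)) ('D_e f (p + s *: e)).
Proof.
move=> d.
have E : (fun h : R => h^-1 *: (((fun t => f (p + t *: e)) \o shift s) (h *: (1 : R)) - f (p + s *: e))) =
    (fun h => h^-1 *: ((f \o shift (p + s *: e)) (h *: e) - f (p + s *: e))).
  apply/funext => h /=; congr (_ *: (f _ - _)).
  by rewrite scaler1 scalerDl addrCA addrC.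
apply: DeriveDef; first by rewrite /derivable E.
by rewrite /derive E.
Qed.

Lemma line_lipschitz f e (K : R) : (forall p, derivable f p e) ->
  (forall p, `|'D_e f p| <= K) -> forall p t, `|f (p + t *: e) - f p| <= K * `|t|.
Proof.
move=> df dK p t.
pose g s := f (p + s *: e).
have dg s : is_derive s (1 : R) g ('D_e f (p + s *: e)) by exact: is_derive_line.
have cg (a b : R) : {within `[a, b], continuous g}.
  apply: derivable_within_continuous => s _.
  by have [] := dg s.
have -> : f (p + t *: e) - f p = g t - g 0 by rewrite /g scale0r addr0.
have [t0|t0] := leP 0 t.
  have [c _ ->] := @MVT_segment R g (fun s => 'D_e f (p + s *: e)) 0 t t0 (fun s _ => dg s) (cg 0 t).
  by rewrite normrM subr0 ler_wpM2r.
have [c _ h] := @MVT_segment R g (fun s => 'D_e f (p + s *: e)) t 0 (ltW t0) (fun s _ => dg s) (cg t 0).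
by rewrite distrC h normrM sub0r normrN ler_wpM2r.
Qed.

(** Derivatives commute with translations. *)
Lemma derive_periodic f e : torus_periodic f -> torus_periodic (fun p => 'D_e f p).
Proof.
move=> pf.
have H p c : (forall q, f (q + c) = f q) -> 'D_e f (p + c) = 'D_e f p.
  move=> fc; rewrite /derive.
  have -> // : (fun h : R => h^-1 *: ((f \o shift (p + c)) (h *: e) - f (p + c))) =
      (fun h => h^-1 *: ((f \o shift p) (h *: e) - f p)).
  by apply/funext => h /=; rewrite addrA !fc.
have Hx q : f (q + (2 * pi, 0, 0)) = f q.
  by case: q => -[x y] z; have [h _ _] := pf x y z; rewrite -h; congr f; congr (_, _, _); rewrite /= addr0.
have Hy q : f (q + (0, 2 * pi, 0)) = f q.
  by case: q => -[x y] z; have [_ h _] := pf x y z; rewrite -h; congr f; congr (_, _, _); rewrite /= addr0.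
have Hz q : f (q + (0, 0, 2 * pi)) = f q.
  by case: q => -[x y] z; have [_ _ h] := pf x y z; rewrite -h; congr f; congr (_, _, _); rewrite /= addr0.
move=> x y z; split.
- rewrite -(H (x, y, z) _ Hx); congr ('D_e f _); congr (_, _, _); rewrite /= addr0//.
- rewrite -(H (x, y, z) _ Hy); congr ('D_e f _); congr (_, _, _); rewrite /= addr0//.
- rewrite -(H (x, y, z) _ Hz); congr ('D_e f _); congr (_, _, _); rewrite /= addr0//.
Qed.

Lemma test_function_admissible f : test_function f -> admissible f.
Proof.
move=> [pf cf].
have c0 : continuous f by exact: (cf 0%N).
have [df cdf] := cf 1%N.
have [K hK] := periodic_bounded c0 pf.
split.
- exact: continuous_measurable3.
- move=> w; have [_ pt _] := vp_translate (- w).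
  move=> x y z; have [a1 a2 a3] := pt _ _ pf x y z; have [b1 b2 b3] := pf x y z.
  by move: a1 a2 a3; rewrite /= => -> -> ->; rewrite b1 b2 b3.
- by move=> w; exists (K + K) => p; apply: le_trans (ler_normB _ _) _; exact: lerD.
- move=> e _.
  have ce : continuous (fun p => 'D_e f p) by exact: cdf.
  have [L hL] := periodic_bounded ce (derive_periodic e pf).
  have de p : derivable f p e by exact: diff_derivable.
  split => //; [|exact: continuous_measurable3|by exists L].
  by exists L => p t; exact: line_lipschitz.
Qed.

Lemma coordinate_admissible f :
  measurable_fun setT f -> (forall p w, f (p + w) - f p = f w) -> (forall p, is_diff p f f) ->
  (forall t p, f (t *: p) = t * f p) ->
  admissible f.
Proof.
move=> mf fD df fZ.
have D e p : 'D_e f p = f e.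
  by have /(is_diff_is_derive e) [_ ->] := df p.
split => //.
- by move=> w x y z; rewrite !fD.
- by move=> w; exists `|f (- w)| => p; rewrite fD.
- move=> e _; split.
  + by exists `|f e| => p t; rewrite fD fZ normrM mulrC.
  + by move=> p; have /(is_diff_is_derive e) [] := df p.
  + by under eq_fun do rewrite D; exact: measurable_cst.
  + by exists `|f e| => p; rewrite D.
Qed.

Lemma admissible_coords : [/\ admissible (fun p : R * R * R => p.1.1),
  admissible (fun p : R * R * R => p.1.2) & admissible (fun p : R * R * R => p.2)].
Proof.
split; apply: coordinate_admissible => //=.
- exact: (measurableT_comp measurable_fst measurable_fst).
- by move=> p w; rewrite addrAC subrr add0r.
- exact: is_diff_11.
- exact: (measurableT_comp measurable_snd measurable_fst).
- by move=> p w; rewrite addrAC subrr add0r.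
- exact: is_diff_12.
- exact: measurable_snd.
- by move=> p w; rewrite addrAC subrr add0r.
- by move=> p; exact: is_diff_snd.
Qed.

Lemma grad_coords p : [/\ grad (fun p : R * R * R => p.1.1) p = (1, 0, 0),
  grad (fun p : R * R * R => p.1.2) p = (0, 1, 0) &
  grad (fun p : R * R * R => p.2) p = (0, 0, 1)].
Proof.
have D (f : R * R * R -> R) e : is_diff p f f -> 'D_e f p = f e.
  by move=> /(is_diff_is_derive e) [].
split; rewrite /grad !(D _ _ (is_diff_11 p), D _ _ (is_diff_12 p), D _ _ (is_diff_snd p))//.
Qed.

End test_functions.

Section field_properties.
Context {R : realType} (alpha m : R).
Hypothesis alpha20 : 20 <= alpha.
Hypothesis m1 : 1 <= m.
Implicit Types (p q v : R * R * R).

Notation B0 := (unstable_field alpha m).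

Lemma unstable_field_bound p : [/\ `|(B0 p).1.1| <= 64 * m, `|(B0 p).1.2| <= 64 * m &
  `|(B0 p).2| <= 64 * m].
Proof.
have [cx cy cz] := curl_approx_cvg alpha20 m1 p.
have h n : (2 <= n)%N -> [/\ `|(curl_approx alpha m n p).1.1| <= 64 * m,
   `|(curl_approx alpha m n p).1.2| <= 64 * m & `|(curl_approx alpha m n p).2| <= 64 * m].
  case: n => [|[|n]]// _; have [h1 h2 h3] := curl_approx_bound alpha20 m1 n p.
  by split; lra.
split.
- by apply: (norm_le_cvg cx) => n /h [].
- by apply: (norm_le_cvg cy) => n /h [].
- by apply: (norm_le_cvg cz) => n /h [].
Qed.

Lemma unstable_field_orthogonal f : admissible f ->
  (\int[vol]_(p in cell) (dot (B0 p) (grad f p))%:E = 0)%E.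
Proof.
move=> af.
have [mfx [Kx hx]] := bounded_measurable_partial af (or_introl erefl).
have [mfy [Ky hy]] := bounded_measurable_partial af (or_intror (or_introl erefl)).
have [mfz [Kz hz]] := bounded_measurable_partial af (or_intror (or_intror erefl)).
have mdot (B : R * R * R -> R * R * R) : measurable_fun setT (fun p => (B p).1.1) ->
    measurable_fun setT (fun p => (B p).1.2) -> measurable_fun setT (fun p => (B p).2) ->
    measurable_fun setT (fun p => dot (B p) (grad f p)).
  move=> mx my mz; rewrite /dot /grad /=.
  exact: measurable_funD (measurable_funD (measurable_funM mx mfx) (measurable_funM my mfy))
    (measurable_funM mz mfz).
have mB := measurable_unstable_field alpha20 m1.
apply: (@cell_integral_lim0 _ (fun n p => dot (curl_approx alpha m n.+2 p) (grad f p)) _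
  (64 * m * Kx + 64 * m * Ky + 64 * m * Kz)).
- by move=> n; have [mx my mz] := measurable_curl_approx alpha m n.+2; exact: mdot.
- apply: mdot.
  + exact: (measurableT_comp measurable_fst (measurableT_comp measurable_fst mB)).
  + exact: (measurableT_comp measurable_snd (measurableT_comp measurable_fst mB)).
  + exact: (measurableT_comp measurable_snd mB).
- apply: aeW => p _; have [cx cy cz] := curl_approx_cvg alpha20 m1 p.
  have sh (u : R^nat) (l : R) : u @ \oo --> l -> (fun n => u n.+2) @ \oo --> l.
    move=> ul; have := ul; rewrite -(cvg_shiftn 2); apply: cvg_trans.
    by rewrite (_ : (fun n => u n.+2) = (fun n => u (n + 2)%N))//; apply/funext => n; rewrite addn2.
  rewrite /dot; apply: cvgD; first apply: cvgD.
  + by apply: cvgM; [exact: (sh _ _ cx)|exact: cvg_cst].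
  + by apply: cvgM; [exact: (sh _ _ cy)|exact: cvg_cst].
  + by apply: cvgM; [exact: (sh _ _ cz)|exact: cvg_cst].
- move=> n p; have [h1 h2 h3] := curl_approx_bound alpha20 m1 n p.
  have mm : 16 * (4 * m) = 64 * m by ring.
  rewrite mm in h1 h2 h3.
  rewrite /dot; apply: le_trans (ler_normD _ _) _; apply: lerD.
    apply: le_trans (ler_normD _ _) _; apply: lerD; rewrite normrM ler_pM//.
    + exact: hx.
    + exact: hy.
  by rewrite normrM ler_pM//; exact: hz.
- by move=> n; exact: curl_approx_div_free.
Qed.

Lemma unstable_field_div_free : div_free B0.
Proof. by move=> f /test_function_admissible; exact: unstable_field_orthogonal. Qed.

(** The means are the pairings with the gradients of the coordinates. *)
Lemma unstable_field_mean_free : mean_free B0.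
Proof.
have [ax ay az] := admissible_coords (R := R).
split.
- rewrite -[RHS](unstable_field_orthogonal ax); apply: eq_integral => p _.
  by have [-> _ _] := grad_coords p; rewrite /dot /= mulr1 !mulr0 !addr0.
- rewrite -[RHS](unstable_field_orthogonal ay); apply: eq_integral => p _.
  by have [_ -> _] := grad_coords p; rewrite /dot /= mulr1 !mulr0 addr0 add0r.
- rewrite -[RHS](unstable_field_orthogonal az); apply: eq_integral => p _.
  by have [_ _ ->] := grad_coords p; rewrite /dot /= mulr1 !mulr0 !add0r.
Qed.

Lemma unstable_field_torus : torus_field B0.
Proof. by split; [exact: unstable_field_periodic|exact: measurable_unstable_field]. Qed.

(** With all the cut-offs inactive, only the derivative of the factor [sin]
    remains, at the coordinate of index 1, which is [y]. *)
Lemma unstable_field_good p :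
  (forall n, 1 <= (m * 2 ^+ n.+2 * sin (coordinate alpha n.+2 p)) ^+ 2) ->
  (B0 p).2 = - cos p.1.2.
Proof.
move=> good; rewrite /unstable_field unstable_vector_good//.
by case=> [|[|n]]// _; exact: (cutoff_far (good n)).
Qed.

End field_properties.

(** * The flow of the reversed velocity *)

Section flow.
Context {R : realType} (alpha : R).
Implicit Types (p q v x : R * R * R) (n : nat) (t r s : R).

Local Notation h := (@hprofile R).

Lemma rot3 p : rot (rot (rot p)) = p.
Proof. by case: p => -[]. Qed.

Lemma iter_rot3 n p : iter (3 * n) rot p = p.
Proof. by elim: n => [//|n ih]; rewrite mulnS iterD ih /= rot3. Qed.

Lemma iter_rotK n p : iter (2 * n) rot (iter n rot p) = p.
Proof. by rewrite -iterD -mulSnr iter_rot3. Qed.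

Lemma iter_rotVK n p : iter n rot (iter (2 * n) rot p) = p.
Proof. by rewrite -iterD -mulSn iter_rot3. Qed.

Lemma iter_rot_diff n p : is_diff p (iter n rot) (iter n rot).
Proof.
elim: n => [|n ih]; first exact: is_diff_id.
exact: (@is_diff_comp _ _ _ _ _ _ _ _ p ih (is_diff_rot _)).
Qed.

Lemma iter_rot_norm n p : `|iter n rot p| = `|p|.
Proof.
elim: n => [//|n <-]; rewrite iterS; set q := iter n rot p.
by rewrite !prod_normE /= maxC maxA.
Qed.

Lemma shearE r p : shear alpha r p = (p.1, p.2 - r * alpha * h p.1.1).
Proof. by []. Qed.

Lemma shearK r : cancel (shear alpha r) (shear alpha (- r)).
Proof. by move=> [[x y] z]; rewrite !shearE /=; congr (_, _); ring. Qed.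

Lemma shearVK r : cancel (shear alpha (- r)) (shear alpha r).
Proof. by move=> [[x y] z]; rewrite !shearE /=; congr (_, _); ring. Qed.

Definition unstep p := shear alpha (- 1) (rot p).

Lemma stepK : cancel (step alpha) unstep.
Proof. by move=> p; rewrite /unstep /step rot3 shearK. Qed.

Lemma unstepK : cancel unstep (step alpha).
Proof. by move=> p; rewrite /unstep /step shearVK rot3. Qed.

Lemma iter_cancel (f g : R * R * R -> R * R * R) n :
  cancel f g -> cancel (iter n f) (iter n g).
Proof. by move=> fK; elim: n => [//|n ih] p; rewrite iterSr iterS fK ih. Qed.

(** The motion during the [n]-th third of a unit of time, [n] counted from 0: a
    fraction of the next shear, with the permutations of the coordinates undone.
    *)
Definition phase n t p := iter n rot (shear alpha (3 * t - n%:R) (orbit alpha n p)).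

Lemma phase_start n p : phase n (n%:R / 3) p = iter n rot (orbit alpha n p).
Proof.
rewrite /phase shearE (_ : 3 * (n%:R / 3) - n%:R = 0); last by field.
by rewrite !mul0r subr0; case: (orbit _ _ _).
Qed.

Lemma phase_end n p : phase n (n.+1%:R / 3) p = iter n.+1 rot (orbit alpha n.+1 p).
Proof.
rewrite /phase (_ : 3 * (n.+1%:R / 3) - n%:R = 1); last by rewrite -natr1; field.
by rewrite iterSr [orbit _ n.+1 p]iterS /step rot3.
Qed.

Definition flow t p := phase (Num.truncn (3 * t)) t p.

Definition unflow t p :=
  iter (Num.truncn (3 * t)) unstep
    (shear alpha (- (3 * t - (Num.truncn (3 * t))%:R)) (iter (2 * Num.truncn (3 * t)) rot p)).

Lemma flowK t : cancel (flow t) (unflow t).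
Proof.
move=> p; rewrite /flow /unflow /phase iter_rotK shearK.
exact: (iter_cancel _ stepK).
Qed.

Lemma unflowK t : cancel (unflow t) (flow t).
Proof.
move=> p; rewrite /flow /unflow /phase.
by rewrite /orbit (iter_cancel _ unstepK) shearVK iter_rotVK.
Qed.

Lemma vp_unflow t : volume_preserving (unflow t).
Proof.
have vu : volume_preserving unstep by apply: vp_comp; [exact: vp_shear|exact: vp_rot].
have := vp_comp (vp_iter (Num.truncn (3 * t)) vu)
  (vp_comp (vp_shear alpha (- (3 * t - (Num.truncn (3 * t))%:R)))
     (vp_iter (2 * Num.truncn (3 * t)) vp_rot)).
exact.
Qed.

Lemma flowE n t p : n%:R <= 3 * t < n.+1%:R -> flow t p = phase n t p.
Proof. by move=> nt; rewrite /flow (truncn_def nt). Qed.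

(** At integer values of [3 * t] the two adjacent descriptions agree. *)
Lemma flow_closed n t p : n%:R <= 3 * t <= n.+1%:R -> flow t p = phase n t p.
Proof.
move=> /andP[nt tn]; have [lt|gt|eq] := ltgtP (3 * t) n.+1%:R.
- by apply: flowE; rewrite nt.
- by move: tn; rewrite leNgt gt.
have -> : t = n.+1%:R / 3 by rewrite -eq; field.
rewrite phase_end -phase_start; apply: flowE.
rewrite (_ : 3 * (n.+1%:R / 3) = n.+1%:R); last by field.
by rewrite lexx ltr_nat /=.
Qed.

Definition vertical (c : R) : R * R * R := (0, 0, c).

(** In the reversed time the three shears occur in the opposite order, which is
    the order in which [rot] permutes the coordinates. *)
Lemma velocity_phase n t x : n%:R < 3 * t < n.+1%:R ->
  velocity_rev alpha t x =
    iter n rot (vertical (- (3 * alpha * h (iter (2 * n) rot x).1.1))).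
Proof.
move=> /andP[nt tn].
pose k := (n %/ 3)%N; pose j := (n %% 3)%N.
have nE : n = (3 * k + j)%N by rewrite mulnC -divn_eq.
have j3 : (j < 3)%N by rewrite ltn_mod.
have kt : tfrac t = t - k%:R.
  rewrite /tfrac; congr (_ - _).
  have -> : Num.floor t = k%:Z; last by [].
  apply/floor_def; move: nt tn; rewrite nE.
  rewrite -natr1 natrD natrM intrD => nt tn.
  have : (j%:R : R) <= 2%:R by rewrite ler_nat -ltnS.
  have : 0 <= j%:R :> R by [].
  rewrite /=; lra.
have it p : iter n rot p = iter j rot p by rewrite nE addnC iterD iter_rot3.
have it2 p : iter (2 * n) rot p = iter (2 * j) rot p.
  by rewrite nE mulnDr mulnCA addnC iterD iter_rot3.
rewrite it it2 /velocity_rev /velocity kt.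
have E (a b c : R) : - ((3 * alpha) *: (a, b, c)) =
  (- (3 * alpha * a), - (3 * alpha * b), - (3 * alpha * c)) by [].
have nt' : j%:R < 3 * (t - k%:R).
  by move: nt; rewrite nE natrD natrM; lra.
have tn' : 3 * (t - k%:R) < j%:R + 1.
  by move: tn; rewrite -[n.+1]addn1 natrD nE natrD natrM; lra.
move: nt' tn' j3; set f := t - k%:R => {}nt {}tn.
have f0 : 0 < f by have : 0 <= j%:R :> R by []; lra.
move: nt tn; case: j {it it2 nE kt} => [|[|[|//]]] nt tn j3.
- have -> : tfrac (1 - f) = 1 - f.
    rewrite /tfrac (_ : Num.floor (1 - f) = 0) ?subr0//.
    by apply/floor_def; rewrite /=; lra.
  rewrite ifF; last by apply/negbTE; rewrite -leNgt; lra.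
  rewrite ifF; last by apply/negbTE; rewrite -leNgt; lra.
  by rewrite E !mulr0 oppr0.
- have -> : tfrac (1 - f) = 1 - f.
    rewrite /tfrac (_ : Num.floor (1 - f) = 0) ?subr0//.
    by apply/floor_def; rewrite /=; lra.
  rewrite ifF; last by apply/negbTE; rewrite -leNgt; lra.
  rewrite ifT; last lra.
  by rewrite E !mulr0 oppr0.
- have -> : tfrac (1 - f) = 1 - f.
    rewrite /tfrac (_ : Num.floor (1 - f) = 0) ?subr0//.
    by apply/floor_def; rewrite /=; lra.
  rewrite ifT; last lra.
  by rewrite E !mulr0 oppr0.
Qed.

Lemma curve_comp (U V : normedModType R) (f : R -> U) (L dL : U -> V) t (df : U) :
  is_derive t (1 : R) f df -> is_diff (f t) L dL ->
  is_derive t (1 : R) (L \o f) (dL df).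
Proof.
move=> [d dfE] dL'; have ff : differentiable f t by apply/derivable1_diffP.
have Lf : differentiable (L \o f) t by apply: differentiable_comp.
have dLf : derivable (L \o f) t 1 by exact: diff_derivable.
apply: DeriveDef => //; rewrite deriveE// diff_comp//= diff_val.
by rewrite deriv1E// derive1E dfE scale1r.
Qed.

Lemma is_derive_phase n t p :
  is_derive t (1 : R) (fun s => phase n s p)
    (iter n rot (vertical (- (3 * alpha * h (orbit alpha n p).1.1)))).
Proof.
pose d := vertical (- (3 * alpha * h (orbit alpha n p).1.1)).
pose c := orbit alpha n p + vertical (n%:R * alpha * h (orbit alpha n p).1.1).
have dc : is_derive t (1 : R) (fun s => c + s *: d) d.
  have h1 : is_derive t (1 : R) (fun s : R => s *: d) d.
    have := is_diff_scalel t d => hd.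
    apply: DeriveDef; first exact: diff_derivable.
    by rewrite deriveE// diff_val scale1r.
  have := is_deriveD (is_derive_cst c t (1 : R)) h1.
  by rewrite add0r.
have := curve_comp dc (iter_rot_diff n _).
rewrite (_ : iter n rot \o _ = fun s => phase n s p)//.
apply/funext => s; rewrite /= /phase shearE; congr (iter n rot).
rewrite /c /d /vertical; case: (orbit alpha n p) => -[a b] e /=.
by congr (_, _, _); rewrite /= /GRing.scale/=; ring.
Qed.

Lemma is_derive_flow n t p : n%:R < 3 * t < n.+1%:R ->
  is_derive t (1 : R) (fun s => flow s p) (velocity_rev alpha t (flow t p)).
Proof.
move=> /andP[nt tn].
have ntn : n%:R < 3 * t < n.+1%:R by rewrite nt.
have fE : flow t p = phase n t p by apply: flowE; rewrite (ltW nt).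
rewrite (velocity_phase _ ntn) fE {1}/phase iter_rotK shearE /=.
apply: near_eq_is_derive (is_derive_phase n t p).
near=> s; apply/esym/flowE; apply/andP; split.
  apply: ltW; near: s.
  have : 3 * s @[s --> t] --> 3 * t by apply: cvgM; [exact: cvg_cst|exact: cvg_id].
  by move=> c; apply: (cvgr_gt _ c).
near: s.
have : 3 * s @[s --> t] --> 3 * t by apply: cvgM; [exact: cvg_cst|exact: cvg_id].
by move=> c; apply: (cvgr_lt _ c).
Unshelve. all: by end_near. Qed.

Let L : R := 3 * `|alpha| * pi.

Let L0 : 0 <= L. Proof. by rewrite !mulr_ge0// pi_ge0. Qed.

Lemma phase_lipschitz n p s t : `|phase n s p - phase n t p| <= L * `|s - t|.
Proof.
pose d := vertical (- (3 * alpha * h (orbit alpha n p).1.1)).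
have dL : `|d| <= L.
  have c1 (x : R) : -1 <= - cos x <= 1 by rewrite lerN2 cos_le1 lerNl cos_geN1.
  rewrite sup_norm_le /= normr0 L0/= normrN !normrM (ger0_norm (_ : 0 <= 3))//.
  rewrite ler_wpM2l ?mulr_ge0// hprofile_acos ger0_norm ?acos_ge0 ?acos_lepi//.
have -> : phase n s p - phase n t p = iter n rot ((s - t) *: d).
  have E r : phase n r p = iter n rot (orbit alpha n p + (r - n%:R / 3) *: d).
    rewrite /phase shearE; congr (iter n rot).
    rewrite /d /vertical; case: (orbit alpha n p) => -[a b] e /=.
    by congr (_, _, _); rewrite /= /GRing.scale/=; field.
  have additive k q q' : iter k rot q - iter k rot q' = iter k rot (q - q').
    by elim: k => [//|k ih]; rewrite !iterS -ih.
  rewrite !E additive; congr (iter n rot).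
  rewrite opprD addrACA subrr add0r -scalerBl; congr (_ *: _); ring.
by rewrite iter_rot_norm normrZ mulrC ler_wpM2r.
Qed.

(** The phases fit together at integer values of [3 * t], and in each of them
    the speed is bounded by that of the velocity field. *)
Lemma flow_lipschitz p s t : 0 <= s -> 0 <= t -> `|flow s p - flow t p| <= L * `|s - t|.
Proof.
wlog st : s t / s <= t.
  by move=> H s0 t0; have [/H->//|/ltW/H] := leP s t; rewrite distrC (distrC t) => ->.
move=> s0 _; rewrite (distrC s) (ger0_norm (_ : 0 <= t - s)) ?subr_ge0//.
have [n tn] : exists n : nat, t <= n%:R / 3.
  exists (Num.truncn (3 * t)).+1; have := truncnS_gt (3 * t); lra.
elim: n t tn st => [|n ih] t tn st.
  have ts : t = s by apply: le_anti; rewrite st (le_trans tn)// mul0r.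
  by rewrite ts !subrr normr0 mulr0.
have [tn'|nt] := leP t (n%:R / 3); first exact: ih.
have ft : flow t p = phase n t p by apply: flow_closed; lra.
have [ns|sn] := leP (n%:R / 3) s.
  have -> : flow s p = phase n s p by apply: flow_closed; lra.
  by rewrite ft; apply: le_trans (phase_lipschitz _ _ _ _) _; rewrite distrC ger0_norm ?subr_ge0.
have fn : flow (n%:R / 3) p = phase n (n%:R / 3) p.
  by apply: flow_closed; have : (n%:R : R) <= n.+1%:R by [rewrite ler_nat]; lra.
have := ler_distD (flow (n%:R / 3) p) (flow s p) (flow t p).
move/le_trans; apply; have -> : L * (t - s) = L * (n%:R / 3 - s) + L * (t - n%:R / 3) by ring.
apply: lerD; first by apply: ih; rewrite ?lexx// ltW.
rewrite fn ft; apply: le_trans (phase_lipschitz _ _ _ _) _.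
by rewrite distrC ger0_norm ?subr_ge0// ltW.
Qed.

Lemma near_dist (t d : R) : 0 < d -> \forall s \near t, `|t - s| <= d.
Proof.
move=> d0; have tt : (fun s : R => s) @ t --> t by exact: cvg_id.
by move/cvgrPdist_le : tt; exact.
Qed.

Lemma flow_continuous p : {within `[0, +oo[, continuous (fun t : R => flow t p)}.
Proof.
apply/subspace_continuousP => t; rewrite /= in_itv/= andbT => t0.
apply/cvgrPdist_le => eps eps0.
have L1 : 0 < L + 1 by rewrite ltr_wpDl.
have H : \forall s \near t, `|t - s| <= eps / (L + 1).
  by apply: near_dist; exact: divr_gt0.
near=> s.
have s0 : 0 <= s.
  have : `[0, +oo[%classic s by near: s; exact: withinT.
  by rewrite /= in_itv/= andbT.
apply: le_trans (flow_lipschitz p t0 s0) _.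
have : `|t - s| <= eps / (L + 1) by near: s; exact: cvg_within.
rewrite ler_pdivlMr// => ts; apply: le_trans ts.
by rewrite mulrC ler_wpM2l// lerDl.
Unshelve. all: by end_near. Qed.

Lemma constant_speed (f : R -> R) (a b c : R) : a <= b ->
  (forall x : R, x \in `]a, b[ -> is_derive x (1 : R) f c) -> {within `[a, b], continuous f} ->
  f b = f a + c * (b - a).
Proof.
move=> ab df cf.
have [x _ fE] := @MVT_segment R f (fun=> c) a b ab df cf.
by rewrite -fE addrC subrK.
Qed.

(** During a phase the velocity only depends on a coordinate that it does not
    change. So this coordinate is constant, the velocity along the trajectory is
    constant, and the trajectory is a segment that the mean value theorem
    determines. *)
Lemma flow_unique (phi : R -> R * R * R -> R * R * R) :
  is_flow (velocity_rev alpha) phi -> forall t p, 0 <= t -> phi t p = flow t p.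
Proof.
move=> Phi t p t0; have [phi0 cphi dphi] := Phi p.
have start n : phi (n%:R / 3) p = phase n (n%:R / 3) p ->
    forall s, n%:R / 3 <= s <= n.+1%:R / 3 -> phi s p = phase n s p.
  move=> hn.
  pose a : R := n%:R / 3; pose q u := iter (2 * n) rot (phi u p).
  have a0 : 0 <= a by rewrite divr_ge0.
  have cq s (l : R * R * R -> R) : continuous l -> {within `[a, s], continuous (l \o q)}.
    have : {within `[a, s], continuous (fun u => phi u p)}.
      apply: continuous_subspaceW cphi => u /=; rewrite !in_itv/= andbT => /andP[nu _].
      exact: le_trans nu.
    move=> cphi' cl u.
    apply: (@continuous_comp (subspace `[a, s]) _ _ (fun u => phi u p) (l \o iter (2 * n) rot) u).
      exact: cphi'.
    apply: continuous_comp; last exact: cl.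
    by apply: differentiable_continuous; have [] := iter_rot_diff (2 * n) (phi u p).
  have dq s u : s <= n.+1%:R / 3 -> u \in `]a, s[ ->
      is_derive u (1 : R) q (vertical (- (3 * alpha * h (q u).1.1))).
    rewrite in_itv/= => sn /andP[nu us].
    have hu : n%:R < 3 * u < n.+1%:R by rewrite /a in nu; apply/andP; split; lra.
    have u0 : 0 < u by apply: le_lt_trans nu.
    have nint : 3 * u \isn't a Num.int.
      apply/negP => /intrP[z zE]; move: hu; rewrite zE.
      rewrite -[n%:R]/((n%:Z)%:~R) -[n.+1%:R]/((n.+1%:Z)%:~R) !ltr_int => /andP[].
      by rewrite -addn1 PoszD ltzD1 => /lt_le_trans h1 /h1; rewrite ltxx.
    have := curve_comp (dphi u u0 nint) (iter_rot_diff (2 * n) _).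
    by rewrite (velocity_phase _ hu) iter_rotK.
  have c11 : continuous (fun v : R * R * R => v.1.1).
    by move=> v; apply: differentiable_continuous; have [] := is_diff_11 v.
  have c12 : continuous (fun v : R * R * R => v.1.2).
    by move=> v; apply: differentiable_continuous; have [] := is_diff_12 v.
  have c2 : continuous (fun v : R * R * R => v.2) by move=> v; exact: cvg_snd.
  have q11 s : a <= s <= n.+1%:R / 3 -> (q s).1.1 = (q a).1.1.
    move=> /andP[as_ sn].
    have df u : u \in `]a, s[ -> is_derive u (1 : R) (fun u => (q u).1.1) 0.
      by move=> us; exact: (curve_comp (dq s u sn us) (is_diff_11 _)).
    by have := constant_speed as_ df (cq s _ c11); rewrite mul0r addr0.
  have q12 s : a <= s <= n.+1%:R / 3 -> (q s).1.2 = (q a).1.2.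
    move=> /andP[as_ sn].
    have df u : u \in `]a, s[ -> is_derive u (1 : R) (fun u => (q u).1.2) 0.
      by move=> us; exact: (curve_comp (dq s u sn us) (is_diff_12 _)).
    by have := constant_speed as_ df (cq s _ c12); rewrite mul0r addr0.
  have qa : q a = orbit alpha n p.
    by rewrite /q /a hn phase_start iter_rotK.
  move=> s sI; have /andP[as_ sn] := sI.
  have q2 : (q s).2 = (q a).2 + - (3 * alpha * h (q a).1.1) * (s - a).
    have df u : u \in `]a, s[ ->
        is_derive u (1 : R) (fun u => (q u).2) (- (3 * alpha * h (q a).1.1)).
      move=> us; rewrite -(q11 u).
        exact: (curve_comp (dq s u sn us) (is_diff_snd _)).
      move: us; rewrite in_itv/= => /andP[au us].
      by rewrite (ltW au) (le_trans (ltW us)).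
    exact: (constant_speed as_ df (cq s _ c2)).
  rewrite -[LHS](iter_rotVK n) -/(q s) /phase shearE; congr (iter n rot).
  rewrite -qa [LHS](_ : _ = ((q s).1.1, (q s).1.2, (q s).2)); last by case: (q s) => -[].
  rewrite (q11 _ sI) (q12 _ sI) q2.
  case: (q a) => -[x y] z /=; by congr (_, _); rewrite /a; field.
have thirds n : phi (n%:R / 3) p = phase n (n%:R / 3) p.
  elim: n => [|n ih]; first by rewrite mul0r phi0 /phase shearE mulr0 subr0 !mul0r subr0; case: (p).
  rewrite (start n ih) ?phase_end ?phase_start// lexx andbT ler_pM2r// ler_nat//.
have t3 : 0 <= 3 * t by rewrite mulr_ge0.
have /andP[h1 h2] := truncn_itv t3.
by apply: start => //; apply/andP; split; lra.
Qed.

Lemma flow_is_flow : is_flow (velocity_rev alpha) flow.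
Proof.
move=> p; split; first by rewrite (@flowE 0) ?mulr0 ?lexx ?ltr01// /phase shearE mulr0 subr0 !mul0r subr0; case: (p).
  exact: flow_continuous.
move=> t t0 nint.
have t3 : 0 <= 3 * t by rewrite mulr_ge0// ltW.
have /andP[h1 h2] := truncn_itv t3.
apply: (@is_derive_flow (Num.truncn (3 * t))); rewrite h2 andbT lt_neqAle h1 andbT.
by apply: contra nint => /eqP <-; exact: natr_int.
Qed.

Definition dflow t p v :=
  iter (Num.truncn (3 * t)) rot
    (dshear ((3 * t - (Num.truncn (3 * t))%:R) * alpha * slopes alpha p (Num.truncn (3 * t)))
      (tangent alpha (slopes alpha p) (Num.truncn (3 * t)) v)).

Lemma is_diff_flow t p : regular alpha (Num.truncn (3 * t)).+1 p ->
  is_diff p (flow t) (dflow t p).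
Proof.
move=> rp; have d1 := is_diff_orbit (regularS rp).
have hn : sin (orbit alpha (Num.truncn (3 * t)) p).1.1 != 0.
  by have := rp _ (ltnSn _); rewrite orbitE.
have d2 := @is_diff_comp _ _ _ _ _ _ _ _ p d1 (is_diff_shear alpha (3 * t - (Num.truncn (3 * t))%:R) hn).
exact: (@is_diff_comp _ _ _ _ _ _ _ _ p d2 (iter_rot_diff _ _)).
Qed.

End flow.

(** * Norms and the set where the field is explicit *)

Section norms.
Context {R : realType}.
Implicit Types (B : R * R * R -> R * R * R) (p : \bar R).

Lemma enorm_le (v : R * R * R) : enorm v <= 2 * `|v|.
Proof.
have [h1 h2 h3] := norm_coords v.
rewrite /enorm -(ger0_norm (_ : 0 <= 2 * `|v|)) ?mulr_ge0// -sqrtr_sqr ler_sqrt ?sqr_ge0//.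
have sq (x : R) : `|x| <= `|v| -> x * x <= `|v| ^+ 2.
  by move=> h; rewrite -expr2 -(real_normK (num_real x)) lerXn2r ?nnegrE.
have := sq _ h1; have := sq _ h2; have := sq _ h3.
have := sqr_ge0 `|v|; rewrite /dot exprMn; lra.
Qed.

Lemma le_enorm (v : R * R * R) : `|v.2| <= enorm v.
Proof.
rewrite /enorm -sqrtr_sqr ler_sqrt ?expr2 /dot.
  by rewrite lerDr addr_ge0// -expr2 sqr_ge0.
by rewrite !addr_ge0// -expr2 sqr_ge0.
Qed.

Lemma enorm_ge0 (v : R * R * R) : 0 <= enorm v.
Proof. exact: sqrtr_ge0. Qed.

Lemma measurable_enorm B : measurable_fun setT B -> measurable_fun setT (fun x => enorm (B x)).
Proof.
move=> mB.
have m1 := measurableT_comp measurable_fst (measurableT_comp measurable_fst mB).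
have m2 := measurableT_comp measurable_snd (measurableT_comp measurable_fst mB).
have m3 := measurableT_comp measurable_snd mB.
apply: (measurableT_comp (f := @Num.sqrt R)).
  by apply: continuous_measurable_fun; exact: sqrt_continuous.
exact: measurable_funD (measurable_funD (measurable_funM m1 m1) (measurable_funM m2 m2))
  (measurable_funM m3 m3).
Qed.

Local Notation V := ((2 * pi) ^+ 3 : R).

Let V0 : 0 < V. Proof. by rewrite exprn_gt0// mulr_gt0// pi_gt0. Qed.

Let mcell := @measurable_cell R.

Lemma torus_Lnorm_fin (r : R) B : r != 0 ->
  (torus_Lnorm r%:E B = (\int[vol]_(x in cell) (enorm (B x) `^ r)%:E) `^ r^-1)%E.
Proof.
move=> r0; rewrite /torus_Lnorm unlock /=; congr (_ `^ _)%E.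
rewrite [RHS]integral_mkcond; apply: eq_integral => x _; rewrite !patchE.
case: ifPn => _; first by rewrite abse_EFin poweR_EFin ger0_norm ?enorm_ge0.
by rewrite abse0 poweR0r.
Qed.

Lemma torus_Lnorm_infty B :
  torus_Lnorm +oo B = ess_sup vol (abse \o ((fun x => (enorm (B x))%:E) \_ cell)).
Proof.
rewrite /torus_Lnorm unlock /= ifT//.
apply: lt_le_trans (_ : vol (@cell R) <= _)%E; first by rewrite vol_cell lte_fin.
by apply: le_measure; rewrite ?inE.
Qed.

Lemma torus_Lnorm_infty_le B (K : R) : 0 <= K ->
  {ae vol, forall x, cell x -> enorm (B x) <= K} -> (torus_Lnorm +oo B <= K%:E)%E.
Proof.
move=> K0 BK; rewrite torus_Lnorm_infty; apply/ess_supP.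
apply: filterS BK => x h; rewrite /= patchE; case: ifPn => [/set_mem/h xK|_].
  by rewrite abse_EFin lee_fin ger0_norm ?enorm_ge0.
by rewrite abse0 lee_fin.
Qed.

Lemma torus_Lnorm_infty_ge B (c : R) (G : set (R * R * R)) : measurable G -> G `<=` cell ->
  (0 < vol G)%E -> (forall x, G x -> c <= enorm (B x)) -> (c%:E <= torus_Lnorm +oo B)%E.
Proof.
move=> mG Gc G0 Bc; rewrite torus_Lnorm_infty leNgt; apply/negP => hlt.
have [A [mA A0 GA]] := ess_sup_ge vol (abse \o ((fun x => (enorm (B x))%:E) \_ cell)).
suff : (vol G <= 0)%E by rewrite leNgt G0.
rewrite -A0; apply: le_measure; rewrite ?inE// => x Gx.
apply: GA => /= hx; move: (le_lt_trans hx hlt).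
rewrite patchE mem_set; last exact: Gc.
by rewrite abse_EFin lte_fin ger0_norm ?enorm_ge0// ltNge Bc.
Qed.

(** The constant does not depend on [p]: if [V] is the volume of the cell, the
    norms are at most [K * V `^ p^-1] and at least [c * v `^ p^-1] respectively,
    and [(V / v) `^ p^-1 <= V / v]. *)
Lemma torus_Lnorm_compare B B' (K c v : R) (G : set (R * R * R)) p : (1 <= p)%E ->
  measurable_fun setT B -> measurable_fun setT B' ->
  0 <= K -> 0 < c -> 0 < v -> measurable G -> G `<=` cell -> (v%:E <= vol G)%E ->
  (forall x, G x -> c <= enorm (B' x)) ->
  {ae vol, forall x, cell x -> enorm (B x) <= K} ->
  (torus_Lnorm p B <= (K / c * (V / v))%:E * torus_Lnorm p B')%E.
Proof.
move=> p1 mB mB' K0 c0 v0 mG Gc vG B'c BK.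
have vV : v <= V.
  rewrite -lee_fin -vol_cell; apply: le_trans vG _.
  by apply: le_measure; rewrite ?inE.
have Vv1 : 1 <= V / v by rewrite ler_pdivlMr// mul1r.
have Kc0 : 0 <= K / c * (V / v).
  by apply: mulr_ge0; apply: divr_ge0 => //; exact: ltW.
case: p p1 => [r|_|//].
- rewrite lee_fin => r1; have r0 : 0 < r by apply: lt_le_trans r1.
  have rN : r != 0 by rewrite gt_eqF.
  have s0 : 0 <= r^-1 by rewrite invr_ge0 ltW.
  have s1 : r^-1 <= 1 by rewrite invf_le1.
  have mf (B1 : R * R * R -> R * R * R) : measurable_fun setT B1 ->
      measurable_fun cell (fun x => (enorm (B1 x) `^ r)%:E).
    move=> mB1; apply: measurable_funTS; apply/measurable_EFinP.
    apply: (measurableT_comp (f := fun x : R => x `^ r)); first exact: measurable_powR.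
    exact: measurable_enorm.
  have up : (\int[vol]_(x in cell) (enorm (B x) `^ r)%:E <= (K `^ r * V)%:E)%E.
    have aeK : {ae vol, forall x, cell x -> (`|(enorm (B x) `^ r)%:E| <= (K `^ r)%:E)%E}.
      apply: filterS BK => x h /h xK; rewrite abse_EFin lee_fin ger0_norm ?powR_ge0//.
      by apply: ge0_ler_powR; rewrite ?nnegrE ?enorm_ge0// ltW.
    have Kr0 : (0 <= (K `^ r)%:E)%E by rewrite lee_fin powR_ge0.
    have := @integral_le_bound _ _ _ vol cell _ (K `^ r)%:E mcell (mf _ mB) Kr0 aeK.
    have -> : ((K `^ r * V)%:E = (K `^ r)%:E * vol (@cell R))%E by rewrite vol_cell.
    apply: le_trans; rewrite le_eqVlt; apply/orP; left; apply/eqP.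
    by apply: eq_integral => x _; rewrite abse_EFin ger0_norm ?powR_ge0.
  have low : ((c `^ r * v)%:E <= \int[vol]_(x in cell) (enorm (B' x) `^ r)%:E)%E.
    apply: le_trans (_ : \int[vol]_(x in G) (enorm (B' x) `^ r)%:E <= _)%E; last first.
      apply: ge0_subset_integral => //; first exact: mf.
      by move=> x _; rewrite lee_fin powR_ge0.
    apply: le_trans (_ : \int[vol]_(x in G) (cst (c `^ r)%:E x) <= _)%E.
      by rewrite integral_cst// EFinM lee_wpmul2l// lee_fin powR_ge0.
    apply: ge0_le_integral => //.
    - by move=> x _; rewrite lee_fin powR_ge0.
    - by apply: measurable_funS (mf _ mB').
    - move=> x Gx; rewrite lee_fin.
      by apply: ge0_ler_powR; rewrite ?nnegrE ?enorm_ge0//; [exact: ltW|exact: ltW|exact: B'c].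
  rewrite !torus_Lnorm_fin//.
  apply: le_trans (_ : ((K `^ r * V)%:E `^ r^-1 <= _)%E).
    apply: gt0_ler_poweR => //; rewrite in_itv/= leey andbT.
      by apply: integral_ge0 => x _; rewrite lee_fin powR_ge0.
    by rewrite lee_fin mulr_ge0 ?powR_ge0// ltW.
  apply: le_trans (_ : ((K / c * (V / v))%:E * (c `^ r * v)%:E `^ r^-1 <= _)%E); last first.
    apply: lee_wpmul2l; first by rewrite lee_fin.
    apply: gt0_ler_poweR => //; rewrite in_itv/= leey andbT.
      by rewrite lee_fin mulr_ge0 ?powR_ge0// ltW.
    by apply: integral_ge0 => x _; rewrite lee_fin powR_ge0.
  have pw (a b : R) : 0 <= a -> 0 <= b -> (a `^ r * b) `^ r^-1 = a * b `^ r^-1.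
    move=> a0 b0; rewrite powRM ?powR_ge0// -powRrM mulfV// powRr1//.
  rewrite !poweR_EFin -EFinM lee_fin (pw K V K0 (ltW V0)) (pw c v (ltW c0) (ltW v0)).
  have VE : V `^ r^-1 = (V / v) `^ r^-1 * v `^ r^-1.
    by rewrite -powRM ?divfK ?gt_eqF// ltW// divr_gt0.
  have := powR_ge0 v r^-1; set vs := v `^ r^-1 => vs0.
  have : (V / v) `^ r^-1 <= V / v.
    by rewrite -[leRHS]powRr1 ?ler_powR// ltW// divr_gt0.
  rewrite VE; set W := V / v; set Ws := W `^ _ => h.
  have -> : K / c * W * (c * vs) = K * (W * vs) by field; rewrite gt_eqF.
  by rewrite ler_wpM2l// ler_wpM2r.
- apply: le_trans (torus_Lnorm_infty_le K0 BK) _.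
  have h := torus_Lnorm_infty_ge mG Gc (lt_le_trans (_ : 0 < v%:E)%E vG) B'c.
  apply: le_trans (_ : ((K / c * (V / v))%:E * c%:E <= _)%E); last first.
    by apply: lee_wpmul2l; [rewrite lee_fin|apply: h; rewrite lte_fin].
  rewrite -EFinM lee_fin.
  have -> : K / c * (V / v) * c = K * (V / v) by field; rewrite !gt_eqF.
  by rewrite ler_peMr.
Qed.

End norms.

Section good_set.
Context {R : realType}.
Implicit Types (p q v : R * R * R).

Let c1 : R := Num.min (cos 2^-1) (sin 2^-1).

Let half_lt : 2^-1 < pi / 2 :> R.
Proof. by have := @pihalf_ge1 R; lra. Qed.

Let c1_gt0 : 0 < c1.
Proof.
rewrite /c1 lt_min cos_gt0_pihalf; last by apply/andP; split; have := half_lt; lra.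
by rewrite sin_gt0_pihalf// half_lt andbT.
Qed.

Let c1_cos : c1 <= cos 2^-1. Proof. by rewrite ge_min lexx. Qed.
Let c1_sin : c1 <= sin 2^-1. Proof. by rewrite ge_min lexx orbT. Qed.

(** The slope of the sine is at least [c1] up to [2^-1], and after [2^-1] its
    values are at least [c1]. *)
Lemma sin_small (d x : R) : d <= c1 -> 0 <= x <= pi / 2 -> sin x < d -> x < d / c1.
Proof.
move=> dc /andP[x0 xpi] sd; rewrite ltr_pdivlMr//.
have cs (a b : R) : {within `[a, b], continuous (@sin R)}.
  by apply: continuous_subspaceT => y; exact: continuous_sin.
have [xh|hx] := leP x 2^-1.
  have [c cI] := @MVT_segment R sin cos 0 x x0 (fun y _ => is_derive_sin y) (cs 0 x).
  rewrite sin0 !subr0 => E; apply: le_lt_trans sd; rewrite E mulrC ler_wpM2r//.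
  apply: le_trans c1_cos _; move: cI; rewrite in_itv/= => /andP[c0 cx].
  rewrite leNgt ltr_cos ?in_itv/= -?leNgt ?(le_trans cx)//; have := half_lt; have := @pi_gt0 R; lra.
have [c cI] := @MVT_segment R sin cos 2^-1 x (ltW hx) (fun y _ => is_derive_sin y) (cs _ x).
move=> E; have : 0 <= cos c * (x - 2^-1).
  apply: mulr_ge0; last by rewrite subr_ge0 ltW.
  by apply: cos_ge0_pihalf; move: cI; rewrite in_itv/= => /andP[]; lra.
rewrite -E; have := c1_sin; lra.
Qed.

Lemma leb_sin_small (d : R) : 0 < d <= c1 ->
  exists2 S : set R, measurable S &
    (forall x, 0 <= x < 2 * pi -> `|sin x| < d -> S x) /\ (leb S <= (4 * (d / c1))%:E)%E.
Proof.
move=> /andP[d0 dc]; pose w := d / c1; have w0 : 0 < w by rewrite divr_gt0.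
exists ((`[0, w] `|` `[(pi - w), (pi + w)]) `|` `[(2 * pi - w), (2 * pi)])%classic.
  by apply: measurableU => //; apply: measurableU.
split.
  move=> x /andP[x0 x2] sx; rewrite /= !in_itv/=.
  have pi0 := @pi_gt0 R.
  have s1 : sin x < d by apply: le_lt_trans sx; exact: ler_norm.
  have s2 : - sin x < d by apply: le_lt_trans sx; rewrite -normrN; exact: ler_norm.
  have [h1|h1] := leP x (pi / 2).
    have := sin_small dc _ s1; rewrite x0 h1 => /(_ isT) h; left; left; rewrite -/w in h; lra.
  have [h2|h2] := leP x pi.
    have := @sin_small d (pi - x) dc.
    rewrite (_ : sin (pi - x) = sin x); last by rewrite addrC sinDpi sinN opprK.
    rewrite -/w => h; left; right.
    have := h _ s1; move=> {}h.
    have : pi - x < w by apply: h; lra.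
    lra.
  have sE : sin (x - pi) = - sin x by rewrite -[in RHS](subrK pi x) sinDpi opprK.
  have [h3|h3] := leP (x - pi) (pi / 2).
    have := @sin_small d (x - pi) dc; rewrite sE -/w => h.
    left; right; have : x - pi < w by apply: h => //; lra.
    lra.
  have := @sin_small d (2 * pi - x) dc.
  rewrite (_ : sin (2 * pi - x) = - sin x); last by rewrite addrC sin_period sinN.
  rewrite -/w => h; right; have : 2 * pi - x < w by apply: h => //; lra.
  lra.
apply: le_trans (measureU2 leb _ _) _ => //; first exact: measurableU.
rewrite (_ : 4 * w = (w + 2 * w) + w); last by ring.
have itvE (a b : R) : a <= b -> (leb `[a, b]%classic <= (b - a)%:E)%E.
  move=> ab; rewrite /leb lebesgue_measure_itv/= lte_fin.
  by case: ltP => // _; rewrite lee_fin subr_ge0.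
rewrite !EFinD; apply: leeD; last first.
  by apply: le_trans (itvE _ _ _) _; [lra|rewrite lee_fin; lra].
apply: le_trans (measureU2 leb _ _) _ => //; apply: leeD.
  by apply: le_trans (itvE _ _ _) _; [lra|rewrite lee_fin; lra].
by apply: le_trans (itvE _ _ _) _; [lra|rewrite lee_fin; lra].
Qed.

Let I : set R := `[0, 2 * pi[%classic.

Definition kink_strip (d : R) : set (R * R * R) := [set p | `|sin p.1.1| < d].

Lemma measurable_kink_strip d : measurable (kink_strip d).
Proof.
have ms : measurable_fun setT (fun p : R * R * R => `|sin p.1.1|).
  apply: (measurableT_comp (f := fun x : R => `|x|)) => //.
  apply: (measurableT_comp (f := @sin R)).
    by apply: continuous_measurable_fun; exact: continuous_sin.
  exact: (measurableT_comp measurable_fst measurable_fst).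
have := ms measurableT `]-oo, d[%classic (measurable_itv _).
by rewrite setTI; congr measurable.
Qed.

Lemma vol_kink_strip (d : R) : 0 < d <= c1 ->
  (vol (cell `&` kink_strip d) <= (4 * (d / c1) * (2 * pi) ^+ 2)%:E)%E.
Proof.
move=> dc; have [S mS [hS lS]] := leb_sin_small dc.
apply: le_trans (_ : vol (S `*` I `*` I) <= _)%E; last first.
  rewrite vol_box//; [|exact: measurable_itv|exact: measurable_itv].
  rewrite /I !leb_circle -muleA -EFinM [leRHS](_ : _ = (4 * (d / c1))%:E * (2 * pi * (2 * pi))%:E)%E.
    by apply: lee_wpmul2r => //; rewrite lee_fin mulr_ge0// mulr_ge0// pi_ge0.
  by rewrite -EFinM expr2.
apply: le_measure; rewrite ?inE.
- by apply: measurableI; [exact: measurable_cell|exact: measurable_kink_strip].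
- by apply: measurableX; [apply: measurableX => //|]; exact: measurable_itv.
- move=> [[x y] z] [[[/= xI yI] zI] sx]; split; [split|] => //=.
  by apply: hS => //; move: xI; rewrite in_itv.
Qed.

(** The steepness for which the strips with an active cut-off have a total
    volume of at most [(2 * pi) ^+ 2 / 4]. *)
Definition mfactor : R := 8 / c1.

Lemma mfactor_ge1 : 1 <= mfactor.
Proof.
rewrite ler_pdivlMr// mul1r; apply: le_trans c1_cos _.
by apply: le_trans (cos_le1 _) _; lra.
Qed.

Definition bad_set (alpha : R) (n : nat) : set (R * R * R) :=
  orbit alpha n @^-1` kink_strip (mfactor * 2 ^+ n.+2)^-1.

(** The points at which no cut-off is active, restricted to a slab where [cos y]
    is bounded below. *)
Definition good_set (alpha : R) : set (R * R * R) :=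
  (I `*` `[0, 2^-1] `*` I) `\` \bigcup_n (cell `&` bad_set alpha n).

Lemma measurable_bad_set alpha n : measurable (bad_set alpha n).
Proof.
have [mo _ _] := vp_orbit alpha n; rewrite /bad_set -[X in measurable X]setTI.
by apply: mo => //; exact: measurable_kink_strip.
Qed.

(** By invariance of the volume, the [n]-th set is as large as the strip of
    half-width of order [(mfactor * 2 ^+ n.+2)^-1] around the kinks. *)
Lemma vol_bad_set alpha n :
  (vol (cell `&` bad_set alpha n) <= (((2 * pi) ^+ 2 / 4) / (2 ^ n.+1)%:R)%:E)%E.
Proof.
have m1 := mfactor_ge1.
have q0 : 0 < 2 ^+ n :> R by rewrite exprn_gt0.
have q1 : 1 <= 2 ^+ n :> R by rewrite exprn_ege1// ler1n.
have M0 : 0 < mfactor * 2 ^+ n.+2 by rewrite mulr_gt0// ?exprn_gt0// (lt_le_trans ltr01).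
rewrite /bad_set (cell_measure_vp (vp_orbit alpha n)); last 2 first.
- exact: measurable_kink_strip.
- by move=> x y z; rewrite /kink_strip /= sin_period.
apply: le_trans (vol_kink_strip _) _.
  rewrite invr_gt0 M0/= invf_ple ?posrE//.
  apply: le_trans (_ : mfactor <= _); first by rewrite /mfactor ler_pdivlMr// mulVf ?gt_eqF//; lra.
  rewrite ler_peMr ?(le_trans ler01)// !exprS; lra.
rewrite lee_fin le_eqVlt; apply/orP; left; apply/eqP.
rewrite natrX !exprS /mfactor; field.
by rewrite !gt_eqF.
Qed.

Lemma measurable_good_set alpha : measurable (good_set alpha).
Proof.
apply: measurableD.
  by apply: measurableX; [apply: measurableX|]; exact: measurable_itv.
apply: bigcupT_measurable => n; apply: measurableI; first exact: measurable_cell.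
exact: measurable_bad_set.
Qed.

Lemma good_set_cell alpha : good_set alpha `<=` cell.
Proof.
move=> [[x y] z] [[[/= xI yI] zI] _]; split; [split|] => //=.
by move: yI; rewrite !in_itv/= => /andP[-> ?]; have := @pi_ge2 R; lra.
Qed.

Lemma vol_good_set alpha : (((2 * pi) ^+ 2 / 4)%:E <= vol (good_set alpha))%E.
Proof.
have mU : measurable (\bigcup_n (cell `&` bad_set alpha n)).
  apply: bigcupT_measurable => n; apply: measurableI; first exact: measurable_cell.
  exact: measurable_bad_set.
have mY : measurable (I `*` `[0, 2^-1] `*` I : set (R * R * R)).
  by apply: measurableX; [apply: measurableX|]; exact: measurable_itv.
have e0 : 0 <= (2 * pi) ^+ 2 / 4 :> R by rewrite divr_ge0// sqr_ge0.
have vU : (vol (\bigcup_n (cell `&` bad_set alpha n)) <= ((2 * pi) ^+ 2 / 4)%:E)%E.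
  apply: le_trans (epsilon_trick0 xpredT e0).
  apply: le_trans (_ : \sum_(n <oo) vol (cell `&` bad_set alpha n) <= _)%E.
    apply: measure_sigma_subadditive => // n.
    by apply: measurableI; [exact: measurable_cell|exact: measurable_bad_set].
  by apply: lee_nneseries => // n _; exact: vol_bad_set.
have vY : vol (I `*` `[0, 2^-1] `*` I : set (R * R * R)) = ((2 * pi) ^+ 2 / 2)%:E.
  rewrite vol_box//; [|exact: measurable_itv|exact: measurable_itv].
  rewrite /I leb_circle /leb lebesgue_measure_itv/= lte_fin invr_gt0 ltr0n/=.
  by rewrite -EFinB -!EFinM; congr (_%:E); field.
have : (((2 * pi) ^+ 2 / 2)%:E <= vol (good_set alpha) + ((2 * pi) ^+ 2 / 4)%:E)%E.
  rewrite -vY; apply: le_trans (_ : vol (good_set alpha) +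
      vol (\bigcup_n (cell `&` bad_set alpha n)) <= _)%E; last first.
    by apply: leeD.
  apply: le_trans (measureU2 vol (measurable_good_set alpha) mU).
  apply: le_measure; rewrite ?inE//; first exact: measurableU (measurable_good_set alpha) mU.
  move=> p Yp; case: (pselect ((\bigcup_n (cell `&` bad_set alpha n)) p)) => h.
    by right.
  by left.
rewrite -leeBlDr// -EFinB; apply: le_trans.
by rewrite lee_fin; lra.
Qed.

Lemma good_setP alpha p : good_set alpha p ->
  cos 2^-1 <= cos p.1.2 /\
  forall n, 1 <= (mfactor * 2 ^+ n.+2 * sin (coordinate alpha n.+2 p)) ^+ 2.
Proof.
move=> Gp; have cp := good_set_cell Gp; move: Gp => [[[_ /= yI] _] nbad]; split.
  move: yI; rewrite in_itv/= => /andP[y0 y2].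
  rewrite leNgt ltr_cos ?in_itv/= -?leNgt//; have := @pi_ge2 R; lra.
move=> n; have M0 : 0 < mfactor * 2 ^+ n.+2.
  by rewrite mulr_gt0// ?exprn_gt0// (lt_le_trans ltr01 mfactor_ge1).
have h : (mfactor * 2 ^+ n.+2)^-1 <= `|sin (coordinate alpha n.+2 p)|.
  rewrite leNgt; apply/negP => hb; apply: nbad; exists n => //; split => //.
rewrite -(real_normK (num_real _)) exprn_ege1// normrM gtr0_norm//.
by rewrite -ler_pdivrMl// mulr1.
Qed.

End good_set.

(** * The transported field *)

Section solution.
Context {R : realType} (alpha m : R).
Hypothesis alpha20 : 20 <= alpha.
Hypothesis m1 : 1 <= m.
Implicit Types (p q v : R * R * R) (t : R).

Local Notation B0 := (unstable_field alpha m).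

Definition transported t p : R * R * R := dflow alpha t (unflow alpha t p) (B0 (unflow alpha t p)).

Lemma measurable_dflow t : measurable_fun setT (fun p => dflow alpha t p (B0 p)).
Proof.
rewrite /dflow; set n := Num.truncn (3 * t).
have mB := measurable_tangent alpha n (measurable_unstable_field alpha20 m1).
have m11 := measurableT_comp measurable_fst (measurableT_comp measurable_fst mB).
have m1' := measurableT_comp measurable_fst mB.
have m2 := measurableT_comp measurable_snd mB.
have [mr _ _] := vp_iter n (@vp_rot R).
apply: (measurableT_comp mr).
apply: measurable_fun_pair => //.
apply: measurable_funB => //; apply: measurable_funM => //.
by apply: measurable_funM => //; exact: measurable_slopes.
Qed.

Lemma transported_torus t : torus_field (transported t).
Proof.
have [mu pu _] := vp_unflow alpha t; split; last first.
  exact: (measurableT_comp (measurable_dflow t) mu).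
apply: (pu _ (fun p => dflow alpha t p (B0 p))) => x y z.
have [s _ _] := dynamics_periodic alpha m; have [s1 s2 s3] := s x y z.
have [b1 b2 b3] := unstable_field_periodic alpha m x y z.
by rewrite /dflow s1 s2 s3 b1 b2 b3.
Qed.

Lemma ae_transportedE t : {ae vol, forall x, cell x ->
  differentiable (flow alpha t) (unflow alpha t x) /\
  transported t x = 'd (flow alpha t) (unflow alpha t x) (B0 (unflow alpha t x))}.
Proof.
apply: filterS (ae_regular_vp alpha (vp_unflow alpha t)) => x h cx.
by have [d dE] := is_diff_flow (h cx (Num.truncn (3 * t)).+1); rewrite dE.
Qed.

Lemma lagrangian_transported : lagrangian_solution (velocity_rev alpha) B0 transported.
Proof.
exists (flow alpha), (unflow alpha); split; first exact: flow_is_flow.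
move=> t t0; split; [exact: flowK|exact: unflowK|exact: transported_torus|exact: ae_transportedE].
Qed.

(** A solution is determined by its flow, and the flow is unique. *)
Lemma lagrangian_unique B : lagrangian_solution (velocity_rev alpha) B0 B ->
  forall t, 0 <= t -> torus_field (B t) /\
    {ae vol, forall x, cell x -> B t x = transported t x}.
Proof.
move=> [phi [psi [Phi sol]]] t t0; have [K1 K2 BT BE] := sol t t0; split => //.
have phiE : phi t = flow alpha t by apply/funext => p; exact: flow_unique.
have psiE : psi t = unflow alpha t.
  by apply/funext => p; rewrite -{1}[p](unflowK alpha t) -phiE K1.
have E := ae_transportedE t; rewrite phiE psiE in BE.
by apply: filterS2 BE E => x h1 h2 cx; have [_ ->] := h1 cx; have [_ ->] := h2 cx.
Qed.

(** [n.+1] exceeds [3 * t], whence the factor 4. *)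
Lemma geometric_decay n t : 3 * t <= n.+1%:R -> (4 ^+ n)^-1 <= 4 * expR (- (3 * ln 4) * t).
Proof.
move=> tn; have E : expR (ln 4) = 4 :> R by rewrite lnK// posrE.
have l0 : 0 <= ln 4 :> R by rewrite ln_ge0// ler1n.
rewrite (_ : (4 ^+ n)^-1 = expR (- (ln 4 * n%:R))); last by rewrite expRN expRM_natr E.
rewrite (_ : 4 * expR _ = expR (ln 4 - 3 * ln 4 * t)); last by rewrite mulNr expRD E.
rewrite ler_expR.
have := ler_wpM2l l0 tn; rewrite -natr1; set l := ln 4 in E l0 *; nra.
Qed.

(** The last, possibly incomplete, shear increases the norm by a factor of at
    most [1 + alpha]. *)
Lemma dflow_decay t p : 0 <= t ->
  `|dflow alpha t p (B0 p)| <= (1 + alpha) * (64 * (4 * m)) * 4 * expR (- (3 * ln 4) * t).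
Proof.
move=> t0; rewrite /dflow iter_rot_norm tangentE.
have t3 : 0 <= 3 * t by rewrite mulr_ge0.
have /andP[n1 n2] := truncn_itv t3.
move: n1 n2; set n := Num.truncn (3 * t) => n1 n2; set r := 3 * t - n%:R.
have r0 : 0 <= r by rewrite subr_ge0.
have r1 : r <= 1 by rewrite lerBlDr addrC natr1 ltW.
set D : R := 64 * (4 * m).
have D0 : 0 <= D by rewrite !mulr_ge0// (le_trans ler01).
have bnd k : (n <= k)%N -> `|sol alpha (slopes alpha p) (B0 p) k| <= D / 4 ^+ n.
  move=> nk; apply: le_trans (sol_unstable_field alpha20 m1 p k) _.
  rewrite -/D ler_wpM2l// lef_pV2 ?posrE ?exprn_gt0//.
  by rewrite ler_eXn2l// ltr1n.
have a0 : 0 <= alpha by apply: le_trans alpha20.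
have hs : `|slopes alpha p n| <= 1.
  by rewrite /slopes hslope_norm.
have F0 : 0 <= D / 4 ^+ n by rewrite divr_ge0// exprn_ge0.
have main : `|dshear (r * alpha * slopes alpha p n)
    (sol alpha (slopes alpha p) (B0 p) n.+2, sol alpha (slopes alpha p) (B0 p) n.+1,
     sol alpha (slopes alpha p) (B0 p) n)| <= (1 + alpha) * (D / 4 ^+ n).
  have le1 : D / 4 ^+ n <= (1 + alpha) * (D / 4 ^+ n) by rewrite ler_peMl//; lra.
  rewrite sup_norm_le/=.
  rewrite !(le_trans (bnd _ _) le1) ?leqW//=.
  apply: le_trans (ler_normB _ _) _; rewrite [leRHS]mulrDl mul1r; apply: lerD; first exact: bnd.
  rewrite normrM; apply: ler_pM => //; last by apply: bnd; rewrite !leqW.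
  rewrite !normrM (ger0_norm r0) (ger0_norm a0).
  by rewrite -[leRHS]mul1r mulrAC ler_pM// ?mulr_ge0//; rewrite -[leRHS]mulr1 ler_pM.
apply: le_trans main _.
rewrite -!(mulrA (1 + alpha)) -(mulrA D).
rewrite ler_wpM2l ?addr_ge0// ler_wpM2l//.
exact: geometric_decay (ltW n2).
Qed.

Lemma enorm_transported_decay t : 0 <= t -> forall p,
  enorm (transported t p) <= 2 * ((1 + alpha) * (64 * (4 * m)) * 4 * expR (- (3 * ln 4) * t)).
Proof.
move=> t0 p; apply: le_trans (enorm_le _) _; rewrite ler_wpM2l//.
exact: dflow_decay.
Qed.

End solution.

Theorem theorem1p2 (R : realType) :
  exists alpha0 : R, 0 < alpha0 /\
    forall alpha : R, alpha0 <= alpha ->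
      exists (B0 : R * R * R -> R * R * R) (lambda2 C : R),
        [/\ torus_Linfty B0, ~ ae_zero B0, div_free B0 & mean_free B0] /\
        [/\ 0 < lambda2, 0 < C,
            exists B, lagrangian_solution (velocity_rev alpha) B0 B
          & forall (p : \bar R) (B : R -> R * R * R -> R * R * R),
              (1 <= p)%E ->
              lagrangian_solution (velocity_rev alpha) B0 B ->
              forall t : R, 0 <= t ->
                (torus_Lnorm p (B t) <=
                 (C * expR (- lambda2 * t))%:E * torus_Lnorm p B0)%E].
Proof.
(* any constant above the [16 + 1 / 4] of the maximum principle would do *)
exists 20; split => // alpha alpha20.
have [m mE m1] : exists2 m : R, m = mfactor & 1 <= m by exists mfactor; last exact: mfactor_ge1.
pose B0 := unstable_field alpha m.
pose c : R := cos 2^-1; pose v : R := (2 * pi) ^+ 2 / 4; pose V : R := (2 * pi) ^+ 3.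
have pi0 := @pi_gt0 R.
have c0 : 0 < c by apply: cos_gt0_pihalf; have := @pihalf_ge1 R; lra.
have v0 : 0 < v by rewrite divr_gt0// exprn_gt0// mulr_gt0.
have V0 : 0 < V by rewrite exprn_gt0// mulr_gt0.
have good p : good_set alpha p -> c <= enorm (B0 p).
  move=> /good_setP; rewrite -mE => -[cy nk]; apply: le_trans (le_enorm _).
  rewrite /B0 (unstable_field_good nk) normrN.
  by apply: le_trans (ler_norm _).
pose M := 2 * ((1 + alpha) * (64 * (4 * m)) * 4).
have m0 : 0 < m by apply: lt_le_trans m1.
have M0 : 0 < M.
  rewrite !mulr_gt0//.
  by rewrite (lt_le_trans ltr01)// lerDl (le_trans _ alpha20).
exists B0, (3 * ln 4), (M / c * (V / v)); split; split.
- split; first exact: unstable_field_torus.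
  apply: le_lt_trans (ltry (2 * (64 * m))).
  apply: torus_Lnorm_infty_le; first by rewrite !mulr_ge0// ltW.
  apply: aeW => x _; apply: le_trans (enorm_le _) _; rewrite ler_wpM2l// sup_norm_le.
  by have [-> -> ->] := unstable_field_bound alpha20 m1 x.
- move=> [N [mN N0 BN]].
  have : (vol (good_set alpha) <= 0)%E.
    rewrite -N0; apply: le_measure; rewrite ?inE//; first exact: measurable_good_set.
    move=> x gx; apply: BN => /= /(_ (good_set_cell gx)) B00.
    have := good x gx; rewrite B00 /enorm /dot /= !mulr0 !addr0 sqrtr0.
    by rewrite leNgt c0.
  by rewrite leNgt (lt_le_trans _ (vol_good_set alpha))// lte_fin.
- exact: unstable_field_div_free.
- exact: unstable_field_mean_free.
- by rewrite mulr_gt0// ln_gt0// ltr1n.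
- by rewrite mulr_gt0// divr_gt0.
- by exists (transported alpha m); exact: lagrangian_transported.
move=> p B p1 sB t t0.
have [[_ mB] BE] := lagrangian_unique sB t0.
pose K := M * expR (- (3 * ln 4) * t).
have -> : M / c * (V / v) * expR (- (3 * ln 4) * t) = K / c * (V / v).
  by rewrite /K; ring.
apply: (@torus_Lnorm_compare R (B t) B0 K c v (good_set alpha)) => //.
- exact: measurable_unstable_field.
- by rewrite mulr_ge0 ?expR_ge0// ltW.
- exact: measurable_good_set.
- exact: good_set_cell.
- exact: vol_good_set.
- apply: filterS BE => x h cx; rewrite h// /K /M -!(mulrA 2).
  exact: enorm_transported_decay.
Qed.
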